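(* Let $1\le r\le p$. Suppose $W_Y=OW_{YO}O^\top$, $V_B=OV_{O^\top BO}O^\top$ and $W_B=OW_{O^\top BO}O^\top$ hold for all $Y\in\mathbb{R}^{p\times r}_*$, $B\in\mathbb{S}_+(r)$ and $O\in\mathbb{O}_r$. Then: (a) Given $Y\in\mathbb{R}^{p\times r}_*$, $U\in\mathrm{St}(r,p)$, $B\in\mathbb{S}_+(r)$: if $[Y]$ (resp. $[U,B]$) is a Riemannian FOSP, or SOSP, or strict saddle of $\min_{[Y]\in\mathcal{M}^{q_1}_{r+}}h_{r+}([Y])$ (resp. $\min_{[U,B]\in\mathcal{M}^{q_2}_{r+}}h_{r+}([U,B])$), then $X=YY^\top$ (resp. $X=UBU^\top$) is a Riemannian FOSP, or SOSP, or strict saddle, respectively, of $\min_{X\in\mathcal{M}^e_{r+}}f(X)$. (b) If $X$ is a Riemannian FOSP, or SOSP, or strict saddle of $\min_{X\in\mathcal{M}^e_{r+}}f(X)$, then there is a unique $[Y]$ (resp. $[U,B]$) such that $YY^\top=X$ (resp. $UBU^\top=X$), and it is a Riemannian FOSP, or SOSP, or strict saddle, respectively, of $\min h_{r+}([Y])$ on $\mathcal{M}^{q_1}_{r+}$ (resp. $\min h_{r+}([U,B])$ on $\mathcal{M}^{q_2}_{r+}$).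
   Context: Notation: $\mathbb{R}^{p\times r}_*$ = full-column-rank $p\times r$ matrices; $\mathrm{St}(r,p)$ = $p\times r$ matrices with orthonormal columns; $\mathbb{O}_r$ = $r\times r$ orthogonal matrices; $\mathbb{S}^{r\times r}$, $\mathbb{S}_+(r)$ = symmetric, resp. symmetric positive definite, $r\times r$ matrices; $U_\perp$ = orthonormal complement of $U$. $f:\mathbb{R}^{p\times p}\to\mathbb{R}$ is twice continuously differentiable with $f(X)=f(X^\top)$. For a function on a Riemannian manifold, a point is a Riemannian FOSP if the Riemannian gradient vanishes there; a Riemannian SOSP if moreover the Riemannian Hessian is positive semidefinite; a strict saddle if it is a FOSP at which the Riemannian Hessian has a strictly negative eigenvalue. Embedded geometry: $\mathcal{M}^e_{r+}=\{X\in\mathbb{S}^{p\times p}:\operatorname{rank}X=r,\ X\succeq0\}\subset\mathbb{R}^{p\times p}$ with the metric induced by the Euclidean inner product. Quotient geometries: for a total space $\overline{\mathcal{M}}$ with metric $\bar g$, an equivalence relation with quotient map $\pi$ and a horizontal space at each point, the quotient metric is $g(\eta,\theta)=\bar g(\bar\eta,\bar\theta)$, where $\bar\eta,\bar\theta$ are horizontal lifts (the unique horizontal vectors mapped to $\eta,\theta$ by $\mathrm{D}\pi$). - $\mathcal{M}^{q_1}_{r+}=\mathbb{R}^{p\times r}_*/\mathbb{O}_r$, $[Y]=\{YO:O\in\mathbb{O}_r\}$, $\bar g^{r+}_Y(\eta,\theta)=\operatorname{tr}(W_Y\eta^\top\theta)$, $W_Y\in\mathbb{S}_+(r)$ smooth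 in $Y$; horizontal space $\{(US+U_\perp D)P^{-\top}:SP^{-\top}W_YP^{-1}\in\mathbb{S}^{r\times r},\ D\in\mathbb{R}^{(p-r)\times r}\}$, where $U\in\mathrm{St}(r,p)$ spans the column space of $Y$ and $P=U^\top Y$. $h_{r+}([Y])=f(YY^\top)$. - $\mathcal{M}^{q_2}_{r+}=(\mathrm{St}(r,p)\times\mathbb{S}_+(r))/\mathbb{O}_r$, $[U,B]=\{(UO,O^\top BO):O\in\mathbb{O}_r\}$, $\bar g^{r+}_{(U,B)}(\eta,\theta)=\operatorname{tr}(V_B\eta_U^\top\theta_U)+\operatorname{tr}(W_B\eta_BW_B\theta_B)$, $V_B,W_B\in\mathbb{S}_+(r)$ smooth in $B$; horizontal space $\{(\theta_U,\theta_B):\theta_U=U_\perp D,\ D\in\mathbb{R}^{(p-r)\times r},\ \theta_B\in\mathbb{S}^{r\times r}\}$. $h_{r+}([U,B])=f(UBU^\top)$. (The weight functions $Y\mapsto W_Y$ and $B\mapsto W_B$ are unrelated.) *)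

(* Defs.v *)
From HB Require Import structures.
From mathcomp Require Export all_boot all_order all_algebra.
From mathcomp Require Export all_classical all_reals all_analysis.
Export Order.TTheory GRing.Theory Num.Theory.
Export numFieldNormedType.Exports.

Set Implicit Arguments.
Unset Strict Implicit.
Unset Printing Implicit Defensive.

Local Open Scope classical_set_scope.
Local Open Scope ring_scope.

Section Smoothness.
Context {R : realType} {V W : normedModType R}.

(* [Ck k A F] : F is of class C^k on the open set A.  The k-th differential is
   reached through the directional maps x |-> dF(x)[v]; since each of them is
   again required to be differentiable (resp. continuous), this is the usual
   notion when V is finite-dimensional. *)
Fixpoint Ck (k : nat) (A : set V) (F : V -> W) : Prop :=
  match k with
  | 0 => forall x, A x -> {for x, continuous F}
  | k'.+1 => (forall x, A x -> differentiable F x) /\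
             (forall v : V, Ck k' A (fun x => 'd F x v))
  end.

Definition Cinf (A : set V) (F : V -> W) : Prop := forall k, Ck k A F.

(* Smoothness on a subset that need not be open (such as the positive definite
   matrices inside all square matrices): local existence of smooth extensions. *)
Definition smooth_on (A : set V) (F : V -> W) : Prop :=
  forall x, A x -> exists (B : set V) (G : V -> W),
    [/\ open_nbhs x B, Cinf B G & forall y, A y -> B y -> F y = G y].

End Smoothness.

Section Coordinates.
Context {R : realType} (d : nat).
Variables (G : 'rV[R]_d -> 'M[R]_d) (h : 'rV[R]_d -> R).

Definition partial (i : 'I_d) (F : 'rV[R]_d -> R) (u : 'rV[R]_d) : R :=
  'D_('e_i) F u.

(* (grad h)^k = sum_l G^{kl} d_l h *)
Definition coord_grad (u : 'rV[R]_d) : 'rV[R]_d :=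
  \row_k \sum_l invmx (G u) k l * partial l h u.

(* Levi-Civita connection: Gamma^k_{ij}. *)
Definition christoffel (k i j : 'I_d) (u : 'rV[R]_d) : R :=
  2^-1 * \sum_l invmx (G u) k l *
    (partial i (fun w => G w j l) u + partial j (fun w => G w i l) u
     - partial l (fun w => G w i j) u).

(* Matrix of xi |-> nabla_xi (grad h), acting on row vectors: row i holds the
   coordinates of the covariant derivative of grad h along the i-th coordinate
   field. *)
Definition coord_hess (u : 'rV[R]_d) : 'M[R]_d :=
  \matrix_(i, k) (partial i (fun w => coord_grad w 0 k) u
                  + \sum_j christoffel k i j u * coord_grad u 0 j).

End Coordinates.

Section Geometry.
Context {R : realType}.

(* A quotient manifold [total] / ~ of a submanifold [total] of E, with
   [cls y] the equivalence class of y.  Points of the quotient are the classes.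
   An embedded submanifold is the quotient by equality. *)
Record geometry (E : normedModType R) := Geometry {
  total : set E ;
  cls : E -> set E ;
  metric : E -> E -> E -> R ;
  horizontal : E -> set E
}.

(* Velocities at x of curves in A. *)
Definition tangent_space {E : normedModType R} (A : set E) (x : E) : set E :=
  [set v | exists c : R -> E,
     [/\ c 0 = x, \forall t \near (0 : R), A (c t) & is_derive (0 : R) 1 c v]].

Section Notions.
Context {E : normedModType R} (M : geometry E).

Definition point (c : set E) : Prop := exists2 y, total M y & c = cls M y.

(* The vertical space ker (D pi)(y) is the tangent space of the fibre. *)
Definition vertical (y : E) : set E := tangent_space (cls M y) y.

(* The horizontal vector with the same image under D pi as v. *)
Definition hlift (y v : E) : E :=
  xget 0 [set eta | horizontal M y eta /\ vertical y (v - eta)].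

(* The lift at psi u of D(pi \o psi)(u)[a]. *)
Definition chart_vec {d : nat} (psi : 'rV[R]_d -> E) (u a : 'rV[R]_d) : E :=
  hlift (psi u) ('d psi u a).

(* psi is a smooth map into the total space near 0, and pi \o psi is a local
   diffeomorphism onto a neighbourhood of c in the quotient, sending 0 to c: its
   differential is a bijection onto the tangent space (seen as the horizontal
   space).  Thus pi \o psi is the inverse of a chart at c. *)
Definition local_param (c : set E) {d : nat} (psi : 'rV[R]_d -> E) : Prop :=
  [/\ total M (psi 0), cls M (psi 0) = c &
   exists B : set 'rV[R]_d,
     [/\ open_nbhs (0 : 'rV[R]_d) B, Cinf B psi, forall u, B u -> total M (psi u) &
      forall u, B u ->
        set_bij [set: 'rV[R]_d] (horizontal M (psi u)) (chart_vec psi u)]].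

Definition gram {d : nat} (psi : 'rV[R]_d -> E) (u : 'rV[R]_d) : 'M[R]_d :=
  \matrix_(i, j) metric M (psi u) (chart_vec psi u 'e_i) (chart_vec psi u 'e_j).

(* Below, h : E -> R is the lift of the objective function to the total space.
   Gradient and Hessian are tensors, so the choice of the parametrization is
   immaterial. *)

Definition FOSP (h : E -> R) (c : set E) : Prop :=
  point c /\ exists (d : nat) (psi : 'rV[R]_d -> E),
    local_param c psi /\ coord_grad (gram psi) (h \o psi) 0 = 0.

Definition SOSP (h : E -> R) (c : set E) : Prop :=
  point c /\ exists (d : nat) (psi : 'rV[R]_d -> E),
    [/\ local_param c psi, coord_grad (gram psi) (h \o psi) 0 = 0 &
     forall a : 'rV[R]_d,
       0 <= (a *m coord_hess (gram psi) (h \o psi) 0 *m gram psi 0 *m a^T) 0 0].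

Definition strict_saddle (h : E -> R) (c : set E) : Prop :=
  point c /\ exists (d : nat) (psi : 'rV[R]_d -> E),
    [/\ local_param c psi, coord_grad (gram psi) (h \o psi) 0 = 0 &
     exists2 a : R, a < 0 & eigenvalue (coord_hess (gram psi) (h \o psi) 0) a].

(* c is the class of some y with q y = X. *)
Definition class_over {T : Type} (q : E -> T) (X : T) (c : set E) : Prop :=
  exists2 y, total M y & c = cls M y /\ q y = X.

End Notions.

Definition stiefel (p r : nat) : set 'M[R]_(p, r) :=
  [set U | U^T *m U = 1%:M].

Definition orthogonal_mx (r : nat) : set 'M[R]_r := [set Q | Q^T *m Q = 1%:M].

Definition full_col_rank (p r : nat) : set 'M[R]_(p, r) :=
  [set Y | \rank Y = r].

Definition sym_mx (r : nat) : set 'M[R]_r := [set A | A^T = A].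

Definition posdef (r : nat) : set 'M[R]_r :=
  [set A | sym_mx A /\ forall x : 'cV[R]_r, x != 0 -> 0 < (x^T *m A *m x) 0 0].

Definition possemidef (r : nat) : set 'M[R]_r :=
  [set A | sym_mx A /\ forall x : 'cV[R]_r, 0 <= (x^T *m A *m x) 0 0].

(* Uc is an orthonormal complement of U. *)
Definition orth_compl (p r : nat) (U : 'M[R]_(p, r)) (Uc : 'M[R]_(p, p - r)) :=
  stiefel Uc /\ U^T *m Uc = 0.

Definition psd_rank (p r : nat) : set 'M[R]_p :=
  [set X | [/\ sym_mx X, \rank X = r & possemidef X]].

Definition Me (p r : nat) : geometry 'M[R]_p :=
  {| total := @psd_rank p r ;
     cls := fun X => [set X] ;
     metric := fun _ eta theta => \tr (eta^T *m theta) ;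
     horizontal := tangent_space (@psd_rank p r) |}.

Definition Mq1 (p r : nat) (W : 'M[R]_(p, r) -> 'M[R]_r) :
    geometry 'M[R]_(p, r) :=
  {| total := @full_col_rank p r ;
     cls := fun Y => [set Y *m Q | Q in @orthogonal_mx r] ;
     metric := fun Y eta theta => \tr (W Y *m eta^T *m theta) ;
     horizontal := fun Y =>
       [set eta | exists (U : 'M[R]_(p, r)) (Uc : 'M[R]_(p, p - r))
                         (S : 'M[R]_r) (D : 'M[R]_(p - r, r)),
          let P := U^T *m Y in
          [/\ stiefel U, (U^T == Y^T)%MS, orth_compl U Uc,
              sym_mx (S *m (invmx P)^T *m W Y *m invmx P) &
              eta = (U *m S + Uc *m D) *m (invmx P)^T]] |}.

Definition Mq2 (p r : nat) (V W : 'M[R]_r -> 'M[R]_r) :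
    geometry ('M[R]_(p, r) * 'M[R]_r)%type :=
  {| total := [set z | stiefel z.1 /\ posdef z.2] ;
     cls := fun z =>
       [set (z.1 *m Q, Q^T *m z.2 *m Q) | Q in @orthogonal_mx r] ;
     metric := fun z eta theta =>
       \tr (V z.2 *m eta.1^T *m theta.1)
       + \tr (W z.2 *m eta.2 *m W z.2 *m theta.2) ;
     horizontal := fun z =>
       [set theta | exists (Uc : 'M[R]_(p, p - r)) (D : 'M[R]_(p - r, r)),
          [/\ orth_compl z.1 Uc, theta.1 = Uc *m D & sym_mx theta.2]] |}.

Definition gram_map (p r : nat) (Y : 'M[R]_(p, r)) : 'M[R]_p := Y *m Y^T.

Definition polar_map (p r : nat) (z : 'M[R]_(p, r) * 'M[R]_r) : 'M[R]_p :=
  z.1 *m z.2 *m z.1^T.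

End Geometry.

(* Main.v *)
(** Read in a chart psi of either quotient, the lifted objective f o pi is the same
    function as f read in the chart pi o psi of the embedded manifold, where pi is
    Y |-> Y Y^T or (U, B) |-> U B U^T; only the metric differs.  At a critical point
    the Riemannian Hessian is H G^-1, with H the matrix of second partial
    derivatives, which does not involve the metric, and G the Gram matrix.  Hence
    being a first-order point says that the partial derivatives vanish, being a
    second-order point that moreover H is positive semidefinite, and, since H is
    symmetric, being a strict saddle that H takes a negative value.  Conversely a
    chart phi of the embedded manifold at X = Y0 Y0^T lifts along the smooth
    sections phi Y0 L with L L^T = (Y0^T phi Y0)^-1, respectively U = phi Y0 L with
    L L^T = (Y0^T phi^2 Y0)^-1 and B = U^T phi U, where L is a Cholesky factor. *)

From HB Require Import structures.
Require Import Defs.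
From mathcomp Require Import ring lra.

Set Implicit Arguments.
Unset Strict Implicit.
Unset Printing Implicit Defensive.

Local Open Scope classical_set_scope.
Local Open Scope ring_scope.

(** * Functions of class C^k *)

(** All three notions ask for some chart at the point, so it suffices to carry the given chart
    across: by composing it with [pi] for (a), by lifting it along a smooth local section of [pi]
    for (b). The obstacle is that [hlift] is defined by choice, which hides how a lift depends on
    the base point. [models] therefore asks for a closed formula [hl]; it comes from a
    Sylvester-type equation for the first quotient and from U^T v_U for the second. It makes chart
    vectors linear and the Gram matrix G continuous. Continuity is enough to get H G^-1: where the
    partial derivatives vanish, differentiating G^-1 times the partials only differentiates the
    partials, and the Christoffel symbols multiply a zero gradient. The embedded manifold satisfies
    [models] with [pi] the identity, so both sides are treated at once. The matrix H G^-1 is not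
    symmetric; a negative eigenvalue is produced by minimising the Rayleigh quotient of H against G.
    Cholesky factors are chosen because they only involve field operations and square roots of
    positive pivots, hence stay smooth in a parameter. *)

Lemma open_near (T : topologicalType) (A : set T) (x : T) :
  open A -> A x -> \near x, A x.
Proof. by move=> oA Ax; apply: open_nbhs_nbhs. Qed.

Section NearDiff.
Context {R : realType} {V W : normedModType R}.

(** The first-order expansion of [F] at [x] is also one of [G], since it only involves values near
    [x]; uniqueness of the continuous linear part then identifies the differentials. *)
Lemma near_eq_diff (F G : V -> W) (x : V) :
  (\near x, F x = G x) -> differentiable F x ->
  differentiable G x /\ 'd G x = 'd F x :> (V -> W).
Proof.
move=> FG dF.
have key : G \o shift x = cst (G x) + 'd F x +o_ 0 id.
  apply/eqaddoP => e e0.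
  have /eqaddoP/(_ _ e0) FE := diff_locally dF.
  have FG0 : \forall y \near (0 : V), F (y + x) = G (y + x).
    by move: FG; rewrite (near_shift (0 : V) x) /= subr0.
  near=> y.
  have -> : (G \o shift x - (cst (G x) + 'd F x)) y
            = (F \o shift x - (cst (F x) + 'd F x)) y.
    rewrite /= -[LHS]/(G (y + x) - (G x + 'd F x y)).
    rewrite -[RHS]/(F (y + x) - (F x + 'd F x y)) (nbhs_singleton FG).
    by congr (_ - _); apply/esym; near: y.
  by near: y.
have dE : 'd G x = 'd F x :> (V -> W).
  by apply: diff_unique key; exact: diff_continuous.
split=> //; apply/diff_locallyP; rewrite dE; split=> //.
exact: diff_continuous.
Unshelve. all: by end_near. Qed.

Lemma Ck_continuous k (A : set V) (F : V -> W) x :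
  Ck k A F -> A x -> {for x, continuous F}.
Proof.
case: k => [|k] /=; first exact.
by case=> dF _ Ax; apply: differentiable_continuous; exact: dF.
Qed.

Lemma Ck_le k l (A : set V) (F : V -> W) : (l <= k)%N -> Ck k A F -> Ck l A F.
Proof.
elim: l k F => [|l IH] [|k] F //=.
- by move=> _ [dF _] x Ax; apply: differentiable_continuous; exact: dF.
- by move=> lk [dF cF]; split=> // v; apply: IH (cF v).
Qed.

(** Openness of [A] turns equality on [A] into equality of germs, so the differentials agree on [A]
    and the recursion applies to them. *)
Lemma Ck_ext k (A : set V) (F G : V -> W) :
  open A -> (forall x, A x -> F x = G x) -> Ck k A F -> Ck k A G.
Proof.
move=> oA; elim: k F G => [|k IH] F G FG /=.
  move=> cF x Ax; have nFG : \near x, F x = G x.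
    by near=> y; apply: FG; near: y; exact: open_near.
  rewrite /prop_for /continuous_at -(FG _ Ax); apply: cvg_trans (cF x Ax).
  exact: near_eq_cvg.
move=> [dF cF].
have dFG x : A x -> differentiable G x /\ 'd G x = 'd F x :> (V -> W).
  move=> Ax; apply: near_eq_diff (dF _ Ax).
  by near=> y; apply: FG; near: y; exact: open_near.
split=> [x /dFG[] //|v].
by apply: IH (cF v) => x /dFG [_ ->].
Unshelve. all: by end_near. Qed.

Lemma Ck_sub k (A B : set V) (F : V -> W) : B `<=` A -> Ck k A F -> Ck k B F.
Proof.
move=> BA; elim: k F => [|k IH] F /=; first by move=> cF x /BA; exact: cF.
by move=> [dF cF]; split=> [x /BA|v]; [exact: dF|exact/IH/cF].
Qed.

Lemma Ck_cst k (A : set V) (w : W) : Ck k A (cst w : V -> W).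
Proof.
elim: k w => [|k IH] w /=; first by move=> x _; exact: cst_continuous.
split=> [x _|v]; first exact: differentiable_cst.
rewrite (_ : (fun x => _) = cst 0); first exact: IH.
by apply/funext => x; rewrite diff_cst.
Qed.

Lemma CkD k (A : set V) (F G : V -> W) : Ck k A F -> Ck k A G -> open A ->
  Ck k A (fun x => F x + G x).
Proof.
move=> + + oA; elim: k F G => [|k IH] F G /=.
  by move=> cF cG x Ax; apply: continuousD; [exact: cF|exact: cG].
move=> [dF cF] [dG cG]; split=> [x Ax|v].
  by apply: differentiableD; [exact: dF|exact: dG].
apply: Ck_ext (IH _ _ (cF v) (cG v)) => // x Ax.
exact: (esym (congr1 (@^~ v) (diffD (dF _ Ax) (dG _ Ax)))).
Qed.

Lemma Ck_sum k (A : set V) (I : Type) (s : seq I) (P : pred I) (F : I -> V -> W) :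
  open A -> (forall i, P i -> Ck k A (F i)) ->
  Ck k A (fun x => \sum_(i <- s | P i) F i x).
Proof.
move=> oA FC; elim: s => [|i s IH].
  rewrite (_ : (fun x => _) = cst 0); first exact: Ck_cst.
  by apply/funext => x; rewrite big_nil.
case Pi: (P i); last first.
  rewrite (_ : (fun x => _) = (fun x => \sum_(i <- s | P i) F i x)) //.
  by apply/funext => x; rewrite big_cons Pi.
rewrite (_ : (fun x => _) = (fun x => F i x + \sum_(i <- s | P i) F i x)).
  by apply: CkD => //; exact: FC.
by apply/funext => x; rewrite big_cons Pi.
Qed.

End NearDiff.

Section CkLinear.
Context {R : realType} {V W Z : normedModType R}.

Lemma Ck_lin k (A : set V) (F : V -> W) (g : {linear W -> Z}) :
  continuous g -> Ck k A F -> open A -> Ck k A (fun x => g (F x)).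
Proof.
move=> cg + oA; elim: k F => [|k IH] F /=.
  by move=> cF x Ax; apply: continuous_comp; [exact: cF|exact: cg].
move=> [dF cF]; have dg y : differentiable g y by exact: linear_differentiable.
split=> [x Ax|v]; first exact: (differentiable_comp (dF _ Ax) (dg _)).
apply: Ck_ext (IH _ (cF v)) => // x Ax.
rewrite (_ : (fun x => g (F x)) = g \o F) //.
by rewrite (diff_comp (dF _ Ax) (dg _)) /= diff_lin.
Qed.

End CkLinear.

Section CkScalar.
Context {R : realType} {V : normedModType R}.

Lemma CkM k (A : set V) (F G : V -> R) : Ck k A F -> Ck k A G -> open A ->
  Ck k A (fun x => F x * G x).
Proof.
move=> + + oA; elim: k F G => [|k IH] F G.
  by move=> cF cG x Ax; apply: continuousM; [exact: cF|exact: cG].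
move=> FC GC; case: (FC) => dF cF; case: (GC) => dG cG.
split=> [x Ax|v].
  by apply: differentiableM; [exact: dF|exact: dG].
have FC' := Ck_le (leqnSn k) FC; have GC' := Ck_le (leqnSn k) GC.
apply: (Ck_ext oA) (CkD (IH _ _ FC' (cG v)) (IH _ _ GC' (cF v)) oA) => x Ax.
exact: (esym (congr1 (@^~ v) (diffM (dF _ Ax) (dG _ Ax)))).
Qed.

(** The inverse square root is handled as one function because its derivative, -1/2 times its cube
    times dF, is a polynomial in the function itself and dF; the induction on k then closes with
    products alone. *)
Lemma Ck_rsqrt k (A : set V) (F : V -> R) : (forall x, A x -> 0 < F x) ->
  Ck k A F -> open A -> Ck k A (fun x => (Num.sqrt (F x))^-1).
Proof.
move=> F0 + oA.
have dS x : A x -> differentiable F x ->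
    is_diff x (fun x => (Num.sqrt (F x))^-1)
      (fun v => - 2^-1 * (Num.sqrt (F x))^-1 ^+ 3 * 'd F x v).
  move=> Ax dF; have Fx := F0 _ Ax.
  have dsq : differentiable (Num.sqrt : R -> R) (F x).
    by apply/derivable1_diffP; apply: ex_derive; exact: is_derive1_sqrt.
  have dc : differentiable (Num.sqrt \o F) x by exact: differentiable_comp.
  have sq0 : (Num.sqrt \o F) x != 0 by rewrite /= gt_eqF// sqrtr_gt0.
  apply: DiffDef; first exact: (differentiableV dc sq0).
  apply/funext => v; apply: etrans (congr1 (@^~ v) (diffV dc sq0)) _.
  have dcv : 'd (Num.sqrt \o F) x v = 'd F x v * (2 * Num.sqrt (F x))^-1.
    apply: etrans (congr1 (@^~ v) (diff_comp dF dsq)) _ => /=.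
    have dS1 : derivable (Num.sqrt : R -> R) (F x) 1 by apply/derivable1_diffP.
    apply: etrans (congr1 (@^~ _) (deriv1E dS1)) _ => /=.
    by rewrite derive1E (@derive_val _ _ _ _ _ _ _ (is_derive1_sqrt Fx)).
  apply: etrans (congr1 (fun y : R => - Num.sqrt (F x) ^- 2 * y) dcv) _.
  rewrite /= in sq0; move: (Num.sqrt (F x)) ('d F x v : R) sq0 => s0 y s00.
  by rewrite exprVn; field.
elim: k => [|k IH] FC.
  move=> x Ax; apply: continuousV; first by rewrite gt_eqF// sqrtr_gt0 F0.
  by apply: continuous_comp; [exact: FC|exact: sqrt_continuous].
have {}IH := IH (Ck_le (leqnSn k) FC).
case: FC => dF cF; split=> [x Ax|v].
  exact: (@ex_diff _ _ _ _ _ _ _ (dS _ Ax (dF _ Ax))).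
have := CkM (CkM (@Ck_cst R V R^o k A (- 2^-1 : R)) (CkM IH (CkM IH IH oA) oA) oA) (cF v) oA.
apply: Ck_ext => // x Ax.
apply: esym; apply: etrans (congr1 (@^~ v) (@diff_val _ _ _ _ _ _ _ (dS _ Ax (dF _ Ax)))) _.
by rewrite /cst !exprS expr0 mulr1.
Qed.

End CkScalar.

Section LinearMaps.
Context {R : realType} {V W Z : normedModType R}.

(** Bundles a proof of linearity into the structure that the library results on linear maps
    expect. *)
Definition pack_linear (U1 U2 : lmodType R) (g : U1 -> U2) (lg : linear g) :
  {linear U1 -> U2} := HB.pack g (GRing.isLinear.Build R U1 U2 _ g lg).

Lemma Ck_linear k (A : set V) (F : V -> W) (g : W -> Z) :
  linear g -> continuous g -> Ck k A F -> open A -> Ck k A (fun x => g (F x)).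
Proof. by move=> lg; exact: (@Ck_lin _ _ _ _ k A F (pack_linear lg)). Qed.

Lemma diff_linear (F : V -> W) (g : W -> Z) x : linear g -> continuous g ->
  differentiable F x ->
  differentiable (fun y => g (F y)) x /\
  forall v, 'd (fun y => g (F y)) x v = g ('d F x v).
Proof.
move=> lg cg dF; have dg y : differentiable (pack_linear lg) y.
  exact: linear_differentiable.
split=> [|v]; first exact: (differentiable_comp dF (dg _)).
apply: etrans (congr1 (@^~ v) (diff_comp dF (dg _))) _ => /=.
exact: (congr1 (@^~ ('d F x v)) (@diff_lin _ _ _ (pack_linear lg) (F x) cg)).
Qed.

End LinearMaps.

(** * Limits, continuity and class C^k for matrix-valued maps *)

Section MatrixTopology.
Context {R : realType}.

Lemma cvg_mxP (T : Type) (F : set_system T) {FF : Filter F} m n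
    (f : T -> 'M[R]_(m, n)) (M : 'M[R]_(m, n)) :
  f @ F --> M <-> forall i j, f x i j @[x --> F] --> M i j.
Proof.
split=> [fM i j|fM].
  apply: (@cvg_comp _ _ _ f (fun N : 'M[R]_(m, n) => N i j) F (nbhs M) _ fM).
  exact: coord_continuous.
apply/cvgrPdist_le => /= e e0; near=> x.
rewrite /Num.Def.normr/= mx_normrE (bigmax_le _ (ltW e0))//= => i _.
rewrite !mxE/=; move: i; near: x; apply: filter_forall => /= i.
exact: ((cvgrPdist_le _ _).1 (fM i.1 i.2)).
Unshelve. all: by end_near. Qed.

Lemma cvg_bigsum (T : Type) (F : set_system T) {FF : Filter F} (W : normedModType R)
    (I : Type) (s : seq I) (f : I -> T -> W) (a : I -> W) :
  (forall i, f i @ F --> a i) -> \sum_(i <- s) f i x @[x --> F] --> \sum_(i <- s) a i.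
Proof.
move=> fa; elim: s => [|i s IH].
  by rewrite big_nil; under eq_fun do rewrite big_nil; exact: cvg_cst.
by rewrite big_cons; under eq_fun do rewrite big_cons; exact: cvgD.
Qed.

Lemma cvg_bigprod (T : Type) (F : set_system T) {FF : Filter F}
    (I : Type) (s : seq I) (f : I -> T -> R) (a : I -> R) :
  (forall i, f i @ F --> a i) -> \prod_(i <- s) f i x @[x --> F] --> \prod_(i <- s) a i.
Proof.
move=> fa; elim: s => [|i s IH].
  by rewrite big_nil; under eq_fun do rewrite big_nil; exact: cvg_cst.
by rewrite big_cons; under eq_fun do rewrite big_cons; exact: cvgM.
Qed.

Lemma cvg_mulmx (T : Type) (F : set_system T) {FF : Filter F} m n q
    (f : T -> 'M[R]_(m, n)) (g : T -> 'M[R]_(n, q)) (a : 'M[R]_(m, n)) (b : 'M[R]_(n, q)) :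
  f @ F --> a -> g @ F --> b -> f x *m g x @[x --> F] --> a *m b.
Proof.
move=> /cvg_mxP fa /cvg_mxP gb; apply/cvg_mxP => i j.
rewrite mxE; under eq_fun do rewrite mxE.
by apply: cvg_bigsum => k; apply: cvgM; [exact: fa|exact: gb].
Qed.

Lemma cvg_trmx (T : Type) (F : set_system T) {FF : Filter F} m n
    (f : T -> 'M[R]_(m, n)) (a : 'M[R]_(m, n)) : f @ F --> a -> (f x)^T @[x --> F] --> a^T.
Proof.
move=> /cvg_mxP fa; apply/cvg_mxP => i j.
by rewrite mxE; under eq_fun do rewrite mxE; exact: fa.
Qed.

Lemma cvg_mxtrace (T : Type) (F : set_system T) {FF : Filter F} n
    (f : T -> 'M[R]_n) (a : 'M[R]_n) : f @ F --> a -> \tr (f x) @[x --> F] --> \tr a.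
Proof. by move=> /cvg_mxP fa; apply: cvg_bigsum => k; exact: fa. Qed.

Lemma cvg_det (T : Type) (F : set_system T) {FF : Filter F} n
    (f : T -> 'M[R]_n) (a : 'M[R]_n) : f @ F --> a -> \det (f x) @[x --> F] --> \det a.
Proof.
move=> /cvg_mxP fa; apply: cvg_bigsum => s; apply: cvgM; first exact: cvg_cst.
by apply: cvg_bigprod => i; exact: fa.
Qed.

Lemma cvg_invmx (T : Type) (F : set_system T) {FF : Filter F} n
    (f : T -> 'M[R]_n) (a : 'M[R]_n) :
  a \in unitmx -> f @ F --> a -> invmx (f x) @[x --> F] --> invmx a.
Proof.
move=> ua fa.
have da : \det a != 0 by rewrite -unitfE -unitmxE.
have nu : \forall x \near F, f x \in unitmx.
  near=> x; rewrite unitmxE unitfE; near: x.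
  exact: cvgr_neq0 (cvg_det fa) da.
(* [invmx] is defined by cases on invertibility; near an invertible limit only the adjugate formula
   is active. *)
apply: (@cvg_trans _ (((\det (f x))^-1 *: \adj (f x)) @[x --> F])).
  apply: near_eq_cvg; near=> x; rewrite /invmx.
  by have -> : f x \in unitmx by near: x.
rewrite /invmx ua; apply: cvgZ; first by apply: cvgV => //; exact: cvg_det.
apply/cvg_mxP => i j; rewrite mxE; under eq_fun do rewrite mxE.
apply: cvgM; first exact: cvg_cst.
apply: cvg_det; apply/cvg_mxP => k l; rewrite !mxE.
under eq_fun do rewrite !mxE.
by move/cvg_mxP: fa; exact.
Unshelve. all: by end_near. Qed.

(** Expanding the argument on the elementary matrices writes [g] as a finite sum of continuous
    coordinate functions times constants. *)
Lemma continuous_linear_mx m n (W : normedModType R) (g : 'M[R]_(m, n) -> W) :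
  linear g -> continuous g.
Proof.
move=> lg x.
have gE y : g y = \sum_i \sum_j y i j *: g (delta_mx i j).
  rewrite {1}(matrix_sum_delta y) -[g]/(pack_linear lg : _ -> _) linear_sum.
  by apply: eq_bigr => i _; rewrite linear_sum; apply: eq_bigr => j _; rewrite linearZ.
have h i j : (y : 'M[R]_(m, n)) i j *: g (delta_mx i j) @[y --> x]
    --> x i j *: g (delta_mx i j).
  apply: (@cvgZr_tmp _ _ _ (nbhs x)); exact: coord_continuous.
have h2 : (fun y : 'M[R]_(m, n) => \sum_i \sum_j y i j *: g (delta_mx i j)) @ x
    --> \sum_i \sum_j x i j *: g (delta_mx i j).
  by apply: (@cvg_bigsum _ (nbhs x)) => i; apply: (@cvg_bigsum _ (nbhs x)) => j.
by rewrite -gE (_ : (fun y => _) = g) in h2 => //; apply/funext => y; rewrite -gE.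
Qed.

Lemma linear_entry m n i j : linear (fun M : 'M[R]_(m, n) => M i j : R^o).
Proof. by move=> k u v; rewrite !mxE. Qed.

End MatrixTopology.

Section CkMatrix.
Context {R : realType} {V : normedModType R}.

Lemma Ck_mxP k (A : set V) m n (F : V -> 'M[R]_(m, n)) : open A ->
  Ck k A F <-> forall i j, Ck k A (fun x => F x i j).
Proof.
move=> oA; split=> [FC i j|FC].
  by apply: Ck_linear (@linear_entry R m n i j) _ FC oA; exact: coord_continuous.
pose G x := \sum_i \sum_j F x i j *: (delta_mx i j : 'M[R]_(m, n)).
apply: (@Ck_ext _ _ _ _ _ G) => // [x _|]; first by rewrite [RHS]matrix_sum_delta.
apply: Ck_sum => // i _; apply: Ck_sum => // j _.
apply: (@Ck_linear _ _ R^o _ k A _ (fun a : R^o => a *: delta_mx i j)) => //.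
- by move=> a u v; rewrite scalerDl -scalerA.
- by move=> x; exact: scalel_continuous.
Qed.

Lemma Ck_mulmx k (A : set V) m n q (F : V -> 'M[R]_(m, n)) (G : V -> 'M[R]_(n, q)) :
  open A -> Ck k A F -> Ck k A G -> Ck k A (fun x => F x *m G x).
Proof.
move=> oA /(Ck_mxP _ _ oA) FC /(Ck_mxP _ _ oA) GC; apply/Ck_mxP => // i j.
rewrite (_ : (fun x => _) = (fun x => \sum_l F x i l * G x l j)); last first.
  by apply/funext => x; rewrite mxE.
by apply: Ck_sum => // l _; exact: CkM.
Qed.

Lemma Ck_trmx k (A : set V) m n (F : V -> 'M[R]_(m, n)) :
  open A -> Ck k A F -> Ck k A (fun x => (F x)^T).
Proof.
move=> oA /(Ck_mxP _ _ oA) FC; apply/Ck_mxP => // i j.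
by rewrite (_ : (fun x => _) = (fun x => F x j i)) //; apply/funext => x; rewrite mxE.
Qed.

(** Expanding dF(x)v on the elementary matrices writes the derivative of the composite as a sum of
    entries of dF(x)v times a directional derivative of [f] in a fixed direction composed with [F],
    to which the induction hypothesis applies. *)
Lemma Ck_comp_mx k (A : set V) m n (F : V -> 'M[R]_(m, n))
    (f : 'M[R]_(m, n) -> R) :
  open A -> Ck k setT f -> Ck k A F -> Ck k A (f \o F).
Proof.
move=> oA; elim: k f F => [|k IH] f F.
  by move=> cf cF x Ax; apply: continuous_comp; [exact: cF|exact: cf].
move=> [df cf] FC; have FC' := Ck_le (leqnSn k) FC; case: FC => dF cF.
split=> [x Ax|v]; first by apply: differentiable_comp; [exact: dF|exact: df].
pose G x := \sum_i \sum_j ('d F x v) i j * 'd f (F x) (delta_mx i j).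
apply: (@Ck_ext _ _ _ _ _ G) => // [x Ax|].
  apply: esym; apply: etrans (congr1 (@^~ v) (diff_comp (dF _ Ax) (df _ I))) _.
  rewrite /=.
  rewrite [in LHS](matrix_sum_delta ('d F x v)) linear_sum.
  apply: eq_bigr => i _; rewrite linear_sum; apply: eq_bigr => j _.
  by rewrite linearZ.
apply: Ck_sum => // i _; apply: Ck_sum => // j _; apply: CkM => //.
  by have /(Ck_mxP _ _ oA) := cF v.
exact: (IH _ _ (cf (delta_mx i j)) FC').
Qed.

End CkMatrix.

(** * Positive definite matrices and smooth Cholesky factors *)

Section LinAlg.
Context {R : realType}.

Lemma mxtrace_tr_mul m n (N : 'M[R]_(m, n)) :
  \tr (N^T *m N) = \sum_j \sum_i N i j ^+ 2.
Proof.
apply: eq_bigr => j _; rewrite mxE; apply: eq_bigr => i _.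
by rewrite mxE expr2.
Qed.

Lemma mxtrace_tr_mul_ge0 m n (N : 'M[R]_(m, n)) : 0 <= \tr (N^T *m N).
Proof. by rewrite mxtrace_tr_mul; do 2!apply: sumr_ge0 => ? _; exact: sqr_ge0. Qed.

Lemma mxtrace_tr_mul_eq0 m n (N : 'M[R]_(m, n)) : \tr (N^T *m N) = 0 -> N = 0.
Proof.
rewrite mxtrace_tr_mul => /eqP; rewrite psumr_eq0; last first.
  by move=> j _; apply: sumr_ge0 => i _; exact: sqr_ge0.
move=> /allP N0; apply/matrixP => i j; rewrite mxE.
have := N0 j (mem_index_enum _); rewrite psumr_eq0; last by move=> ? _; exact: sqr_ge0.
by move=> /allP /(_ i (mem_index_enum _)); rewrite sqrf_eq0 => /eqP.
Qed.

Lemma mxtrace_tr_mul_gt0 m n (N : 'M[R]_(m, n)) : N != 0 -> 0 < \tr (N^T *m N).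
Proof.
move=> N0; rewrite lt_neqAle mxtrace_tr_mul_ge0 andbT eq_sym.
by apply: contra_neq N0; exact: mxtrace_tr_mul_eq0.
Qed.

Lemma mulTmx_eq0 m n (N : 'M[R]_(m, n)) : N^T *m N = 0 -> N = 0.
Proof. by move=> N0; apply: mxtrace_tr_mul_eq0; rewrite N0 mxtrace0. Qed.

Lemma mx11_tr (A : 'M[R]_1) : \tr A = A 0 0.
Proof. by rewrite /mxtrace big_ord1. Qed.

Lemma quadratic_ge0 (b c : R) : 0 <= c -> (forall t, 0 <= 2 * t * b + t ^+ 2 * c) -> b = 0.
Proof.
(* At this t the quadratic equals -(c + 2) b^2 / (c + 1)^2. Dividing by c + 1 instead of c also
   covers c = 0. *)
move=> c0 /(_ (- b / (c + 1))) h.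
have c1 : 0 < c + 1 by lra.
have : 0 <= - (c + 2) * b ^+ 2.
  have -> : - (c + 2) * b ^+ 2
      = (2 * (- b / (c + 1)) * b + (- b / (c + 1)) ^+ 2 * c) * (c + 1) ^+ 2.
    by field; rewrite gt_eqF.
  by apply: mulr_ge0 => //; exact: sqr_ge0.
move=> h2; apply/eqP; rewrite -sqrf_eq0 eq_le sqr_ge0 andbT; nra.
Qed.

(** Along x + t A x the form equals 2 t |A x|^2 + O(t^2) and stays nonnegative for t of both signs,
    which forces A x = 0. *)
Lemma psd_ker n (A : 'M[R]_n) (x : 'cV[R]_n) :
  possemidef A -> (x^T *m A *m x) 0 0 = 0 -> A *m x = 0.
Proof.
move=> [symA psdA] xAx; apply: mulTmx_eq0.
set y := A *m x; apply/matrixP => i j; rewrite !ord1 [RHS]mxE.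
apply: (@quadratic_ge0 _ ((y^T *m A *m y) 0 0)) => [|t]; first exact: psdA.
have -> : 2 * t * (y^T *m y) 0 0 + t ^+ 2 * (y^T *m A *m y) 0 0
    = ((x + t *: y)^T *m A *m (x + t *: y)) 0 0; last exact: psdA.
have -> : (x + t *: y)^T = x^T + t *: y^T by rewrite linearD linearZ.
rewrite !mulmxDl !mulmxDr -!scalemxAl -!scalemxAr.
have -> : x^T *m A = y^T by rewrite /y trmx_mul symA.
have -> : y^T *m A *m x = y^T *m y by rewrite /y mulmxA.
have e0 : (y^T *m x) 0 0 = 0 by rewrite /y trmx_mul symA.
move: (y^T *m x) e0 (y^T *m y) (y^T *m A *m y) => a a0 b c.
by rewrite !mxE a0; ring.
Qed.

Lemma unitmx_ker n (A : 'M[R]_n) :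
  (forall x : 'cV[R]_n, A *m x = 0 -> x = 0) -> A \in unitmx.
Proof.
move=> A0; rewrite -unitmx_tr -row_free_unit -kermx_eq0; apply/eqP/row_matrixP => i.
apply: trmx_inj; rewrite row0 trmx0; apply: A0; apply: trmx_inj.
by rewrite trmx_mul trmxK trmx0 -row_mul mulmx_ker row0.
Qed.

Lemma posdef_unit n (A : 'M[R]_n) : posdef A -> A \in unitmx.
Proof.
move=> [_ pA]; apply: unitmx_ker => x Ax; apply: contra_eq (Ax) => /pA.
by rewrite -mulmxA => h; apply: contraTneq h => ->; rewrite mulmx0 mxE ltxx.
Qed.

Lemma posdef_psd n (A : 'M[R]_n) : posdef A -> possemidef A.
Proof.
move=> [symA pA]; split=> // x; have [->|/pA/ltW//] := eqVneq x 0.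
by rewrite mulmx0 mxE.
Qed.

Lemma psd_unit_posdef n (A : 'M[R]_n) : possemidef A -> A \in unitmx -> posdef A.
Proof.
move=> psdA uA; have [symA pA] := psdA; split=> // x x0.
rewrite lt_neqAle pA andbT eq_sym; apply: contra_neq x0 => /(psd_ker psdA) Ax.
by rewrite -(mulKmx uA x) Ax mulmx0.
Qed.

Lemma posdef1 n : posdef (1%:M : 'M[R]_n).
Proof.
split; first by rewrite /sym_mx /= trmx1.
by move=> x x0; rewrite mulmx1 -mx11_tr; exact: mxtrace_tr_mul_gt0.
Qed.

Lemma sym_congr m n (A : 'M[R]_m) (N : 'M[R]_(m, n)) :
  sym_mx A -> sym_mx (N^T *m A *m N).
Proof. by rewrite /sym_mx /= => sA; rewrite !trmx_mul trmxK sA mulmxA. Qed.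

Lemma psd_congr m n (A : 'M[R]_m) (N : 'M[R]_(m, n)) :
  possemidef A -> possemidef (N^T *m A *m N).
Proof.
move=> [sA pA]; split; first exact: sym_congr.
by move=> x; have := pA (N *m x); rewrite trmx_mul !mulmxA.
Qed.

Lemma posdef_congr m n (A : 'M[R]_m) (N : 'M[R]_(m, n)) :
  posdef A -> (forall x : 'cV[R]_n, N *m x = 0 -> x = 0) -> posdef (N^T *m A *m N).
Proof.
move=> [sA pA] N0; split; first exact: sym_congr.
move=> x x0; have := pA (N *m x); rewrite trmx_mul !mulmxA; apply.
by apply: contra_neq x0; exact: N0.
Qed.

Lemma full_col_rankP m n (Y : 'M[R]_(m, n)) :
  full_col_rank Y <-> forall x : 'cV[R]_n, Y *m x = 0 -> x = 0.
Proof.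
rewrite /full_col_rank /=; split=> [rY x Yx|Y0].
  have fY : row_free Y^T by rewrite /row_free mxrank_tr rY.
  apply: trmx_inj; apply: (row_free_inj fY).
  by rewrite -trmx_mul Yx !trmx0 mul0mx.
apply/eqP; rewrite -mxrank_tr; change (row_free Y^T); rewrite -kermx_eq0.
apply/eqP/row_matrixP => i.
apply: trmx_inj; rewrite row0 trmx0; apply: Y0; apply: trmx_inj.
by rewrite trmx_mul trmxK trmx0 -row_mul mulmx_ker row0.
Qed.

Lemma posdef_gram m n (Y : 'M[R]_(m, n)) : full_col_rank Y -> posdef (Y^T *m Y).
Proof.
move=> /full_col_rankP Y0; rewrite -[Y^T]mulmx1.
by apply: posdef_congr Y0; exact: posdef1.
Qed.

Lemma stiefel_full_rank m n (U : 'M[R]_(m, n)) : stiefel U -> full_col_rank U.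
Proof.
rewrite /stiefel /= => UU; apply/full_col_rankP => x Ux.
by rewrite -[x]mul1mx -UU -mulmxA Ux mulmx0.
Qed.

Lemma psd_rank_gram p r (Y : 'M[R]_(p, r)) : full_col_rank Y -> psd_rank r (Y *m Y^T).
Proof.
move=> fY; have uG := posdef_unit (posdef_gram fY).
split; first by rewrite /sym_mx /= trmx_mul trmxK.
  apply/eqP; rewrite eqn_leq (leq_trans (mxrankM_maxl _ _)) ?rank_leq_col //=.
  (* Y^T (Y Y^T) Y is the square of the invertible matrix Y^T Y, so Y Y^T cannot have rank below
     r. *)
  have uGG : (Y^T *m Y) *m (Y^T *m Y) \in unitmx by rewrite unitmx_mul uG.
  have rE : \rank (Y^T *m (Y *m Y^T) *m Y) = r.
    by rewrite !mulmxA -mulmxA; exact: mxrank_unit.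
  rewrite -[X in (X <= _)%N]rE; apply: leq_trans (mxrankM_maxl _ _) (mxrankM_maxr _ _).
split; first by rewrite /sym_mx /= trmx_mul trmxK.
move=> x; rewrite -[Y *m _]mulmx1 mulmxA -mulmxA.
have := mxtrace_tr_mul_ge0 (Y^T *m x).
by rewrite mx11_tr trmx_mul trmxK !mulmxA mulmx1.
Qed.

End LinAlg.

(** * Schur complements and Cholesky factors depending smoothly on a parameter *)

Section SchurComplement.
Context {R : realType} (n : nat) (a t : R) (b : 'rV[R]_n) (C : 'M[R]_n).
Hypothesis ta : t * a = 1.

(** [t] is the inverse of the pivot [a]. For a positive pivot, the first coordinate - t b y is the
    one that minimises the form for given y, and the minimum is the form of the Schur complement. *)
Lemma schur_quadratic (y : 'cV[R]_n) :
  (col_mx (- t *: (b *m y)) y)^T *m block_mx a%:M b b^T C *m col_mx (- t *: (b *m y)) y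
  = y^T *m (C - t *: (b^T *m b)) *m y.
Proof.
rewrite tr_col_mx mul_row_block mul_row_col.
rewrite [(_ *: _)^T]linearZ /=.
rewrite mul_mx_scalar scalerA.
rewrite mulrN mulrC mulrC [a * t]mulrC ta scaleN1r trmx_mul addNr mul0mx add0r.
rewrite scaleNr mulNmx mulmxDl mulNmx mulmxBr mulmxBl -scalemxAr -!scalemxAl.
by rewrite addrC !mulmxA.
Qed.

(** The upper right block cancels the coupling with [b], the scalar s normalises the pivot, and [L]
    treats the Schur complement: this is one step of the elimination. *)
Lemma schur_factor (s : R) (L : 'M[R]_n) : s * s = t ->
  L^T *m (C - t *: (b^T *m b)) *m L = 1%:M ->
  (block_mx s%:M (- t *: (b *m L)) 0 L)^T *m block_mx a%:M b b^T C
    *m block_mx s%:M (- t *: (b *m L)) 0 L = 1%:M.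
Proof.
move=> st LE; rewrite tr_block_mx -mulmxA !mulmx_block.
rewrite [RHS](@scalar_mx_block _ 1 n 1) trmx0 !mul0mx !mulmx0 !addr0 tr_scalar_mx.
have E1 : a%:M *m (- t *: (b *m L)) + b *m L = 0.
  by rewrite mul_scalar_mx scalerA mulrN mulrC ta scaleN1r addNr.
have E2 : b^T *m (- t *: (b *m L)) + C *m L = (C - t *: (b^T *m b)) *m L.
  by rewrite mulmxBl -scalemxAr scaleNr -scalemxAl mulmxA addrC.
rewrite E1 E2 !mulmx0 add0r [L^T *m (_ *m L)]mulmxA LE.
congr block_mx.
  by rewrite -!scalar_mxM mulrA mulrAC st ta.
rewrite -scalar_mxM !mul_mx_scalar [(_ *: _)^T]linearZ /= trmx_mul -scalemxAr scalerA.
rewrite -scalerDl (_ : _ + s = 0) ?scale0r //.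
by rewrite mulrN mulrAC [a * t]mulrC ta mul1r addNr.
Qed.

End SchurComplement.

Section Cholesky.
Context {R : realType} {V : normedModType R}.

Lemma Ck_block k (A : set V) m1 m2 n1 n2 (F : V -> 'M[R]_(m1, n1))
    (G : V -> 'M[R]_(m1, n2)) (H : V -> 'M[R]_(m2, n1)) (K : V -> 'M[R]_(m2, n2)) :
  open A -> Ck k A F -> Ck k A G -> Ck k A H -> Ck k A K ->
  Ck k A (fun x => block_mx (F x) (G x) (H x) (K x)).
Proof.
move=> oA /(Ck_mxP _ _ oA) FC /(Ck_mxP _ _ oA) GC /(Ck_mxP _ _ oA) HC /(Ck_mxP _ _ oA) KC.
apply/Ck_mxP => // i j.
case: (split_ordP i) => i' ->; case: (split_ordP j) => j' ->.
- by under eq_fun do rewrite block_mxEul.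
- by under eq_fun do rewrite block_mxEur.
- by under eq_fun do rewrite block_mxEdl.
- by under eq_fun do rewrite block_mxEdr.
Qed.

Lemma Ck_scale_mx k (A : set V) m n (c : V -> R) (F : V -> 'M[R]_(m, n)) :
  open A -> Ck k A c -> Ck k A F -> Ck k A (fun x => c x *: F x).
Proof.
move=> oA cC /(Ck_mxP _ _ oA) FC; apply/Ck_mxP => // i j.
by under eq_fun do rewrite mxE; exact: CkM.
Qed.

(** Induction on the size by eliminating the pivot [A u 0 0]. The only non-rational operation is the
    inverse square root of a positive pivot. The form L^T A L = 1 gives the transposed inverse of
    the usual Cholesky factor, which is what the sections below use. *)
Lemma smooth_cholesky n (B : set V) (A : V -> 'M[R]_n) :
  open B -> Cinf B A -> (forall u, B u -> posdef (A u)) ->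
  exists2 L : V -> 'M[R]_n, Cinf B L & forall u, B u -> (L u)^T *m A u *m L u = 1%:M.
Proof.
move=> oB; elim: n A => [|n IH] A AC Ap.
  by exists A => // u _; apply/matrixP => -[].
pose a u := A u 0 0.
pose b u : 'rV[R]_n := ursubmx (A u : 'M[R]_(1 + n)).
pose C u : 'M[R]_n := drsubmx (A u : 'M[R]_(1 + n)).
have AE u : B u -> A u = block_mx (a u)%:M (b u) (b u)^T (C u) :> 'M[R]_(1 + n).
  move=> /Ap [sA _]; rewrite -[LHS](@submxK _ 1 n 1 n); congr block_mx.
    by apply/matrixP => i j; rewrite !mxE !ord1 /a eqxx mulr1n; congr (A u _ _); apply/val_inj.
  by rewrite /b trmx_ursub sA.
have a0 u : B u -> 0 < a u.
  pose e : 'cV[R]_n.+1 := delta_mx 0 0.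
  move=> Bu; have [_ /(_ e)] := Ap _ Bu.
  have -> : (e^T *m A u *m e) 0 0 = a u.
    by rewrite trmx_delta -rowE -colE !mxE.
  apply; apply/eqP => /matrixP/(_ 0 0); rewrite !mxE eqxx => /eqP.
  by rewrite oner_eq0.
pose s u := (Num.sqrt (a u))^-1.
have aC : Cinf B a by move=> k; have /(Ck_mxP _ _ oB) := AC k; exact.
have bC : Cinf B b.
  move=> k; have /(Ck_mxP _ _ oB) AC' := AC k; apply/Ck_mxP => // i j.
  by under eq_fun do rewrite !mxE.
have CC : Cinf B C.
  move=> k; have /(Ck_mxP _ _ oB) AC' := AC k; apply/Ck_mxP => // i j.
  by under eq_fun do rewrite !mxE.
have sC : Cinf B s by move=> k; exact: Ck_rsqrt.
have ss u : B u -> s u * s u = (a u)^-1.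
  by move=> /a0 au; rewrite /s -invfM -expr2 sqr_sqrtr // ltW.
have sa u : B u -> s u * s u * a u = 1.
  by move=> Bu; rewrite ss // mulVf // gt_eqF ?a0.
pose S u := C u - (s u * s u) *: ((b u)^T *m b u).
have SC : Cinf B S.
  move=> k; rewrite /S (_ : (fun u => _) = fun u => C u + (-1 * (s u * s u)) *: ((b u)^T *m b u)).
    apply: CkD => //; apply: Ck_scale_mx => //.
      by apply: CkM => //; [exact: (@Ck_cst _ _ R^o)|exact: CkM].
    by apply: Ck_mulmx => //; exact: Ck_trmx.
  by apply/funext => u; rewrite mulN1r scaleNr.
have Sp u : B u -> posdef (S u).
  move=> Bu; have [sA pA] := Ap _ Bu; split.
    rewrite /sym_mx /S /= linearB linearZ /= trmx_mul trmxK; congr (_ - _).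
    by rewrite /C trmx_drsub sA.
  (* Positivity of the Schur complement: test [A u] on the vector that completes y optimally. *)
  move=> y y0; have := pA (col_mx (- (s u * s u) *: (b u *m y)) y).
  suff -> : ((col_mx (- (s u * s u) *: (b u *m y)) y)^T *m A u
      *m (col_mx (- (s u * s u) *: (b u *m y)) y : 'cV_(1 + n))) 0 0 = (y^T *m S u *m y) 0 0.
    apply; apply: contra_neq y0 => e.
    have := congr1 (fun z : 'cV[R]_(1 + n) => dsubmx z) e.
    by rewrite col_mxKd => ->; apply/matrixP => i j; rewrite !mxE.
  by rewrite AE // /S; congr (fun_of_matrix _ 0 0); apply: schur_quadratic; exact: sa.
have [L' L'C L'E] := IH S SC Sp.
exists (fun u => block_mx (s u)%:M (- (s u * s u) *: (b u *m L' u)) 0 (L' u)).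
  move=> k; apply: Ck_block => //.
  - rewrite (_ : (fun u => _) = fun u => s u *: (1%:M : 'M[R]_1)); last first.
      by apply/funext => u; rewrite scalemx1.
    by apply: Ck_scale_mx => //; exact: Ck_cst.
  - rewrite (_ : (fun u => _) = fun u => (-1 * (s u * s u)) *: (b u *m L' u)); last first.
      by apply/funext => u; rewrite mulN1r.
    apply: Ck_scale_mx => //; last exact: Ck_mulmx.
    by apply: CkM => //; [exact: (@Ck_cst _ _ R^o)|exact: CkM].
  - exact: Ck_cst.
by move=> u Bu; rewrite AE //; apply: schur_factor (L'E u Bu) => //; exact: sa.
Qed.

End Cholesky.

Section Factorizations.
Context {R : realType}.

Lemma cholesky n (A : 'M[R]_n) : posdef A -> exists L : 'M[R]_n, L^T *m A *m L = 1%:M.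
Proof.
(* A single matrix is a constant family, here parametrised by the real line. *)
move=> pA; have [|||L _ LE] := @smooth_cholesky R R^o n setT (fun=> A).
- exact: openT.
- by move=> k; exact: Ck_cst.
- by [].
by exists (L 0); exact: LE.
Qed.

Lemma cholesky_unit n (A L : 'M[R]_n) : L^T *m A *m L = 1%:M ->
  [/\ L \in unitmx, A \in unitmx & L *m L^T = invmx A].
Proof.
move=> LE; have [uLA uL] := mulmx1_unit LE.
have uA : A \in unitmx by move: uLA; rewrite unitmx_mul => /andP[].
split=> //; rewrite -[LHS](mulmxK uA) -[RHS]mul1mx; congr (_ *m _).
by rewrite -mulmxA; exact: mulmx1C.
Qed.

(** [N] is the transposed inverse of the factor given by [cholesky]; it is in general not the
    symmetric square root. *)
Lemma psd_sqrt n (A : 'M[R]_n) : posdef A -> exists2 N : 'M[R]_n, N \in unitmx & A = N *m N^T.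
Proof.
move=> pA; have [L LE] := cholesky pA; have [uL uA LL] := cholesky_unit LE.
exists (invmx L)^T; first by rewrite unitmx_tr unitmx_inv.
have : invmx L^T *m (L^T *m A *m L) *m invmx L = A.
  by rewrite !mulmxA mulVmx ?unitmx_tr // mul1mx mulmxK.
by rewrite LE mulmx1 trmxK trmx_inv => ->.
Qed.

(** Gram-Schmidt in matrix form: L^T (Y^T Y) L = 1 says that the columns of Y L are orthonormal. *)
Lemma orthonormalize m n (Y : 'M[R]_(m, n)) : full_col_rank Y ->
  exists2 L : 'M[R]_n, L \in unitmx & stiefel (Y *m L).
Proof.
move=> /posdef_gram/cholesky [L LE]; have [uL _ _] := cholesky_unit LE.
by exists L => //; rewrite /stiefel /= trmx_mul !mulmxA -[_ *m Y]mulmxA.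
Qed.

Lemma orth_compl_ex p r (U : 'M[R]_(p, r)) : stiefel U -> exists Uc, orth_compl U Uc.
Proof.
move=> sU; have rU : \rank (kermx U) = (p - r)%N.
  by rewrite mxrank_ker (stiefel_full_rank sU).
have [N fN UN] : exists2 N : 'M[R]_(p, p - r), full_col_rank N & U^T *m N = 0.
  rewrite -rU; exists (row_base (kermx U))^T.
    by rewrite /full_col_rank /= mxrank_tr; apply/eqP; exact: row_base_free.
  apply: trmx_inj; rewrite trmx_mul !trmxK trmx0; apply/sub_kermxP.
  by rewrite eq_row_base.
have [L _ sL] := orthonormalize fN.
by exists (N *m L); split=> //; rewrite mulmxA UN mul0mx.
Qed.

(** With the rows of R0 a basis of the row space, symmetry of X gives X = R0^T M R0. The r by r
    matrix M is semidefinite as a congruence of X and invertible because X has rank r, so M = N N^T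
    and Y = R0^T N. *)
Lemma psd_rank_factor p r (X : 'M[R]_p) : psd_rank r X ->
  exists2 Y : 'M[R]_(p, r), full_col_rank Y & X = Y *m Y^T.
Proof.
move=> [sX rX psdX].
have [R0 fR [C XE]] : exists2 R0 : 'M[R]_(r, p), row_free R0 & exists C, X = C *m R0.
  case: _ / rX; exists (row_base X); first exact: row_base_free.
  by exists (col_base X); rewrite mulmx_base.
have XR : X *m pinvmx R0 *m R0 = X by rewrite {1}XE -[C *m _ *m _]mulmxA mulmxVp // mulmx1.
pose M := (pinvmx R0)^T *m X *m pinvmx R0.
have XM : X = R0^T *m M *m R0.
  have tX : X^T = X by exact: sX.
  have XL : R0^T *m ((pinvmx R0)^T *m X) = X by rewrite -{1}tX -!trmx_mul XR.
  by rewrite -{1}XL /M -{1}XR !mulmxA.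
have psdM : possemidef M by exact: psd_congr.
have uM : M \in unitmx.
  rewrite -row_free_unit /row_free eqn_leq rank_leq_row /= -[X in (X <= _)%N]rX.
  by rewrite {1}XM; apply: leq_trans (mxrankM_maxl _ _) (mxrankM_maxr _ _).
have [N uN ME] := psd_sqrt (psd_unit_posdef psdM uM).
exists (R0^T *m N); last by rewrite XM ME trmx_mul trmxK !mulmxA.
by rewrite /full_col_rank /= mxrankMfree ?mxrank_tr ?row_free_unit //; exact/eqP.
Qed.

(** A zero form is in particular semidefinite, so [psd_ker] puts every vector in the kernel. *)
Lemma sym_quad_eq0 n (A : 'M[R]_n) : A^T = A ->
  (forall x : 'cV[R]_n, (x^T *m A *m x) 0 0 = 0) -> A = 0.
Proof.
move=> sA A0; have psdA : possemidef A by split=> // x; rewrite A0.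
have A0' (x : 'cV[R]_n) : A *m x = 0 by exact: psd_ker.
apply/matrixP => i j; rewrite mxE.
have := congr1 (fun z : 'cV[R]_n => z i 0) (A0' (delta_mx j 0)).
by rewrite -colE !mxE.
Qed.

End Factorizations.

(** * Rayleigh quotients of a symmetric pencil *)

Section Rayleigh.
Context {R : realType} {d : nat}.
Implicit Types (H G : 'M[R]_d) (v : 'rV[R]_d).

Let q H v : R := (v *m H *m v^T) 0 0.

Lemma quad_continuous H : continuous (q H).
Proof.
move=> v.
have : w *m H *m w^T @[w --> v] --> v *m H *m v^T.
  apply: (@cvg_mulmx _ _ (nbhs v)); last exact: (@cvg_trmx _ _ (nbhs v)).
  by apply: (@cvg_mulmx _ _ (nbhs v)) => //; exact: cvg_cst.
by move=> /(@cvg_mxP _ _ (nbhs v)); exact.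
Qed.

Lemma quadZ H (c : R) v : q H (c *: v) = c ^+ 2 * q H v.
Proof.
by rewrite /q linearZ /= -!scalemxAl -scalemxAr !mxE mulrA expr2.
Qed.

Lemma quadB H G (c : R) v : q (H - c *: G) v = q H v - c * q G v.
Proof.
rewrite /q mulmxBr mulmxBl -scalemxAr -scalemxAl.
by move: (v *m H *m v^T) (v *m G *m v^T) => a b; rewrite !mxE.
Qed.

Lemma posdef_row G v : posdef G -> v != 0 -> 0 < q G v.
Proof.
move=> [_ pG] v0; have := pG v^T; rewrite trmxK; apply.
by apply: contra_neq v0 => /(congr1 trmx); rewrite trmxK trmx0.
Qed.

(** Left to right, v H = a v G gives the value a times a positive number. Conversely, the minimum m
    of the quotient of the two forms is negative, H - m G is semidefinite and its form vanishes at
    the minimiser w, so w lies in its kernel, that is, w H = m w G. *)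
Lemma pencil_eigenvalue H G : H^T = H -> posdef G ->
  (exists2 a : R, a < 0 & eigenvalue (H *m invmx G) a) <->
  exists v, (v *m H *m v^T) 0 0 < 0.
Proof.
move=> sH pG; have uG := posdef_unit pG; split=> [[a a0 /eigenvalueP[v vE v0]]|[v vH]].
  exists v; have -> : v *m H = a *: (v *m G).
    by rewrite scalemxAl -vE mulmxA mulmxKV.
  by rewrite -scalemxAl mxE nmulr_rlt0 //; exact: posdef_row.
(* The unit sphere of the norm of the matrix space, not the Euclidean one. The quotient is
   homogeneous of degree zero, so any compact set meeting every ray would serve. *)
pose S : set 'rV[R]_d := [set w | `|w| = 1].
have v0 : v != 0 by apply: contraTneq vH => ->; rewrite !mul0mx mxE ltxx.
have nv : 0 < `|v| by rewrite normr_gt0.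
have cS : compact S.
  apply: bounded_closed_compact.
    by exists 1; split=> // M M1 w /= ->; exact: ltW.
  rewrite (_ : S = (fun w => `|w|) @^-1` [set 1]) //.
  by apply: closed_comp => [w _|]; [exact: norm_continuous|exact: closed_eq].
have nS w : S w -> w != 0 by move=> /= w1; rewrite -normr_gt0 w1.
have cq : {within S, continuous (fun w => q H w / q G w)}.
  apply: continuous_in_subspaceT => w; rewrite inE => Sw.
  apply: continuousM; first exact: quad_continuous.
  by apply: continuousV; [rewrite gt_eqF// posdef_row// nS|exact: quad_continuous].
have S0 : S !=set0.
  by exists (`|v|^-1 *: v); rewrite /S /= normrZ normfV normr_id mulVf ?gt_eqF.
have [w Sw wmin] := EVT_min_rV S0 cS cq.
rewrite inE in Sw; have w0 := nS _ Sw.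
set m := q H w / q G w in wmin.
have mle u : m * q G u <= q H u.
  have [->|u0] := eqVneq u 0; first by rewrite /q !mul0mx !mxE mulr0.
  have nu : 0 < `|u| by rewrite normr_gt0.
  have /wmin : `|u|^-1 *: u \in S.
    by rewrite inE /S /= normrZ normfV normr_id mulVf ?gt_eqF.
  rewrite !quadZ invfM mulrACA mulfV ?mul1r; last first.
    by rewrite expf_neq0 // invr_neq0 // gt_eqF.
  by rewrite ler_pdivlMr ?posdef_row.
have m0 : m < 0.
  have := le_lt_trans (mle v) vH; rewrite pmulr_llt0 //; exact: posdef_row.
exists m => //; apply/eigenvalueP; exists w => //.
have psdK : possemidef (H - m *: G).
  split; first by rewrite /sym_mx /= linearB linearZ /= sH (proj1 pG).
  by move=> x; have := mle x^T; rewrite -subr_ge0 -quadB /q trmxK.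
have Kw : (H - m *: G) *m w^T = 0.
  apply: psd_ker psdK _; rewrite trmxK -[LHS]/(q _ w) quadB.
  by rewrite /m divfK ?subrr // gt_eqF // posdef_row.
have wH : w *m H = m *: (w *m G).
  apply/eqP; rewrite -subr_eq0 scalemxAr -mulmxBr; apply/eqP/trmx_inj.
  by rewrite trmx_mul trmx0 linearB linearZ /= sH (proj1 pG).
by rewrite mulmxA wH -scalemxAl mulmxK.
Qed.

End Rayleigh.

(** * Symmetry of second derivatives and the Hessian at a critical point *)

Section Schwarz.
Context {R : realType} {V : normedModType R}.

Lemma diff_line (W : normedModType R) (F : V -> W) (y v : V) (t : R) :
  differentiable F (y + t *: v) ->
  is_derive t 1 (fun s : R => F (y + s *: v)) ('d F (y + t *: v) v).
Proof.
move=> dF.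
have dl : is_diff t (fun s : R => y + s *: v) (fun s : R => s *: v).
  have -> : (fun s : R => y + s *: v) = cst y + ( *:%R^~ v) by [].
  by apply: is_diff_eq; apply/funext => s; rewrite -[LHS]/(0 + s *: v) add0r.
have dFl : differentiable (F \o (fun s : R => y + s *: v)) t.
  by apply: differentiable_comp => //; exact: ex_diff.
apply: DeriveDef; first exact/derivable1_diffP.
rewrite (deriveE _ dFl).
apply: etrans (congr1 (@^~ (1 : R)) (diff_comp (@ex_diff _ _ _ _ _ _ _ dl) dF)) _ => /=.
by rewrite (@diff_val _ _ _ _ _ _ _ dl) scale1r.
Qed.

(** The mean value theorem is applied twice: in the direction v to the increment of [g] along h w,
    then in the direction w to dg(.)v. *)
Lemma second_difference (B : set V) (g : V -> R) (x v w : V) (h : R) :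
  0 <= h -> Ck 2 B g ->
  (forall s t, 0 <= s <= h -> 0 <= t <= h -> B (x + s *: v + t *: w)) ->
  exists s t, [/\ 0 <= s <= h, 0 <= t <= h &
    g (x + h *: v + h *: w) - g (x + h *: v) - g (x + h *: w) + g x
    = h ^+ 2 * 'd (fun y => 'd g y v) (x + s *: v + t *: w) w].
Proof.
move=> h0 [dg cg] Bst; have hh : 0 <= h <= h by rewrite h0 lexx.
have h00 : 0 <= (0 : R) <= h by rewrite h0 lexx.
pose phi (s : R) := g (x + h *: w + s *: v) - g (x + s *: v).
have sw (s t : R) : x + t *: w + s *: v = x + s *: v + t *: w by rewrite addrAC.
have dphi (s : R) : 0 <= s <= h ->
    is_derive s 1 phi ('d g (x + h *: w + s *: v) v - 'd g (x + s *: v) v).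
  move=> sh; apply: is_deriveB; apply: diff_line; apply: dg.
    by rewrite sw; exact: Bst.
  by have := Bst _ _ sh h00; rewrite scale0r addr0.
have [|||s] := @MVT_segment R phi (fun s => 'd g (x + h *: w + s *: v) v - 'd g (x + s *: v) v) 0 h.
- by [].
- by move=> s; rewrite in_itv /= => /andP[s0 sh]; apply: dphi; rewrite !ltW.
- apply: continuous_in_subspaceT => s; rewrite inE /= in_itv /= => sh.
  have [+ _] := dphi _ sh => /derivable1_diffP; exact: differentiable_continuous.
rewrite in_itv /= => sh phiE.
pose psi (t : R) := 'd g (x + s *: v + t *: w) v.
have dpsi (t : R) : 0 <= t <= h ->
    is_derive t 1 psi ('d (fun y => 'd g y v) (x + s *: v + t *: w) w).
  move=> th; have [dgv _] := cg v.
  by apply: (@diff_line _ (fun y => 'd g y v)); apply: dgv; exact: Bst.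
have [|||t] := @MVT_segment R psi (fun t => 'd (fun y => 'd g y v) (x + s *: v + t *: w) w) 0 h.
- by [].
- by move=> t; rewrite in_itv /= => /andP[t0 th]; apply: dpsi; rewrite !ltW.
- apply: continuous_in_subspaceT => t; rewrite inE /= in_itv /= => th.
  have [+ _] := dpsi _ th => /derivable1_diffP; exact: differentiable_continuous.
rewrite in_itv /= => th psiE.
exists s, t; split=> //.
move: phiE psiE; rewrite /phi /psi !scale0r !addr0 sw subr0 sw => E1 E2.
rewrite E2 in E1; transitivity (g (x + h *: v + h *: w) - g (x + h *: v) - (g (x + h *: w) - g x)).
  by ring.
by rewrite E1; ring.
Qed.

(** The second difference is unchanged when v and w are exchanged, so the two mixed derivatives take
    a common value at two points of a small parallelogram; if they differed at x, continuity would
    contradict this. *)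
Lemma schwarz (B : set V) (g : V -> R) (x v w : V) :
  open B -> B x -> Ck 2 B g ->
  'd (fun y => 'd g y v) x w = 'd (fun y => 'd g y w) x v.
Proof.
move=> oB Bx gC; have [dg cg] := gC.
pose P y := 'd (fun z => 'd g z v) y w; pose Q y := 'd (fun z => 'd g z w) y v.
have cP : {for x, continuous P} by case: (cg v) => _ /(_ w) /(_ x Bx).
have cQ : {for x, continuous Q} by case: (cg w) => _ /(_ v) /(_ x Bx).
apply/eqP/negPn/negP => PQ; pose e := `|P x - Q x| / 2.
have e0 : 0 < e by rewrite divr_gt0 // normr_gt0 subr_eq0.
have : \forall y \near x, [/\ B y, `|P x - P y| < e & `|Q x - Q y| < e].
  near=> y; split; near: y; first exact: open_near.
    by move/cvgrPdist_lt : cP; exact.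
  by move/cvgrPdist_lt : cQ; exact.
move=> /nbhs_ballP [r /= r0 hr].
(* With this h every point of the parallelogram is within r / 2 of x; the added 1 keeps the
   denominator positive when v = w = 0. *)
pose h := r / (2 * (`|v| + `|w| + 1)).
have n0 : 0 < `|v| + `|w| + 1 by rewrite ltr_wpDl // addr_ge0.
have h0 : 0 < h by rewrite divr_gt0 // mulr_gt0.
have near_x (s t : R) (a b : V) : `|a| + `|b| = `|v| + `|w| ->
    0 <= s <= h -> 0 <= t <= h -> ball x r (x + s *: a + t *: b).
  move=> ab /andP[s0 sh] /andP[t0 th]; rewrite -ball_normE /=.
  rewrite -addrA opprD addrA subrr add0r normrN.
  apply: le_lt_trans (ler_normD _ _) _; rewrite !normrZ !ger0_norm //.
  apply: (@le_lt_trans _ _ (h * (`|v| + `|w| + 1))); last first.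
    rewrite /h; have -> : r / (2 * (`|v| + `|w| + 1)) * (`|v| + `|w| + 1) = r / 2.
      by field; rewrite gt_eqF.
    by rewrite ltr_pdivrMr // ltr_pMr // ltr1n.
  have := normr_ge0 a; have := normr_ge0 b; nra.
have [s [t [sh th E1]]] : exists s t, [/\ 0 <= s <= h, 0 <= t <= h &
    g (x + h *: v + h *: w) - g (x + h *: v) - g (x + h *: w) + g x
    = h ^+ 2 * P (x + s *: v + t *: w)].
  apply: (second_difference (ltW h0) gC) => s t sh th.
  by case: (hr _ (near_x s t v w erefl sh th)).
have [s' [t' [sh' th' E2]]] : exists s t, [/\ 0 <= s <= h, 0 <= t <= h &
    g (x + h *: w + h *: v) - g (x + h *: w) - g (x + h *: v) + g x
    = h ^+ 2 * Q (x + s *: w + t *: v)].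
  apply: (second_difference (ltW h0) gC) => s' t' sh' th'.
  by case: (hr _ (near_x s' t' w v (addrC _ _) sh' th')).
have PQE : P (x + s *: v + t *: w) = Q (x + s' *: w + t' *: v).
  have hn : h ^+ 2 != 0 by rewrite expf_neq0 // gt_eqF.
  apply: (mulfI hn); rewrite -E1 -E2 [x + h *: w + _]addrAC; ring.
have [_ Ph _] := hr _ (near_x s t v w erefl sh th).
have [_ _ Qh] := hr _ (near_x s' t' w v (addrC _ _) sh' th').
have : `|P x - Q x| < e + e.
  have -> : P x - Q x = (P x - P (x + s *: v + t *: w)) - (Q x - Q (x + s' *: w + t' *: v)).
    by rewrite PQE; ring.
  by apply: le_lt_trans (ler_normB _ _) _; exact: ltrD.
by rewrite /e -splitr ltxx.
Unshelve. all: by end_near. Qed.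

End Schwarz.

(** * Coordinate gradient and Hessian at a critical point *)

Section CriticalPoint.
Context {R : realType} {d : nat}.
Implicit Types (g : 'rV[R]_d -> R) (G : 'rV[R]_d -> 'M[R]_d) (B : set 'rV[R]_d).

Definition stationary g : Prop := forall l, partial l g 0 = 0.

Definition flat_hess g : 'M[R]_d := \matrix_(i, l) partial i (partial l g) 0.

Lemma partial_diff B g l u : Ck 2 B g -> B u -> partial l g u = 'd g u 'e_l.
Proof. by move=> [dg _] Bu; rewrite /partial deriveE //; exact: dg. Qed.

Lemma partial_differentiable B g l u : open B -> Ck 2 B g -> B u ->
  differentiable (partial l g) u.
Proof.
move=> oB gC Bu; have [_ cg] := gC; have [dg _] := cg ('e_l).
have [//|] := @near_eq_diff _ _ _ (fun y => 'd g y 'e_l) (partial l g) u _ (dg u Bu).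
  near=> y; have By : B y by near: y; exact: open_nbhs_nbhs.
  by rewrite (partial_diff l gC By).
by [].
Unshelve. all: by end_near. Qed.

Lemma partial_germ B g1 g2 l u : open B -> (forall u, B u -> g1 u = g2 u) -> B u ->
  partial l g1 u = partial l g2 u.
Proof.
move=> oB g12 Bu; apply: near_eq_derive.
by near=> y; apply: g12; near: y; exact: open_nbhs_nbhs.
Unshelve. all: by end_near. Qed.

Lemma stationary_germ B g1 g2 : open_nbhs (0 : 'rV[R]_d) B -> (forall u, B u -> g1 u = g2 u) ->
  stationary g1 -> stationary g2.
Proof. by move=> [oB B0] g12 s1 l; rewrite -(partial_germ _ oB g12). Qed.

Lemma flat_hess_germ B g1 g2 : open_nbhs (0 : 'rV[R]_d) B -> (forall u, B u -> g1 u = g2 u) ->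
  flat_hess g1 = flat_hess g2.
Proof.
move=> [oB B0] g12; apply/matrixP => i l; rewrite [LHS]mxE [RHS]mxE.
by apply: (@partial_germ B) => // u Bu; exact: partial_germ Bu.
Qed.

Lemma flat_hess_sym B g : open_nbhs (0 : 'rV[R]_d) B -> Ck 2 B g -> (flat_hess g)^T = flat_hess g.
Proof.
move=> [oB B0] gC; apply/matrixP => i l; rewrite [LHS]mxE [LHS]mxE [RHS]mxE.
have E j k : partial j (partial k g) 0 = 'd (fun y => 'd g y 'e_k) 0 'e_j.
  have [_ /(_ 'e_k) [dg _]] := gC.
  rewrite (@partial_germ B _ (fun y => 'd g y 'e_k)) //.
    by rewrite /partial deriveE //; exact: dg.
  by move=> u Bu; exact: partial_diff Bu.
by rewrite !E; exact: schwarz gC.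
Qed.

(** Since phi vanishes at x, the difference quotient of the product is a(x + h v) times that of phi,
    so continuity of [a] suffices. It is applied with [a] an entry of the inverse Gram matrix and
    [phi] a partial derivative. *)
Lemma is_derive_mul_zero (a phi : 'rV[R]_d -> R) x v :
  {for x, continuous a} -> phi x = 0 -> derivable phi x v ->
  is_derive x v (fun w => a w * phi w) (a x * 'D_v phi x).
Proof.
move=> ca px dphi.
suff h : h^-1 *: (((fun w => a w * phi w) \o shift x) (h *: v) - a x * phi x)
    @[h --> 0^'] --> a x * 'D_v phi x.
  by apply: DeriveDef; [apply/cvg_ex; exists (a x * 'D_v phi x)|exact: cvg_lim].
have hE : (fun h : R => h^-1 *: (((fun w => a w * phi w) \o shift x) (h *: v) - a x * phi x))
  = (fun h : R => a (h *: v + x) * (h^-1 *: ((phi \o shift x) (h *: v) - phi x))).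
  by apply/funext => h /=; rewrite px mulr0 !subr0 /GRing.scale /= mulrCA.
rewrite hE; apply: cvgM; last exact: dphi.
have cl : h *: v + x @[h --> (0 : R)^'] --> x.
  apply: cvg_within_filter.
  have : {for (0 : R), continuous (fun h : R => h *: v + x)}.
    apply: continuousD; [exact: scalel_continuous|exact: cst_continuous].
  by rewrite /prop_for /continuous_at scale0r add0r.
exact: (cvg_comp _ _ cl ca).
Qed.

Section Fixed.
Variables (B : set 'rV[R]_d) (g : 'rV[R]_d -> R) (G : 'rV[R]_d -> 'M[R]_d).
Hypotheses (B0 : open_nbhs (0 : 'rV[R]_d) B) (gC : Ck 2 B g).
Hypotheses (cG : {for 0, continuous G}) (pG : posdef (G 0)).

Lemma coord_gradE u : coord_grad G g u = (invmx (G u) *m \col_l partial l g u)^T.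
Proof.
by apply/rowP => k; rewrite !mxE; apply: eq_bigr => l _; rewrite !mxE.
Qed.

Lemma coord_grad_eq0 : coord_grad G g 0 = 0 <-> stationary g.
Proof.
have uG := posdef_unit pG; rewrite coord_gradE; split=> [h l|h]; last first.
  by rewrite (_ : \col_l _ = 0) ?mulmx0 ?trmx0 //; apply/colP => l; rewrite !mxE.
have : \col_l partial l g 0 = 0.
  by rewrite -[LHS](mulKVmx uG) -[invmx _ *m _]trmxK h trmx0 mulmx0.
by move=> /colP /(_ l); rewrite !mxE.
Qed.

Lemma coord_hess_stationary : stationary g ->
  coord_hess G g 0 = flat_hess g *m invmx (G 0).
Proof.
move=> g0; have [oB B00] := B0; have uG := posdef_unit pG.
have grad0 : coord_grad G g 0 = 0 by apply/coord_grad_eq0.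
have ciG : {for 0, continuous (fun u => invmx (G u))}.
  by apply: (@cvg_invmx R _ (nbhs (0 : 'rV[R]_d)) _ d G (G 0)).
(* The Christoffel symbols enter only multiplied by the gradient, so they contribute zero whatever
   their values. *)
apply/matrixP => i k; rewrite mxE [X in _ + X]big1 ?addr0; last first.
  by move=> j _; rewrite grad0 mxE mulr0.
rewrite [RHS]mxE.
have dl l : is_derive (0 : 'rV[R]_d) 'e_i (fun w => invmx (G w) k l * partial l g w)
    (invmx (G 0) k l * partial i (partial l g) 0).
  apply: is_derive_mul_zero => //.
    exact: (proj1 (@cvg_mxP R _ (nbhs (0 : 'rV[R]_d)) _ d d (fun w => invmx (G w)) _) ciG k l).
  by apply: diff_derivable; exact: partial_differentiable gC _.
have -> : partial i (fun w => coord_grad G g w 0 k) 0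
    = \sum_l invmx (G 0) k l * partial i (partial l g) 0.
  have -> : (fun w => coord_grad G g w 0 k)
      = \sum_l (fun w => invmx (G w) k l * partial l g w).
    by apply/funext => w; rewrite mxE fct_sumE.
  by rewrite /partial; apply: derive_val; apply: is_derive_sum.
apply: eq_bigr => l _; rewrite mxE mulrC; congr (_ * _).
(* Symmetry of G exchanges the indices of its inverse, so that it stands to the right of the flat
   Hessian. *)
by rewrite -[in RHS](proj1 pG) -trmx_inv mxE.
Qed.

Lemma coord_hess_psd : stationary g ->
  (forall a : 'rV[R]_d, 0 <= (a *m coord_hess G g 0 *m G 0 *m a^T) 0 0) <->
  (forall a : 'rV[R]_d, 0 <= (a *m flat_hess g *m a^T) 0 0).
Proof.
move=> g0; have uG := posdef_unit pG.
split=> h a; have := h a; rewrite coord_hess_stationary // mulmxA mulmxKV //.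
Qed.

Lemma coord_hess_neg_eigenvalue : stationary g ->
  (exists2 a : R, a < 0 & eigenvalue (coord_hess G g 0) a) <->
  exists v : 'rV[R]_d, (v *m flat_hess g *m v^T) 0 0 < 0.
Proof.
move=> g0; rewrite coord_hess_stationary //; apply: pencil_eigenvalue => //.
exact: flat_hess_sym gC.
Qed.

End Fixed.
End CriticalPoint.

(** * Tangent spaces *)

Section Curves.
Context {R : realType}.

(** [phi] is nonnegative to the right of 0 and nonpositive to the left. This is how a curve defined
    on both sides of 0 turns an inequality, tight at t = 0, into an equation for its velocity. *)
Lemma sign_limit (phi : R -> R) (a : R) :
  phi t @[t --> (0 : R)] --> a -> (\forall t \near (0 : R), 0 <= t * phi t) -> a = 0.
Proof.
move=> pa tp; apply/eqP/negPn/negP => a0.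
have na : 0 < `|a| by rewrite normr_gt0.
have : \forall t \near (0 : R), 0 <= t * phi t /\ `|a - phi t| < `|a|.
  near=> t; split; near: t => //.
  by move/cvgrPdist_lt : pa; exact.
move=> /nbhs_ballP [e /= e0 he].
have e2 : 0 < e / 2 by rewrite divr_gt0.
have be (s : R) : `|s| = e / 2 -> ball 0 e s.
  by move=> se; rewrite -ball_normE /= sub0r normrN se; lra.
have [p1 d1] := he _ (be (e / 2) (gtr0_norm e2)).
have [p2 d2] := he (- (e / 2)) (be _ (etrans (normrN _) (gtr0_norm e2))).
rewrite pmulr_rge0 // in p1; rewrite mulNr oppr_ge0 pmulr_rle0 // in p2.
move: a0; rewrite neq_lt => /orP[a0|a0].
  by move: d1; rewrite (ltr0_norm a0) ltr_norml; lra.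
by move: d2; rewrite (gtr0_norm a0) ltr_norml; lra.
Unshelve. all: by end_near. Qed.

(** Linearises a constraint along a curve: the constraint is divided by t and then t tends to 0. *)
Lemma mx_limit_eq0 m n (phi : R -> 'M[R]_(m, n)) (a : 'M[R]_(m, n)) :
  phi t @[t --> (0 : R)] --> a -> (\forall t \near (0 : R), t *: phi t = 0) -> a = 0.
Proof.
move=> /cvg_mxP pa tp; apply/matrixP => i j; rewrite [RHS]mxE.
apply: sign_limit (pa i j) _; near=> t.
have := congr1 (fun M : 'M[R]_(m, n) => M i j) (near tp t _) => /= h.
by rewrite mxE [RHS]mxE in h; rewrite h //; near: t.
Unshelve. all: by end_near. Qed.

(** Carathéodory's form of the derivative: velocities are computed by matrix algebra on the factor
    [delta] and limits of sums and products. *)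
Lemma caratheodory (E : normedModType R) (c : R -> E) (v : E) :
  is_derive (0 : R) 1 c v <->
  exists2 delta : R -> E, (forall t, c t = c 0 + t *: delta t) &
    delta t @[t --> (0 : R)] --> v.
Proof.
have shE (f : R -> E) : (fun h : R => h^-1 *: ((f \o shift 0) (h *: (1 : R)) - f 0))
    = (fun h : R => h^-1 *: (f h - f 0)).
  by apply/funext => h /=; rewrite addr0 /GRing.scale /= mulr1.
split=> [[dc <-]|[delta cE dv]].
  (* The limit is along full neighbourhoods of 0, so the value at 0 has to be the derivative
     itself. *)
  pose delta (t : R) := if t == 0 then 'D_1 c 0 else t^-1 *: (c t - c 0).
  exists delta => [t|].
    rewrite /delta; case: eqVneq => [->|t0]; first by rewrite scale0r addr0.
    by rewrite scalerA mulfV // scale1r addrC subrK.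
  have dl : h^-1 *: (c h - c 0) @[h --> (0 : R)^'] --> 'D_1 c 0.
    by have := dc; rewrite /derivable /derive shE.
  apply/cvgrPdist_lt => e e0; move/cvgrPdist_lt : dl => /(_ e e0).
  rewrite /dnbhs near_withinE => h; near=> t; rewrite /delta; case: eqVneq => [_|t0].
    by rewrite subrr normr0.
  by move: t0; near: t.
have dl : h^-1 *: ((c \o shift 0) (h *: (1 : R)) - c 0) @[h --> (0 : R)^'] --> v.
  have dv' : delta t @[t --> (0 : R)^'] --> v by apply: cvg_within_filter.
  rewrite shE; apply: cvg_trans dv'.
  apply: near_eq_cvg; near=> h.
  have h0 : h != 0 by near: h; exact: nbhs_dnbhs_neq.
  by rewrite cE addrC addrA addNr add0r scalerA mulVf // scale1r.
by apply: DeriveDef; [apply/cvg_ex; exists v|exact: cvg_lim].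
Unshelve. all: by end_near. Qed.

Lemma cvg_scale0 (E : normedModType R) (f : R -> E) (a : E) :
  f t @[t --> (0 : R)] --> a -> t *: f t @[t --> (0 : R)] --> (0 : E).
Proof.
move=> fa; rewrite -(scale0r a).
by apply: (@cvgZ _ _ _ (nbhs (0 : R))) => //; exact: cvg_id.
Qed.

End Curves.

Section Cayley.
Context {R : realType} {n : nat}.
Variable Om : 'M[R]_n.
Hypothesis skew : Om^T = - Om.

Lemma skew_quad (x : 'cV[R]_n) : x^T *m Om *m x = 0.
Proof.
apply/matrixP => i j; rewrite !ord1 [RHS]mxE.
have : (x^T *m Om *m x)^T = - (x^T *m Om *m x).
  by rewrite !trmx_mul trmxK skew mulNmx mulmxN mulmxA.
move=> /matrixP /(_ 0 0); rewrite mxE [RHS]mxE => h; lra.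
Qed.

Lemma cayley_unit (s : R) : 1%:M + s *: Om \in unitmx.
Proof.
apply: unitmx_ker => x; rewrite mulmxDl mul1mx => xE.
apply: mulTmx_eq0; have := congr1 (mulmx x^T) xE.
by rewrite mulmxDr -scalemxAl -scalemxAr mulmxA skew_quad scaler0 addr0 mulmx0.
Qed.

(** The Cayley transform: a rational curve of orthogonal matrices through the identity with velocity
    [Om], in the role of the exponential. *)
Definition cayley (t : R) : 'M[R]_n :=
  invmx (1%:M + (- (t / 2)) *: Om) *m (1%:M + (t / 2) *: Om).

(** Transposition exchanges 1 + s Om and 1 - s Om because [Om] is skew; these two matrices commute,
    and so do their inverses. *)
Lemma cayley_orthogonal t : orthogonal_mx (cayley t).
Proof.
rewrite /orthogonal_mx /= /cayley; set s := t / 2.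
have u1 := cayley_unit s; have u2 := cayley_unit (- s).
have tr a : (1%:M + a *: Om)^T = 1%:M + (- a) *: Om.
  by rewrite linearD linearZ /= trmx1 skew scalerN scaleNr.
have com : (1%:M + (- s) *: Om) *m (1%:M + s *: Om) = (1%:M + s *: Om) *m (1%:M + (- s) *: Om).
  by rewrite !mulmxDl !mulmxDr !mul1mx !mulmx1 -!scalemxAl -!scalemxAr !scalerA mulrC addrACA [s *: Om + _]addrC addrACA.
have comV : invmx (1%:M + s *: Om) *m invmx (1%:M + (- s) *: Om)
    = invmx (1%:M + (- s) *: Om) *m invmx (1%:M + s *: Om).
  have u21 : (1%:M + (- s) *: Om) *m (1%:M + s *: Om) \in unitmx by rewrite unitmx_mul u1 u2.
  apply: (can_inj (mulKmx u21)).
  by rewrite [RHS]mulmxA {2}com !mulmxA mulmxK // mulmxV // mulmxK // mulmxV.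
rewrite trmx_mul trmx_inv !tr opprK mulmxA -[_ *m invmx _ *m invmx _]mulmxA.
by rewrite comV mulmxA mulmxV // mul1mx mulVmx.
Qed.

Lemma cayleyE t : cayley t = 1%:M + t *: (invmx (1%:M + (- (t / 2)) *: Om) *m Om).
Proof.
rewrite /cayley; set s := t / 2; have u2 := cayley_unit (- s).
transitivity (invmx (1%:M + (- s) *: Om) *m (1%:M + (- s) *: Om + t *: Om)).
  by congr (_ *m _); rewrite -addrA -scalerDl; congr (_ + _ *: _); rewrite /s; lra.
by rewrite mulmxDr mulVmx // scalemxAr.
Qed.

Lemma cayley_cvg :
  invmx (1%:M + (- (t / 2)) *: Om) *m Om @[t --> (0 : R)] --> Om.
Proof.
rewrite -[X in _ --> X]mul1mx -[1%:M in X in _ --> X]invmx1.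
apply: (@cvg_mulmx _ _ (nbhs (0 : R))); last exact: cvg_cst.
apply: (@cvg_invmx _ _ (nbhs (0 : R))); first exact: unitmx1.
rewrite -[X in _ --> X]addr0; apply: (@cvgD _ _ _ (nbhs (0 : R))); first exact: cvg_cst.
rewrite (_ : (fun t : R => _) = fun t : R => t *: (- (2^-1) *: Om)); last first.
  by apply/funext => t; rewrite scalerA mulrN.
by apply: (@cvg_scale0 _ _ _ (- (2^-1) *: Om)); exact: cvg_cst.
Qed.

End Cayley.

Section TangentSpaces.
Context {R : realType}.

Lemma tangent_diff (V E : normedModType R) (B : set V) (A : set E) (psi : V -> E) u a :
  open B -> B u -> (forall w, B w -> A (psi w)) -> differentiable psi u ->
  tangent_space A (psi u) ('d psi u a).
Proof.
move=> oB Bu BA dpsi; exists (fun t : R => psi (u + t *: a)); split.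
- by rewrite scale0r addr0.
- near=> t; apply: BA; near: t.
  have : {for (0 : R), continuous (fun t : R => u + t *: a)}.
    apply: continuousD; [exact: cst_continuous|exact: scalel_continuous].
  apply; rewrite /= scale0r addr0; exact: open_nbhs_nbhs.
- have := @diff_line R V E psi u a 0; rewrite scale0r addr0; exact.
Unshelve. all: by end_near. Qed.

Lemma tangent_set1 (E : normedModType R) (x v : E) : tangent_space [set x] x v <-> v = 0.
Proof.
split=> [[c [c0 cx dc]]|->].
  have : is_derive (0 : R) 1 c 0.
    by apply: near_eq_is_derive (is_derive_cst x _ _); near=> t; apply/esym; near: t.
  by move=> [_ <-]; case: dc.
exists (cst x); split=> //; first by near=> t.
exact: is_derive_cst.
Unshelve. all: by end_near. Qed.

(** The Moore-Penrose left inverse when [Y] has full column rank; [Y *m pinv_col Y] is then the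
    orthogonal projector onto the column space. *)
Definition pinv_col m n (Y : 'M[R]_(m, n)) := invmx (Y^T *m Y) *m Y^T.

Lemma pinv_colK m n (Y : 'M[R]_(m, n)) : full_col_rank Y -> pinv_col Y *m Y = 1%:M.
Proof. by move=> /posdef_gram/posdef_unit uG; rewrite /pinv_col -mulmxA mulVmx. Qed.

Lemma pinv_col_sym m n (Y : 'M[R]_(m, n)) : (Y *m pinv_col Y)^T = Y *m pinv_col Y.
Proof.
by rewrite /pinv_col !trmx_mul trmxK trmx_inv trmx_mul trmxK !mulmxA.
Qed.

(** The curve is (Y + t Z)(Y + t Z)^T; the rank stays r near 0 because det (Y^T (Y + t Z)) tends to
    a nonzero limit. *)
Lemma tangent_psd_gram p r (Y Z : 'M[R]_(p, r)) : full_col_rank Y ->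
  tangent_space (@psd_rank R p r) (Y *m Y^T) (Y *m Z^T + Z *m Y^T).
Proof.
move=> fY; pose c (t : R) := (Y + t *: Z) *m (Y + t *: Z)^T.
exists c; split; first by rewrite /c scale0r addr0.
  have cd : \det (Y^T *m (Y + t *: Z)) @[t --> (0 : R)] --> \det (Y^T *m Y).
    apply: (@cvg_det _ _ (nbhs (0 : R))); apply: (@cvg_mulmx _ _ (nbhs (0 : R))).
      exact: cvg_cst.
    rewrite -[X in _ --> X]addr0; apply: (@cvgD _ _ _ (nbhs (0 : R))); first exact: cvg_cst.
    by apply: (@cvg_scale0 _ _ _ Z); exact: cvg_cst.
  have d0 : \det (Y^T *m Y) != 0.
    by rewrite -unitfE -unitmxE; apply/posdef_unit/posdef_gram.
  near=> t; apply: psd_rank_gram; apply/full_col_rankP => x xE.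
  have uG : Y^T *m (Y + t *: Z) \in unitmx.
    by rewrite unitmxE unitfE; near: t; exact: cvgr_neq0 cd d0.
  by rewrite -(mulKmx uG x) -[_ *m _ *m x]mulmxA xE !mulmx0.
apply/caratheodory; exists (fun t => Y *m Z^T + Z *m Y^T + t *: (Z *m Z^T)) => [t|].
  rewrite /c scale0r addr0 linearD linearZ /= mulmxDl !mulmxDr -!scalemxAl -!scalemxAr.
  by rewrite !scalerDr !addrA.
rewrite -[X in _ --> X]addr0; apply: (@cvgD _ _ _ (nbhs (0 : R))); first exact: cvg_cst.
by apply: (@cvg_scale0 _ _ _ (Z *m Z^T)); exact: cvg_cst.
Unshelve. all: by end_near. Qed.

(** With P the projector onto the column space of Y, the hypothesis says that the symmetric matrix
    (1 - P) v (1 - P) has zero form, hence is zero, so v = v P + P v - P v P. *)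
Lemma tangent_psd_gram_ex p r (Y : 'M[R]_(p, r)) (v : 'M[R]_p) : full_col_rank Y ->
  v^T = v -> (forall x : 'cV[R]_p, Y *m Y^T *m x = 0 -> (x^T *m v *m x) 0 0 = 0) ->
  exists Z, v = Y *m Z^T + Z *m Y^T.
Proof.
move=> fY sv vx; set P := Y *m pinv_col Y.
have PT : P^T = P by exact: pinv_col_sym.
have PY : P *m Y = Y by rewrite /P -mulmxA pinv_colK // mulmx1.
have PPY : (pinv_col Y)^T *m Y^T = P by rewrite -trmx_mul PT.
have N0 : (1%:M - P) *m v *m (1%:M - P) = 0.
  apply: sym_quad_eq0; first by rewrite !trmx_mul linearB /= trmx1 PT sv mulmxA.
  move=> x; have := vx ((1%:M - P) *m x); rewrite trmx_mul linearB /= trmx1 PT.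
  rewrite !mulmxA; apply; rewrite -[_ *m Y^T *m _]mulmxA -trmx1 -{1}PT -linearB /=.
  by rewrite -trmx_mul mulmxBl mul1mx PY subrr trmx0 mulmx0 mul0mx.
have vE : v = v *m P + P *m v - P *m v *m P.
  move: N0; rewrite mulmxBl mul1mx mulmxBr mulmx1 mulmxBl => /eqP.
  by rewrite subr_eq0 subr_eq => /eqP {1}->; rewrite addrAC addrC addrA.
(* The block P v P is shared equally: Z Y^T = v P - P v P / 2 and Y Z^T is its transpose. *)
exists ((v - 2^-1 *: (P *m v)) *m (pinv_col Y)^T).
rewrite trmx_mul trmxK linearB linearZ /= trmx_mul sv PT -[X in _ + X]mulmxA PPY.
rewrite mulmxA -/P mulmxBr mulmxBl -scalemxAr -scalemxAl mulmxA.
rewrite {1}vE addrACA -opprD -scalerDl (_ : 2^-1 + 2^-1 = 1 :> R); last by lra.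
by rewrite scale1r [P *m v + _]addrC.
Qed.

(** For x in the kernel of X, semidefiniteness along the curve gives t (x^T delta x) >= 0 on both
    sides of 0, so [sign_limit] applies. For the converse, X is factored as Y Y^T and a curve of
    Gram matrices realises v. *)
Lemma tangent_psdP p r (X v : 'M[R]_p) : psd_rank r X ->
  tangent_space (@psd_rank R p r) X v <->
  v^T = v /\ forall x : 'cV[R]_p, X *m x = 0 -> (x^T *m v *m x) 0 0 = 0.
Proof.
move=> rX; split=> [[c [c0 cA /caratheodory[delta cE dv]]]|[sv vx]].
  split=> [|x Xx].
    apply/subr0_eq; apply: (@mx_limit_eq0 _ _ _ (fun t => (delta t)^T - delta t)).
      apply: (@cvgB _ _ _ (nbhs (0 : R))) => //; exact: (@cvg_trmx _ _ (nbhs (0 : R))).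
    near=> t; have [sc _ _] : psd_rank r (c t) by near: t.
    have := sc; rewrite /sym_mx /= cE c0 linearD linearZ /=.
    have -> : X^T = X by case: rX.
    by move=> /addrI h; rewrite scalerBr h subrr.
  apply: (@sign_limit _ (fun t => (x^T *m delta t *m x) 0 0)).
    apply: (proj1 (@cvg_mxP _ _ (nbhs (0 : R)) _ _ _ _ _)).
    apply: (@cvg_mulmx _ _ (nbhs (0 : R))); last exact: cvg_cst.
    by apply: (@cvg_mulmx _ _ (nbhs (0 : R))) => //; exact: cvg_cst.
  near=> t; have [_ _ [_ /(_ x)]] : psd_rank r (c t) by near: t.
  rewrite cE c0 mulmxDr mulmxDl -mulmxA Xx mulmx0 add0r -scalemxAr -scalemxAl.
  by rewrite mxE.
have [Y fY XE] := psd_rank_factor rX; rewrite XE in vx *.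
have [Z ->] := tangent_psd_gram_ex fY sv vx; exact: tangent_psd_gram.
Unshelve. all: by end_near. Qed.

(** Cayley curves realise the vectors Y Om. For a general curve in the orbit, the left inverse of Y
    recovers the orthogonal factor and its velocity. *)
Lemma tangent_orbitP p r (Y w : 'M[R]_(p, r)) : full_col_rank Y ->
  tangent_space [set Y *m Q | Q in @orthogonal_mx R r] Y w <->
  exists2 Om : 'M[R]_r, Om^T = - Om & w = Y *m Om.
Proof.
move=> fY; have YK := pinv_colK fY; split; last first.
  move=> [Om skew ->]; exists (fun t => Y *m cayley Om t); split.
  - by rewrite cayleyE // scale0r addr0 mulmx1.
  - by near=> t; exists (cayley Om t) => //; exact: cayley_orthogonal.
  apply/caratheodory.
  exists (fun t => Y *m (invmx (1%:M + (- (t / 2)) *: Om) *m Om)) => [t|].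
    by rewrite !cayleyE // scale0r addr0 mulmx1 mulmxDr mulmx1 -scalemxAr.
  by apply: (@cvg_mulmx _ _ (nbhs (0 : R))); [exact: cvg_cst|exact: cayley_cvg].
move=> [c [c0 cA /caratheodory[delta cE dw]]].
exists (pinv_col Y *m w).
  apply/eqP; rewrite -addr_eq0; apply/eqP.
  (* On the orbit Q = 1 + t K, and orthogonality of Q reads t (K^T + K + t K^T K) = 0. *)
  pose K t := pinv_col Y *m delta t.
  have cK : K t @[t --> (0 : R)] --> pinv_col Y *m w.
    by apply: (@cvg_mulmx _ _ (nbhs (0 : R))) => //; exact: cvg_cst.
  have cKT : (K t)^T @[t --> (0 : R)] --> (pinv_col Y *m w)^T.
    exact: (@cvg_trmx _ _ (nbhs (0 : R))).
  apply: (@mx_limit_eq0 _ _ _ (fun t => (K t)^T + K t + t *: ((K t)^T *m K t))).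
    rewrite -[X in _ --> X]addr0; apply: (@cvgD _ _ _ (nbhs (0 : R))).
      exact: (@cvgD _ _ _ (nbhs (0 : R))).
    apply: (@cvg_scale0 _ _ _ ((pinv_col Y *m w)^T *m (pinv_col Y *m w))).
    exact: (@cvg_mulmx _ _ (nbhs (0 : R))).
  near=> t; have [Q oQ QE] : [set Y *m Q | Q in @orthogonal_mx R r] (c t) by near: t.
  have QK : Q = 1%:M + t *: K t.
    by rewrite -[LHS]mul1mx -YK -mulmxA QE cE c0 mulmxDr YK -scalemxAr.
  have KT : (1%:M + t *: K t)^T = 1%:M + t *: (K t)^T by rewrite linearD linearZ /= trmx1.
  move: oQ; rewrite /orthogonal_mx /= QK KT.
  rewrite mulmxDl !mulmxDr mul1mx mulmx1 mul1mx -!scalemxAl -scalemxAr -addrA => /eqP.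
  rewrite -subr_eq0 addrAC subrr add0r => /eqP <-.
  by rewrite !scalerDr addrCA addrA.
apply/eqP; rewrite -subr_eq0; apply/eqP.
(* t delta(t) = Y (Q - 1) lies in the column space of Y, which the projector fixes. *)
apply: (@mx_limit_eq0 _ _ _ (fun t => delta t - Y *m (pinv_col Y *m delta t))).
  apply: (@cvgB _ _ _ (nbhs (0 : R))) => //.
  apply: (@cvg_mulmx _ _ (nbhs (0 : R))); first exact: cvg_cst.
  by apply: (@cvg_mulmx _ _ (nbhs (0 : R))) => //; exact: cvg_cst.
near=> t; have [Q oQ QE] : [set Y *m Q | Q in @orthogonal_mx R r] (c t) by near: t.
have tE : t *: delta t = Y *m (Q - 1%:M).
  by rewrite mulmxBr mulmx1 QE cE c0 addrC addrA addNr add0r.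
by rewrite scalerBr !scalemxAr tE [pinv_col Y *m _]mulmxA YK mul1mx subrr.
Unshelve. all: by end_near. Qed.

End TangentSpaces.

(** * Transfer of critical points between models *)

Lemma set_bij_compK (T1 T2 T3 : Type) (A : set T1) (B : set T2) (C : set T3)
    (f : T1 -> T2) (g : T2 -> T3) :
  set_fun A B f -> set_bij B C g -> set_bij A C (g \o f) -> set_bij A B f.
Proof.
move=> fAB [gBC ginj _] [_ gfinj gfsurj]; split=> // [x y xA yA fxy|y By].
  by apply: gfinj => //=; rewrite fxy.
have [x Ax gfx] := gfsurj (g y) (gBC y By).
by exists x => //; apply: ginj; rewrite ?inE //; exact: fAB.
Qed.

Lemma near_eq_continuous (T U : topologicalType) (F G : T -> U) (x : T) :
  (\near x, F x = G x) -> {for x, continuous F} -> {for x, continuous G}.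
Proof.
move=> FG cF; rewrite /prop_for /continuous_at -(nbhs_singleton FG).
by apply: cvg_trans cF; exact: near_eq_cvg.
Qed.

Section Presentation.
Context {R : realType} (p r : nat) {E : normedModType R}.

(* M is a model of the manifold of rank r positive semidefinite matrices: pi
   maps its total space onto that manifold with the classes of M as fibres, dpi
   is the differential of pi and hl a closed formula for the horizontal
   projection. *)
Record models (M : geometry E) (pi : E -> 'M[R]_p) (dpi : E -> E -> 'M[R]_p)
    (hl : E -> E -> E) : Prop := Models {
  pi_total : forall y, total M y -> psd_rank r (pi y) ;
  pi_cls : forall y z, total M y -> total M z -> cls M y = cls M z <-> pi y = pi z ;
  pi_section : forall d (phi : 'rV[R]_d -> 'M[R]_p) (B : set 'rV[R]_d),
    open_nbhs (0 : 'rV[R]_d) B -> Cinf B phi -> (forall u, B u -> psd_rank r (phi u)) ->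
    exists (psi : 'rV[R]_d -> E) (B' : set 'rV[R]_d),
      [/\ open_nbhs (0 : 'rV[R]_d) B', B' `<=` B, Cinf B' psi &
          forall u, B' u -> total M (psi u) /\ pi (psi u) = phi u] ;
  pi_smooth : forall d (psi : 'rV[R]_d -> E) (B : set 'rV[R]_d),
    open B -> Cinf B psi -> Cinf B (pi \o psi) ;
  dpi_diff : forall d (psi : 'rV[R]_d -> E) u a,
    differentiable psi u -> 'd (pi \o psi) u a = dpi (psi u) ('d psi u a) ;
  dpi_bij : forall y, total M y ->
    set_bij (horizontal M y) (tangent_space (@psd_rank R p r) (pi y)) (dpi y) ;
  hl_linear : forall y, total M y -> linear (hl y) ;
  hlE : forall y v, total M y -> tangent_space (total M) y v ->
    [/\ hlift M y v = hl y v, horizontal M y (hl y v) & dpi y (hl y v) = dpi y v] ;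
  metricC : forall y u v, total M y -> metric M y u v = metric M y v u ;
  metric_linear : forall y v k u u', total M y ->
    metric M y (k *: u + u') v = k * metric M y u v + metric M y u' v ;
  metric_gt0 : forall y v, total M y -> horizontal M y v -> v != 0 -> 0 < metric M y v v ;
  metric_continuous : forall d (psi w1 w2 : 'rV[R]_d -> E),
    (\forall u \near (0 : 'rV[R]_d), total M (psi u)) ->
    {for 0, continuous psi} -> {for 0, continuous w1} -> {for 0, continuous w2} ->
    {for 0, continuous
      (fun u => metric M (psi u) (hl (psi u) (w1 u)) (hl (psi u) (w2 u)))}
}.

Section Charts.
Variables (M : geometry E) (pi : E -> 'M[R]_p) (dpi : E -> E -> 'M[R]_p)
  (hl : E -> E -> E).
Hypothesis HM : models M pi dpi hl.
Variables (d : nat) (psi : 'rV[R]_d -> E) (B : set 'rV[R]_d).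
Hypotheses (B0 : open_nbhs (0 : 'rV[R]_d) B) (psiC : Cinf B psi).
Hypothesis psiM : forall u, B u -> total M (psi u).

Lemma chart_differentiable u : B u -> differentiable psi u.
Proof. by move=> Bu; have [/(_ u Bu)] := psiC 1. Qed.

Lemma chart_tangent u a : B u -> tangent_space (total M) (psi u) ('d psi u a).
Proof.
move=> Bu; have dpsi := chart_differentiable Bu.
exact: (@tangent_diff R _ E B (total M) psi u a (proj1 B0) Bu psiM dpsi).
Qed.

(** Replaces the choice hidden in [hlift] by the formula [hl], from which linearity in [a] and
    continuity in [u] can be read off. *)
Lemma chart_vecE u a : B u -> chart_vec M psi u a = hl (psi u) ('d psi u a).
Proof.
by move=> Bu; have [] := hlE HM (psiM Bu) (chart_tangent a Bu).
Qed.

Lemma dpi_chart_vec u a : B u -> dpi (psi u) (chart_vec M psi u a) = 'd (pi \o psi) u a.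
Proof.
move=> Bu; rewrite chart_vecE // (dpi_diff HM) //; last exact: chart_differentiable.
by have [_ _] := hlE HM (psiM Bu) (chart_tangent a Bu).
Qed.

Lemma chart_vec_horizontal u a : B u -> horizontal M (psi u) (chart_vec M psi u a).
Proof.
move=> Bu; rewrite chart_vecE //.
by have [] := hlE HM (psiM Bu) (chart_tangent a Bu).
Qed.

Lemma chart_vec_linear u : B u -> linear (chart_vec M psi u).
Proof.
move=> Bu k a b; rewrite !chart_vecE // [X in hl _ X]linearP.
exact: (hl_linear HM (psiM Bu)).
Qed.

Lemma metric_sumr y (I : Type) (s : seq I) (c : I -> R) (v : I -> E) w : total M y ->
  metric M y (\sum_(i <- s) c i *: v i) w = \sum_(i <- s) c i * metric M y (v i) w.
Proof.
move=> My; have m0 : metric M y 0 w = 0.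
  by have := metric_linear HM w (-1) 0 0 My; rewrite scaler0 addr0 mulN1r addNr.
elim: s => [|i s IH]; first by rewrite !big_nil.
by rewrite !big_cons (metric_linear HM) // IH.
Qed.

Lemma gram_quad u (a b : 'rV[R]_d) : B u ->
  (a *m gram M psi u *m b^T) 0 0
  = metric M (psi u) (chart_vec M psi u a) (chart_vec M psi u b).
Proof.
move=> Bu; have My := psiM Bu; pose cv := pack_linear (chart_vec_linear Bu).
have cvE c : chart_vec M psi u c = \sum_i c 0 i *: chart_vec M psi u 'e_i.
  rewrite {1}(row_sum_delta c) -[chart_vec M psi u]/(cv : _ -> _) linear_sum.
  by apply: eq_bigr => i _; rewrite linearZ.
rewrite cvE metric_sumr // -mulmxA mxE; apply: eq_bigr => i _; congr (_ * _).
rewrite (metricC HM) // cvE metric_sumr // mxE; apply: eq_bigr => j _.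
by rewrite !mxE mulrC (metricC HM).
Qed.

Lemma gram_posdef u : B u ->
  set_bij [set: 'rV[R]_d] (horizontal M (psi u)) (chart_vec M psi u) ->
  posdef (gram M psi u).
Proof.
move=> Bu [_ cinj _]; split.
  by apply/matrixP => i j; rewrite !mxE (metricC HM) //; exact: psiM.
move=> x x0; rewrite -{2}[x]trmxK gram_quad //; apply: (metric_gt0 HM).
- exact: psiM.
- exact: chart_vec_horizontal.
apply: contra_neq x0 => cx0.
have c0 : chart_vec M psi u 0 = 0.
  by rewrite -[chart_vec M psi u]/(pack_linear (chart_vec_linear Bu) : _ -> _) linear0.
have : x^T = 0 by apply: cinj; rewrite ?inE // cx0 c0.
by move=> /(congr1 trmx); rewrite trmxK trmx0.
Qed.

Lemma gram_continuous : {for (0 : 'rV[R]_d), continuous (gram M psi)}.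
Proof.
have [oB B00] := B0.
have nB : \forall u \near (0 : 'rV[R]_d), B u by exact: open_nbhs_nbhs.
apply/(@cvg_mxP _ _ (nbhs (0 : 'rV[R]_d))) => i j.
have cpsi : {for 0, continuous psi} := Ck_continuous (psiC 0) B00.
have cd a : {for 0, continuous (fun u => 'd psi u a)}.
  by have [_ /(_ a)] := psiC 1; exact.
have nM : \forall u \near (0 : 'rV[R]_d), total M (psi u).
  by near=> u; apply: psiM; near: u.
have cm := metric_continuous HM nM cpsi (cd 'e_i) (cd 'e_j).
pose F u := metric M (psi u) (hl (psi u) ('d psi u 'e_i)) (hl (psi u) ('d psi u 'e_j)).
have FE u : B u -> gram M psi u i j = F u.
  by move=> Bu; rewrite mxE (chart_vecE 'e_i Bu) (chart_vecE 'e_j Bu).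
have cF : {for (0 : 'rV[R]_d), continuous F} := cm.
clear cm; suff : {for (0 : 'rV[R]_d), continuous (fun u => gram M psi u i j)} by [].
by apply: near_eq_continuous cF; near=> u; apply/esym/FE; near: u.
Unshelve. all: by end_near. Qed.

End Charts.

Section Criticality.
Variables (M : geometry E) (pi : E -> 'M[R]_p) (dpi : E -> E -> 'M[R]_p)
  (hl : E -> E -> E).
Hypothesis HM : models M pi dpi hl.
Variable f : 'M[R]_p -> R.
Hypothesis f_C2 : Ck 2 [set: 'M[R]_p] f.

(* Criticality of c for f \o pi together with a property of the flat Hessian in a
   chart: all three notions of critical points are of this form. *)
Definition critical_with (h : E -> R) (c : set E) (P : forall d, 'M[R]_d -> Prop) : Prop :=
  point M c /\ exists (d : nat) (psi : 'rV[R]_d -> E),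
    [/\ local_param M c psi, stationary (h \o psi) & P d (flat_hess (h \o psi))].

Definition hess_any (d : nat) (H : 'M[R]_d) : Prop := True.
Definition hess_psd (d : nat) (H : 'M[R]_d) : Prop :=
  forall a : 'rV[R]_d, 0 <= (a *m H *m a^T) 0 0.
Definition hess_neg (d : nat) (H : 'M[R]_d) : Prop :=
  exists a : 'rV[R]_d, (a *m H *m a^T) 0 0 < 0.

Lemma local_param_good d (psi : 'rV[R]_d -> E) c : local_param M c psi ->
  exists B : set 'rV[R]_d, [/\ open_nbhs (0 : 'rV[R]_d) B, Ck 2 B (f \o pi \o psi),
    {for (0 : 'rV[R]_d), continuous (gram M psi)} & posdef (gram M psi 0)].
Proof.
move=> [My _ [B [B0 psiC psiM bij]]]; exists B; split=> //.
- apply: (@Ck_comp_mx _ _ _ _ _ _ (pi \o psi)) => //; first exact: (proj1 B0).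
  exact: (pi_smooth HM (proj1 B0) psiC).
- refine (gram_continuous HM B0 psiC psiM).
- by apply: (gram_posdef HM B0 psiC psiM); [exact: (proj2 B0)|exact: bij (proj2 B0)].
Qed.

Lemma FOSP_critical c : FOSP M (f \o pi) c <-> critical_with (f \o pi) c hess_any.
Proof.
split=> [[pc [d [psi [par g0]]]]|[pc [d [psi [par g0 _]]]]]; split=> //; exists d, psi;
  have [B [B0 hC cG pG]] := local_param_good par; split=> //; exact/(coord_grad_eq0 _ pG).
Qed.

Lemma SOSP_critical c : SOSP M (f \o pi) c <-> critical_with (f \o pi) c hess_psd.
Proof.
split=> -[pc [d [psi [par g0 hP]]]]; split=> //; exists d, psi;
  have [B [B0 hC cG pG]] := local_param_good par.
  have s0 : stationary (f \o pi \o psi) by exact/(coord_grad_eq0 _ pG).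
  by split=> //; apply/(coord_hess_psd B0 hC cG pG).
have s0 : coord_grad (gram M psi) (f \o pi \o psi) 0 = 0 by exact/(coord_grad_eq0 _ pG).
by split=> //; apply/(coord_hess_psd B0 hC cG pG).
Qed.

Lemma strict_saddle_critical c :
  strict_saddle M (f \o pi) c <-> critical_with (f \o pi) c hess_neg.
Proof.
split=> -[pc [d [psi [par g0 hP]]]]; split=> //; exists d, psi;
  have [B [B0 hC cG pG]] := local_param_good par.
  have s0 : stationary (f \o pi \o psi) by exact/(coord_grad_eq0 _ pG).
  by split=> //; apply/(coord_hess_neg_eigenvalue B0 hC cG pG).
have s0 : coord_grad (gram M psi) (f \o pi \o psi) 0 = 0 by exact/(coord_grad_eq0 _ pG).
by split=> //; apply/(coord_hess_neg_eigenvalue B0 hC cG pG).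
Qed.

End Criticality.
End Presentation.

(** * The embedded manifold as a model of itself, and the transfer of charts *)

Section Embedded.
Context {R : realType} (p r : nat).

Lemma Me_models :
  models r (@Me R p r) (@id 'M[R]_p) (fun _ v => v) (fun _ v => v).
Proof.
(* The fibre is a single point, so the vertical space is zero and every tangent vector is its own
   lift. *)
have lift1 (y v : 'M[R]_p) : tangent_space (@psd_rank R p r) y v -> hlift (Me p r) y v = v.
  move=> ty; rewrite /hlift; case: xgetP => [w _ [_]|/(_ v) []].
    by rewrite /vertical /= => /tangent_set1 /subr0_eq.
  by split=> //; rewrite /vertical /= subrr; apply/tangent_set1.
apply: Models.
- by [].
- by move=> y z _ _; split=> [/= e|->//]; have : [set z] y by rewrite -e.
- move=> d phi B B0 phiC phiB; exists phi, B; split=> // u Bu; split=> //; exact: phiB.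
- by move=> d psi B _ psiC.
- by move=> d psi u a _.
- by move=> y _; split=> // v tv; exists v.
- by move=> y _ k u v.
- by move=> y v _ tv; split=> //; exact: lift1.
- move=> y u v _; rewrite /=.
  by rewrite -mxtrace_tr trmx_mul trmxK.
- by move=> y v k u u' _ /=; rewrite linearD linearZ /= mulmxDl -scalemxAl linearD linearZ.
- by move=> y v _ _; exact: mxtrace_tr_mul_gt0.
move=> d psi w1 w2 _ _ c1 c2.
apply: (@cvg_mxtrace _ _ (nbhs (0 : 'rV[R]_d))).
apply: (@cvg_mulmx _ _ (nbhs (0 : 'rV[R]_d))) => //.
exact: (@cvg_trmx _ _ (nbhs (0 : 'rV[R]_d))).
Qed.

End Embedded.

Section Transfer.
Context {R : realType} (p r : nat) {E : normedModType R}.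
Variables (M : geometry E) (pi : E -> 'M[R]_p) (dpi : E -> E -> 'M[R]_p)
  (hl : E -> E -> E).
Hypothesis HM : models r M pi dpi hl.
Let e : geometry 'M[R]_p := Me p r.

(** The chart vectors of [pi \o psi] are the images under [dpi] of those of [psi], and [dpi] is a
    bijection from the horizontal space onto the tangent space, so each bijectivity implies the
    other. *)
Lemma bij_transfer d (psi : 'rV[R]_d -> E) (B : set 'rV[R]_d) u :
  open_nbhs (0 : 'rV[R]_d) B -> Cinf B psi -> (forall u, B u -> total M (psi u)) -> B u ->
  set_bij [set: 'rV[R]_d] (horizontal M (psi u)) (chart_vec M psi u) <->
  set_bij [set: 'rV[R]_d] (horizontal e (pi (psi u))) (chart_vec e (pi \o psi) u).
Proof.
move=> B0 psiC psiM Bu; have HE := @Me_models R p r.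
have eC : Cinf B (pi \o psi) by exact: (pi_smooth HM (proj1 B0) psiC).
have eM w : B w -> total e ((pi \o psi) w) by move=> /psiM; exact: (pi_total HM).
have -> : chart_vec e (pi \o psi) u = dpi (psi u) \o chart_vec M psi u.
  apply/funext => a /=; rewrite (dpi_chart_vec HM B0 psiC psiM) //.
  by rewrite (chart_vecE HE B0 eC eM).
split=> [h|]; first exact: set_bij_comp h (dpi_bij HM (psiM _ Bu)).
apply: set_bij_compK (dpi_bij HM (psiM _ Bu)).
by move=> a _; apply: (chart_vec_horizontal HM B0 psiC psiM).
Qed.

Lemma local_param_push d (psi : 'rV[R]_d -> E) y : total M y ->
  local_param M (cls M y) psi -> local_param e (cls e (pi y)) (pi \o psi).
Proof.
move=> My [M0 c0 [B [B0 psiC psiM bij]]]; split.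
- exact: (pi_total HM M0).
- by rewrite /= (proj1 (pi_cls HM M0 My) c0).
exists B; split=> //.
- exact: (pi_smooth HM (proj1 B0) psiC).
- by move=> u /psiM; exact: (pi_total HM).
by move=> u Bu; apply/(bij_transfer B0 psiC psiM Bu); exact: bij.
Qed.

Lemma local_param_lift d (phi : 'rV[R]_d -> 'M[R]_p) X : local_param e (cls e X) phi ->
  exists (psi : 'rV[R]_d -> E) (B : set 'rV[R]_d),
    [/\ open_nbhs (0 : 'rV[R]_d) B, total M (psi 0), pi (psi 0) = X,
        local_param M (cls M (psi 0)) psi & forall u, B u -> pi (psi u) = phi u].
Proof.
move=> [e0 c0 [B0 [B00 phiC phiB bij]]].
have phi0 : phi 0 = X by have : [set X] (phi 0) by rewrite -[[set X]]c0.
have [psi [B [B1 BB psiC psiE]]] := pi_section HM B00 phiC phiB.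
have psiM u : B u -> total M (psi u) by case/psiE.
have [oB Bz] := B1; exists psi, B; split=> //.
- exact: psiM.
- by rewrite -phi0; case: (psiE 0 Bz).
- split; [exact: psiM|by []|]; exists B; split=> // u Bu.
  apply/(bij_transfer B1 psiC psiM Bu).
  have -> : pi (psi u) = phi u by case: (psiE u Bu).
  (* Bijectivity is required at every u near 0, so the differentials are compared at each such u,
     where the two maps have the same germ. *)
  have dE : 'd (pi \o psi) u = 'd phi u :> ('rV[R]_d -> 'M[R]_p).
    have dphi : differentiable phi u by have [/(_ u (BB _ Bu))] := phiC 1.
    have [|_ //] := @near_eq_diff _ _ _ phi (pi \o psi) u _ dphi.
    by near=> w; apply/esym; apply: (proj2 (psiE w _)); near: w; exact: open_nbhs_nbhs.
  have -> : chart_vec e (pi \o psi) u = chart_vec e phi u.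
    have eC : Cinf B (pi \o psi) by exact: (pi_smooth HM oB psiC).
    have eM w : B w -> total e ((pi \o psi) w) by move=> /psiM; exact: (pi_total HM).
    have HE := @Me_models R p r; apply/funext => a.
    rewrite (chart_vecE HE B1 eC eM a Bu) (chart_vecE HE B00 phiC phiB a (BB _ Bu)).
    exact: (congr1 (@^~ a) dE).
  exact: bij (BB _ Bu).
by move=> u /psiE[].
Unshelve. all: by end_near. Qed.

Variable f : 'M[R]_p -> R.
Variable P : forall d, 'M[R]_d -> Prop.

(** [f \o pi] read in [psi] and [f] read in [pi \o psi] are the same function, so stationarity and
    the flat Hessian carry over unchanged for every property [P]. *)
Lemma critical_push y : total M y ->
  critical_with M (f \o pi) (cls M y) P -> critical_with e f (cls e (pi y)) P.
Proof.
move=> My [_ [d [psi [par s0 PH]]]]; split.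
  by exists (pi y) => //; exact: (pi_total HM).
by exists d, (pi \o psi); split=> //; exact: local_param_push.
Qed.

Lemma critical_lift X : critical_with e f (cls e X) P ->
  exists c, unique (class_over M pi X) c /\ critical_with M (f \o pi) c P.
Proof.
move=> [_ [d [phi [/local_param_lift[psi [B [B0 My piy par psiE]]] s0 PH]]]].
have fE u : B u -> (f \o phi) u = (f \o pi \o psi) u by move=> /psiE /= ->.
exists (cls M (psi 0)); split.
  split; first by exists (psi 0).
  by move=> c' [z Mz [-> pz]]; apply/(pi_cls HM) => //; rewrite piy pz.
split; first by exists (psi 0).
exists d, psi; split; [exact: par|exact: (stationary_germ B0 fE s0)|].
have FE := flat_hess_germ B0 fE; rewrite -FE; exact: PH.
Qed.

End Transfer.

Section Correspondence.
Context {R : realType} (p r : nat) {E : normedModType R}.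
Variables (M : geometry E) (pi : E -> 'M[R]_p) (dpi : E -> E -> 'M[R]_p)
  (hl : E -> E -> E).
Hypothesis HM : models r M pi dpi hl.
Variable f : 'M[R]_p -> R.
Hypothesis f_C2 : Ck 2 [set: 'M[R]_p] f.
Let e : geometry 'M[R]_p := Me p r.
Let HE := @Me_models R p r.

Lemma correspondence_push y : total M y ->
  [/\ FOSP M (f \o pi) (cls M y) -> FOSP e f (cls e (pi y)),
      SOSP M (f \o pi) (cls M y) -> SOSP e f (cls e (pi y)) &
      strict_saddle M (f \o pi) (cls M y) -> strict_saddle e f (cls e (pi y))].
Proof.
move=> My; split=> h.
- by apply/(FOSP_critical HE f_C2)/(critical_push HM My)/(FOSP_critical HM f_C2).
- by apply/(SOSP_critical HE f_C2)/(critical_push HM My)/(SOSP_critical HM f_C2).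
- by apply/(strict_saddle_critical HE f_C2)/(critical_push HM My)/(strict_saddle_critical HM f_C2).
Qed.

Lemma correspondence_lift X :
  [/\ FOSP e f (cls e X) ->
        exists c, unique (class_over M pi X) c /\ FOSP M (f \o pi) c,
      SOSP e f (cls e X) ->
        exists c, unique (class_over M pi X) c /\ SOSP M (f \o pi) c &
      strict_saddle e f (cls e X) ->
        exists c, unique (class_over M pi X) c /\ strict_saddle M (f \o pi) c].
Proof.
split=> h.
- have [c [uc cc]] := critical_lift HM ((FOSP_critical HE f_C2 _).1 h).
  by exists c; split=> //; apply/(FOSP_critical HM f_C2).
- have [c [uc cc]] := critical_lift HM ((SOSP_critical HE f_C2 _).1 h).
  by exists c; split=> //; apply/(SOSP_critical HM f_C2).
- have [c [uc cc]] := critical_lift HM ((strict_saddle_critical HE f_C2 _).1 h).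
  by exists c; split=> //; apply/(strict_saddle_critical HM f_C2).
Qed.

End Correspondence.

(** * The factor model *)

Section MatrixCalculus.
Context {R : realType} {V : normedModType R}.

Lemma diff_mulmx m n q (F : V -> 'M[R]_(m, n)) (G : V -> 'M[R]_(n, q)) u :
  differentiable F u -> differentiable G u ->
  differentiable (fun w => F w *m G w) u /\
  forall a, 'd (fun w => F w *m G w) u a = F u *m 'd G u a + 'd F u a *m G u.
Proof.
move=> dF dG; pose f : {bilinear _ -> _ -> _} := @mulmx R m n q.
have cf : continuous (fun p : 'M[R]_(m, n) * 'M[R]_(n, q) => f p.1 p.2).
  move=> p; apply: (@cvg_mulmx R _ (nbhs p) _ m n q fst snd p.1 p.2).
    exact: cvg_fst.
  exact: cvg_snd.
have dp := differentiable_pair dF dG.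
have df := differentiable_bilin (F u, G u) cf.
split=> [|a]; first exact: (differentiable_comp dp df).
apply: etrans (congr1 (@^~ a) (diff_comp dp df)) _ => /=.
apply: etrans (congr1 (@^~ _) (diff_bilin (F u, G u) cf)) _ => /=.
by have /(congr1 (@^~ a)) /= -> := diff_pair dF dG.
Qed.

Lemma diff_trmx m n (F : V -> 'M[R]_(m, n)) u : differentiable F u ->
  differentiable (fun w => (F w)^T) u /\ forall a, 'd (fun w => (F w)^T) u a = ('d F u a)^T.
Proof.
have lt : linear (fun M : 'M[R]_(m, n) => M^T) by move=> k x y; rewrite linearP.
exact: (diff_linear lt (continuous_linear_mx lt)).
Qed.

Lemma open_neq0 (B : set V) (phi : V -> R) : open B ->
  (forall u, B u -> {for u, continuous phi}) -> open [set u | B u /\ phi u != 0].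
Proof.
move=> oB cphi; rewrite openE => u [Bu p0]; rewrite /interior /=.
near=> w; split; near: w; first exact: open_nbhs_nbhs.
by apply: cvgr_neq0 p0; exact: cphi.
Unshelve. all: by end_near. Qed.

(** Near x the determinant stays nonzero, and an invertible semidefinite matrix is positive
    definite. *)
Lemma smooth_local_cholesky n (B : set V) (A : V -> 'M[R]_n) (x : V) :
  open_nbhs x B -> Cinf B A -> (forall u, B u -> possemidef (A u)) -> A x \in unitmx ->
  exists (L : V -> 'M[R]_n) (B' : set V),
    [/\ open_nbhs x B', B' `<=` B, Cinf B' L &
        forall u, B' u -> A u \in unitmx /\ (L u)^T *m A u *m L u = 1%:M].
Proof.
move=> [oB Bx] AC psdA uA; pose B' := [set u | B u /\ \det (A u) != 0].
have oB' : open B'.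
  apply: open_neq0 => // u Bu; apply: (@cvg_det _ _ (nbhs u)).
  exact: Ck_continuous (AC 0) Bu.
have AC' : Cinf B' A by move=> k; apply: Ck_sub (AC k) => u [].
have uA' u : B' u -> A u \in unitmx by move=> [_]; rewrite unitmxE unitfE.
have [u /[dup] [[Bu _]] B'u|L LC LE] := smooth_cholesky oB' AC'.
  by apply: psd_unit_posdef (psdA _ Bu) _; exact: uA'.
exists L, B'; split=> //; first by split=> //; split=> //; rewrite -unitfE -unitmxE.
- by move=> u [].
- by move=> u B'u; split; [exact: uA'|exact: LE].
Qed.

End MatrixCalculus.

(** Along [psi], [F] coincides near x with a smooth extension around [psi x]. *)
Lemma smooth_on_continuous (R : realType) (V W : normedModType R) (T : topologicalType)
    (A : set V) (F : V -> W) (psi : T -> V) x :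
  smooth_on A F -> (\near x, A (psi x)) -> {for x, continuous psi} ->
  {for x, continuous (F \o psi)}.
Proof.
move=> sF nA cpsi; have [B [G [[oB Bx] GC FG]]] := sF _ (nbhs_singleton nA).
have cG : {for x, continuous (G \o psi)}.
  by apply: continuous_comp => //; exact: Ck_continuous (GC 0) Bx.
apply: near_eq_continuous cG; near=> y; apply/esym/FG; near: y => //.
exact: cpsi (open_nbhs_nbhs (conj oB Bx)).
Unshelve. all: by end_near. Qed.

(** * The Sylvester-type equation M Om W + W Om M = K *)

Section Sylvester.
Context {R : realType} {n : nat}.
Implicit Types M W K Om : 'M[R]_n.

Lemma trace_congr_gt0 m (W : 'M[R]_n) (v : 'M[R]_(m, n)) : posdef W -> v != 0 ->
  0 < \tr (W *m v^T *m v).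
Proof.
move=> pW v0; have [N uN ->] := psd_sqrt pW.
have -> : \tr (N *m N^T *m v^T *m v) = \tr ((v *m N)^T *m (v *m N)).
  by rewrite trmx_mul -!mulmxA mxtrace_mulC -!mulmxA.
apply: mxtrace_tr_mul_gt0; apply: contra_neq v0 => vN.
by rewrite -[v](mulmxK uN) vN mul0mx.
Qed.

(** Pairing with Om in the trace inner product gives two terms of the form tr (Om^T A Om B) with A
    and B positive definite, each positive unless Om = 0. *)
Lemma sylvester_inj M W Om : posdef M -> posdef W ->
  M *m Om *m W + W *m Om *m M = 0 -> Om = 0.
Proof.
move=> pM pW E; apply/eqP/negPn/negP => Om0.
have pos A B : posdef A -> posdef B -> 0 < \tr (Om^T *m (A *m Om *m B)).
  move=> pA pB; have [N uN AE] := psd_sqrt pA.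
  have NO : N^T *m Om != 0.
    apply: contra_neq Om0 => NO; have uNT : N^T \in unitmx by rewrite unitmx_tr.
    by rewrite -[Om](mulKmx uNT) NO mulmx0.
  suff -> : \tr (Om^T *m (A *m Om *m B)) = \tr (B *m (N^T *m Om)^T *m (N^T *m Om)).
    exact: trace_congr_gt0.
  by rewrite AE mulmxA mxtrace_mulC trmx_mul trmxK !mulmxA.
have := addr_gt0 (pos _ _ pM pW) (pos _ _ pW pM).
by rewrite -linearD -mulmxDr E mulmx0 linear0 ltxx.
Qed.

(** The operator Om |-> M Om W + W Om M acting on vectorised matrices. Solving through [invmx] makes
    the solution continuous in M, W and K. *)
Definition sylvester_mx M W : 'M[R]_(n * n) :=
  lin_mulmx M *m lin_mulmxr W + lin_mulmx W *m lin_mulmxr M.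

Definition sylvester M W K : 'M[R]_n := vec_mx (mxvec K *m invmx (sylvester_mx M W)).

Lemma mul_sylvester_mx M W Om :
  mxvec Om *m sylvester_mx M W = mxvec (M *m Om *m W + W *m Om *m M).
Proof. by rewrite mulmxDr !mulmxA !mul_vec_lin /= !linearD. Qed.

Lemma sylvester_unit M W : posdef M -> posdef W -> sylvester_mx M W \in unitmx.
Proof.
move=> pM pW; rewrite -row_free_unit -kermx_eq0; apply/eqP/row_matrixP => i.
rewrite row0; set v := row _ _; have vE : v *m sylvester_mx M W = 0.
  by rewrite -row_mul mulmx_ker row0.
rewrite -[v]vec_mxK mul_sylvester_mx in vE.
have : M *m vec_mx v *m W + W *m vec_mx v *m M = 0.
  by apply: (can_inj mxvecK); rewrite vE linear0.
by move=> /(sylvester_inj pM pW) v0; rewrite -[v]vec_mxK v0 linear0.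
Qed.

Lemma sylvesterE M W K : posdef M -> posdef W ->
  M *m sylvester M W K *m W + W *m sylvester M W K *m M = K.
Proof.
move=> pM pW; apply: (can_inj mxvecK).
by rewrite -mul_sylvester_mx vec_mxK mulmxKV //; exact: sylvester_unit.
Qed.

(** By transposition Om + Om^T solves the homogeneous equation, so it vanishes. *)
Lemma sylvester_skew M W K : posdef M -> posdef W -> K^T = - K ->
  (sylvester M W K)^T = - sylvester M W K.
Proof.
move=> pM pW sK; apply/eqP; rewrite -addr_eq0; apply/eqP.
apply: (sylvester_inj pM pW).
have E := sylvesterE K pM pW; have /(congr1 trmx) := E.
rewrite linearD /= !trmx_mul (proj1 pM) (proj1 pW) sK !mulmxA => ET.
rewrite !mulmxDr !mulmxDl addrACA E addrC -[X in _ + X = _]addrC ET.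
by rewrite subrr.
Qed.

Lemma sylvester_linear M W : linear (sylvester M W).
Proof. by move=> k x y; rewrite /sylvester !linearP /= mulmxDl -scalemxAl linearP. Qed.

Lemma cvg_sylvester (T : Type) (F : set_system T) {FF : Filter F}
    (f g h : T -> 'M[R]_n) M W K : posdef M -> posdef W ->
  f @ F --> M -> g @ F --> W -> h @ F --> K ->
  sylvester (f x) (g x) (h x) @[x --> F] --> sylvester M W K.
Proof.
move=> pM pW fM gW hK.
have cl m1 n1 m2 n2 (l : 'M[R]_(m1, n1) -> 'M[R]_(m2, n2)) (k : T -> 'M[R]_(m1, n1)) (a : 'M[R]_(m1, n1)) :
    linear l -> k @ F --> a -> l (k x) @[x --> F] --> l a.
  by move=> ll ka; apply: cvg_comp ka _; exact: (continuous_linear_mx ll).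
apply: (@cl _ _ _ _ vec_mx); first by move=> k x y; rewrite linearP.
apply: cvg_mulmx; first by apply: (@cl _ _ _ _ mxvec) => // k x y; rewrite linearP.
apply: cvg_invmx; first exact: sylvester_unit.
have cL (k : T -> 'M[R]_n) (a : 'M[R]_n) : k @ F --> a -> lin_mulmx (k x) @[x --> F] --> (lin_mulmx a : 'M[R]_(n * n)).
  by move=> ka; apply: (@cl _ _ _ _ lin_mulmx) ka => c x y; rewrite linearP.
have cR (k : T -> 'M[R]_n) (a : 'M[R]_n) : k @ F --> a -> lin_mulmxr (k x) @[x --> F] --> (lin_mulmxr a : 'M[R]_(n * n)).
  by move=> ka; apply: (@cl _ _ _ _ lin_mulmxr) ka => c x y; rewrite linearP.
by apply: cvgD; apply: cvg_mulmx; [exact: cL|exact: cR|exact: cL|exact: cR].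
Qed.

End Sylvester.

Section Orthogonal.
Context {R : realType}.

Lemma orthogonalP r (Q : 'M[R]_r) : orthogonal_mx Q -> Q *m Q^T = 1%:M.
Proof. by rewrite /orthogonal_mx /= => /mulmx1C. Qed.

Lemma orthogonal_tr r (Q : 'M[R]_r) : orthogonal_mx Q -> orthogonal_mx Q^T.
Proof. by rewrite /orthogonal_mx /= trmxK => /mulmx1C. Qed.

Lemma orthogonal_mul r (Q Q' : 'M[R]_r) :
  orthogonal_mx Q -> orthogonal_mx Q' -> orthogonal_mx (Q *m Q').
Proof.
rewrite /orthogonal_mx /= => oQ oQ'.
by rewrite trmx_mul mulmxA -[_ *m Q]mulmxA oQ mulmx1.
Qed.

Lemma orthogonal1 r : orthogonal_mx (1%:M : 'M[R]_r).
Proof. by rewrite /orthogonal_mx /= trmx1 mulmx1. Qed.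

Lemma gram_orbit p r (Y Z : 'M[R]_(p, r)) : full_col_rank Y -> Y *m Y^T = Z *m Z^T ->
  exists2 Q, orthogonal_mx Q & Z = Y *m Q.
Proof.
move=> fY YZ; have YK := pinv_colK fY; exists (pinv_col Y *m Z).
  rewrite -[pinv_col Y *m Z]trmxK; apply: orthogonal_tr.
  rewrite /orthogonal_mx /= trmxK trmx_mul mulmxA -[_ *m Z *m _]mulmxA -YZ.
  by rewrite mulmxA YK mul1mx -trmx_mul YK trmx1.
(* Z - Y pinv_col(Y) Z vanishes: the projector complementary to Y kills Y Y^T = Z Z^T, so the rows
   of this difference have zero norm. *)
apply/eqP; rewrite -subr_eq0 mulmxA -{1}[Z]mul1mx -mulmxBl; apply/eqP/trmx_inj.
rewrite trmx0; apply: mulTmx_eq0; rewrite trmxK trmx_mul mulmxA -[_ *m Z *m _]mulmxA -YZ.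
rewrite [_ *m (Y *m _)]mulmxA mulmxBl mul1mx -[Y *m _ *m Y]mulmxA YK mulmx1 subrr.
by rewrite !mul0mx.
Qed.

(** The difference N of the two sides is an orthogonal projector of trace p - r - (p - r) = 0, so
    its squared norm tr (N^T N) is zero. The bound r <= p matters because p - r is truncated
    subtraction. *)
Lemma orth_compl_sum p r (U : 'M[R]_(p, r)) (Uc : 'M[R]_(p, p - r)) :
  (r <= p)%N -> stiefel U -> orth_compl U Uc -> U *m U^T + Uc *m Uc^T = 1%:M.
Proof.
rewrite /stiefel /= => rp sU [sUc UUc]; rewrite /stiefel /= in sUc.
have UcU : Uc^T *m U = 0 by rewrite -[_ *m _]trmxK trmx_mul trmxK UUc trmx0.
pose N := 1%:M - (U *m U^T + Uc *m Uc^T).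
have NT : N^T = N by rewrite /N linearB /= [(_ + _)^T]linearD /= trmx1 !trmx_mul !trmxK.
have NU : N *m U = 0.
  by rewrite /N mulmxBl mul1mx mulmxDl -!mulmxA sU UcU mulmx1 mulmx0 addr0 subrr.
have NUc : N *m Uc = 0.
  by rewrite /N mulmxBl mul1mx mulmxDl -!mulmxA sUc UUc mulmx1 mulmx0 add0r subrr.
have NN : N^T *m N = N.
  rewrite NT {2}/N mulmxBr mulmx1 mulmxDr [N *m (U *m _)]mulmxA [N *m (Uc *m _)]mulmxA.
  by rewrite NU NUc !mul0mx addr0 subr0.
have : N = 0.
  apply: mxtrace_tr_mul_eq0; rewrite NN /N linearB linearD /= mxtrace1.
  rewrite mxtrace_mulC sU mxtrace1 mxtrace_mulC sUc mxtrace1 -natrD subnKC //.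
  by rewrite subrr.
by move/eqP; rewrite subr_eq0 => /eqP <-.
Qed.

End Orthogonal.

Section FactorModel.
Context {R : realType} (p r : nat).
Hypothesis r_le_p : (r <= p)%N.
Variable W : 'M[R]_(p, r) -> 'M[R]_r.
Hypothesis W_pos : forall Y, full_col_rank Y -> posdef (W Y).
Hypothesis W_smooth : smooth_on (@full_col_rank R p r) W.
Let q1 := Mq1 W.

(** Removes the auxiliary frame: with Y = U P, the matrix Y^T eta W_Y is the congruence by P of the
    matrix S P^-T W_Y P^-1 whose symmetry defines horizontality. *)
Lemma q1_horizontalP Y eta : full_col_rank Y ->
  horizontal q1 Y eta <-> sym_mx (Y^T *m eta *m W Y).
Proof.
move=> fY; split.
  move=> [U [Uc [S [D [sU UY [sUc UUc] sS ->]]]]].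
  rewrite /stiefel /= in sU; set P := U^T *m Y in sS *.
  have YE : Y = U *m P.
    have /andP[_ /submxP[C YC]] := UY.
    have {}YC : Y = U *m C^T by rewrite -[Y]trmxK YC trmx_mul trmxK.
    by rewrite /P YC [U^T *m _]mulmxA sU mul1mx.
  have uP : P \in unitmx.
    apply: unitmx_ker => x Px; apply: (proj1 (full_col_rankP Y) fY).
    by rewrite YE -mulmxA Px mulmx0.
  have -> : Y^T *m ((U *m S + Uc *m D) *m (invmx P)^T) *m W Y
      = P^T *m (S *m (invmx P)^T *m W Y *m invmx P) *m P.
    have -> : Y^T = P^T *m U^T by rewrite -trmx_mul -YE.
    have UE : U^T *m (U *m S + Uc *m D) = S.
      by rewrite mulmxDr mulmxA sU mul1mx mulmxA UUc mul0mx addr0.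
    by rewrite -!mulmxA mulVmx // mulmx1 [U^T *m _]mulmxA UE.
  exact: sym_congr.
move=> sE; have [L uL sU] := orthonormalize fY.
have [Uc oUc] := orth_compl_ex sU; have sum1 := orth_compl_sum r_le_p sU oUc.
set U := Y *m L in sU oUc sum1.
have PE : U^T *m Y = invmx L.
  by rewrite -[Y](mulmxK uL) -/U mulmxA sU mul1mx.
have iP : invmx (U^T *m Y) = L by rewrite PE invmxK.
have PT : (U^T *m Y)^T *m L^T = 1%:M by rewrite PE -trmx_mul mulmxV // trmx1.
(* S and D are the components of eta P^T along U and its complement. *)
exists U, Uc, (U^T *m eta *m (U^T *m Y)^T), (Uc^T *m eta *m (U^T *m Y)^T).
split=> //.
- have UE : U^T = L^T *m Y^T by rewrite trmx_mul.
  have fL : row_full L^T by rewrite row_full_unit unitmx_tr.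
  by rewrite UE; apply/eqmxP; exact: eqmxMfull fL.
- rewrite iP -[_ *m _ *m L^T]mulmxA PT mulmx1.
  have -> : U^T *m eta *m W Y *m L = L^T *m (Y^T *m eta *m W Y) *m L.
    by rewrite /U trmx_mul !mulmxA.
  exact: sym_congr.
rewrite iP mulmxDl -[U *m _ *m _]mulmxA -[Uc *m _ *m _]mulmxA -![_ *m _ *m L^T]mulmxA PT !mulmx1.
by rewrite !mulmxA -mulmxDl sum1 mul1mx.
Qed.

(** The skew Om for which v - Y Om is horizontal: symmetry of Y^T (v - Y Om) W_Y is exactly this
    equation with M = Y^T Y. *)
Definition q1_rot Y (v : 'M[R]_(p, r)) : 'M[R]_r :=
  sylvester (Y^T *m Y) (W Y) (Y^T *m v *m W Y - W Y *m v^T *m Y).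

Definition q1_hl Y (v : 'M[R]_(p, r)) : 'M[R]_(p, r) := v - Y *m q1_rot Y v.

Definition q1_dpi (Y v : 'M[R]_(p, r)) : 'M[R]_p := Y *m v^T + v *m Y^T.

Lemma q1_rot_skew Y v : full_col_rank Y -> (q1_rot Y v)^T = - q1_rot Y v.
Proof.
move=> fY; have pW := W_pos fY; apply: sylvester_skew => //; first exact: posdef_gram.
by rewrite linearB /= !trmx_mul !trmxK (proj1 pW) opprB !mulmxA.
Qed.

Lemma q1_hl_horizontal Y v : full_col_rank Y -> horizontal q1 Y (q1_hl Y v).
Proof.
move=> fY; apply/q1_horizontalP => //; rewrite /sym_mx /=.
have pW := W_pos fY; have pM := posdef_gram fY.
have := sylvesterE (Y^T *m v *m W Y - W Y *m v^T *m Y) pM pW; rewrite -/(q1_rot Y v).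
have sk := q1_rot_skew v fY; rewrite /q1_hl; set Om := q1_rot Y v in sk *.
move=> E; rewrite !trmx_mul linearB /= trmx_mul sk trmxK (proj1 pW).
rewrite mulNmx opprK mulmxBr !mulmxDl mulmxDr mulNmx !mulmxA.
apply/eqP; rewrite -subr_eq0 opprB addrA addrAC; apply/eqP.
move/eqP: E; rewrite -subr_eq0 => /eqP E; rewrite -[RHS]E !mulmxA opprB.
by rewrite addrC -!addrA; congr (_ + _); rewrite addrCA.
Qed.

Lemma q1_dpi_orbit Y Om : Om^T = - Om -> q1_dpi Y (Y *m Om) = 0.
Proof. by move=> sk; rewrite /q1_dpi trmx_mul sk mulNmx mulmxN mulmxA addNr. Qed.

(** Horizontal and vertical spaces meet only in zero: for skew Om the symmetry condition becomes the
    homogeneous Sylvester-type equation. *)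
Lemma q1_horizontal_orbit Y Om : full_col_rank Y -> Om^T = - Om ->
  sym_mx (Y^T *m (Y *m Om) *m W Y) -> Om = 0.
Proof.
move=> fY sk; have pW := W_pos fY; rewrite /sym_mx /= => h.
apply: (sylvester_inj (posdef_gram fY) pW).
move: h; rewrite !trmx_mul trmxK (proj1 pW) sk !mulNmx mulmxN !mulmxA => <-.
by rewrite addNr.
Qed.

Lemma sym_mxB n (A B : 'M[R]_n) : sym_mx A -> sym_mx B -> sym_mx (A - B).
Proof. by rewrite /sym_mx /= linearB /= => -> ->. Qed.

Lemma q1_lift Y v : full_col_rank Y -> hlift q1 Y v = q1_hl Y v.
Proof.
move=> fY; have pW := W_pos fY; have hh := q1_hl_horizontal v fY.
have vv : vertical q1 Y (v - q1_hl Y v).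
  apply/tangent_orbitP => //; exists (q1_rot Y v); first exact: q1_rot_skew.
  by rewrite /q1_hl opprB addrC subrK.
rewrite /hlift; case: xgetP => [eta _ [he ve]|/(_ (q1_hl Y v)) []//].
have [Om1 s1 E1] := (tangent_orbitP _ fY).1 ve.
have [Om2 s2 E2] := (tangent_orbitP _ fY).1 vv.
have E : eta - q1_hl Y v = Y *m (Om2 - Om1).
  rewrite mulmxBr -E1 -E2; move: (q1_hl Y v) => w.
  by rewrite opprB [RHS]addrC addrA subrK.
have O0 : Om2 - Om1 = 0.
  apply: (q1_horizontal_orbit fY); first by rewrite linearB /= s1 s2 opprB opprK addrC.
  rewrite -E mulmxBr mulmxBl; apply: sym_mxB; exact/q1_horizontalP.
by apply/eqP; rewrite -subr_eq0 E O0 mulmx0.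
Qed.

Lemma q1_section d (phi : 'rV[R]_d -> 'M[R]_p) (B : set 'rV[R]_d) :
  open_nbhs (0 : 'rV[R]_d) B -> Cinf B phi -> (forall u, B u -> psd_rank r (phi u)) ->
  exists (psi : 'rV[R]_d -> 'M[R]_(p, r)) (B' : set 'rV[R]_d),
    [/\ open_nbhs (0 : 'rV[R]_d) B', B' `<=` B, Cinf B' psi &
        forall u, B' u -> full_col_rank (psi u) /\ gram_map (psi u) = phi u].
Proof.
move=> B0 phiC phiB; have [Y0 fY0 X0] := psd_rank_factor (phiB _ (proj2 B0)).
have uG0 := posdef_unit (posdef_gram fY0).
pose A u := Y0^T *m phi u *m Y0.
have AC : Cinf B A.
  move=> k; apply: Ck_mulmx; [exact: (proj1 B0)| |exact: Ck_cst].
  by apply: Ck_mulmx; [exact: (proj1 B0)|exact: Ck_cst|exact: phiC].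
have pA u : B u -> possemidef (A u) by move=> /phiB[_ _]; exact: psd_congr.
(* Since phi 0 = Y0 Y0^T, the matrix A 0 is the square of Y0^T Y0. *)
have uA : A 0 \in unitmx by rewrite /A X0 mulmxA -mulmxA unitmx_mul uG0.
have [L [B' [B0' BB LC LE]]] := smooth_local_cholesky B0 AC pA uA.
exists (fun u => phi u *m Y0 *m L u), B'; split=> //.
  move=> k; apply: Ck_mulmx; [exact: (proj1 B0')| |exact: LC].
  apply: Ck_mulmx; [exact: (proj1 B0')| |exact: Ck_cst].
  exact: Ck_sub (phiC k).
move=> u B'u; have [uAu LAL] := LE _ B'u; have [sX rX _] := phiB _ (BB _ B'u).
have [Z fZ XZ] := psd_rank_factor (phiB _ (BB _ B'u)).
have [uL _ LL] := cholesky_unit LAL.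
have AE : A u = (Y0^T *m Z) *m (Y0^T *m Z)^T.
  by rewrite /A XZ trmx_mul trmxK !mulmxA.
have uH : Y0^T *m Z \in unitmx.
  by move: uAu; rewrite AE unitmx_mul => /andP[].
have E : gram_map (phi u *m Y0 *m L u) = phi u.
  rewrite /gram_map !trmx_mul !mulmxA -[_ *m L u *m _]mulmxA LL.
  (* Writing phi = Z Z^T and K = Y0^T Z gives A = K K^T with K invertible, so K^T A^-1 K = 1 and phi
     Y0 A^-1 Y0^T phi = Z Z^T. *)
  have -> : (phi u)^T = phi u by exact: sX.
  have -> : phi u *m Y0 *m invmx (A u) *m Y0^T *m phi u
      = Z *m ((Y0^T *m Z)^T *m invmx (A u) *m (Y0^T *m Z)) *m Z^T.
    by rewrite XZ trmx_mul trmxK !mulmxA.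
  suff -> : (Y0^T *m Z)^T *m invmx (A u) *m (Y0^T *m Z) = 1%:M by rewrite mulmx1 -XZ.
  apply: mulmx1C; rewrite mulmxA.
  by rewrite -AE mulmxV.
split=> //; rewrite /full_col_rank /=; apply/eqP; rewrite eqn_leq rank_leq_col /=.
rewrite -[X in (X <= _)%N]rX -{1}E; exact: mxrankM_maxl.
Qed.

Lemma Mq1_models : models r q1 (@gram_map R p r) q1_dpi q1_hl.
Proof.
apply: Models.
- by move=> Y fY; exact: psd_rank_gram.
- move=> Y Z fY fZ; split=> [e|].
    have [Q oQ <-] : [set Z *m Q | Q in @orthogonal_mx R r] Y.
      have : cls q1 Y Y by exists 1%:M; [exact: orthogonal1|rewrite mulmx1].
      by rewrite e.
    by rewrite /gram_map trmx_mul mulmxA -[_ *m Q *m _]mulmxA (orthogonalP oQ) mulmx1.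
  move=> /(gram_orbit fY)[Q oQ ->]; apply/seteqP; split=> _ [T oT <-].
    exists (Q^T *m T); first by apply: orthogonal_mul => //; exact: orthogonal_tr.
    by rewrite mulmxA -[_ *m Q *m _]mulmxA (orthogonalP oQ) mulmx1.
  by exists (Q *m T); [exact: orthogonal_mul|rewrite mulmxA].
- exact: q1_section.
- by move=> d psi B oB psiC k; apply: Ck_mulmx => //; exact: Ck_trmx.
- move=> d psi u a dpsi; have [dT dTE] := diff_trmx dpsi.
  have [_ dE] := diff_mulmx dpsi dT.
  by rewrite -[LHS]/('d (fun w => psi w *m (psi w)^T) u a) dE dTE.
- move=> Y fY; split.
  + move=> eta _; apply/tangent_psdP; first exact: psd_rank_gram.
    split; first by rewrite linearD /= !trmx_mul !trmxK addrC.
    move=> x Xx; have Yx : Y^T *m x = 0.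
      apply: mulTmx_eq0; by rewrite trmx_mul trmxK mulmxA -[x^T *m _ *m _]mulmxA -[_ *m x]mulmxA Xx mulmx0.
    rewrite mulmxDr mulmxDl !mulmxA -[_ *m Y^T *m x]mulmxA Yx mulmx0 addr0.
    by rewrite -[x^T *m Y]trmxK trmx_mul trmxK Yx trmx0 !mul0mx mxE.
  + move=> e1 e2; rewrite !inE => h1 h2 e12.
    have k0 : q1_dpi Y (e1 - e2) = 0.
      rewrite /q1_dpi linearB /= mulmxBr mulmxBl addrACA -opprD.
      by rewrite -[X in X - _]/(q1_dpi Y e1) e12 subrr.
    have YP : Y^T *m (pinv_col Y)^T = 1%:M by rewrite -trmx_mul pinv_colK // trmx1.
    (* For e = e1 - e2, multiplying Y e^T + e Y^T = 0 on the right by the transposed left inverse of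
       Y solves for e as Y Om. Cancelling Y on both sides then shows that Om is skew, so e is both
       vertical and horizontal. *)
    pose Om := - ((e1 - e2)^T *m (pinv_col Y)^T).
    have eE : e1 - e2 = Y *m Om.
      have := congr1 (mulmx ^~ (pinv_col Y)^T) k0.
      rewrite /q1_dpi mulmxDl mul0mx -!mulmxA YP mulmx1 => /eqP.
      by rewrite addrC addr_eq0 => /eqP ->; rewrite /Om mulmxN.
    have sk : Om^T = - Om.
      have := k0; rewrite eE /q1_dpi trmx_mul => h.
      have : pinv_col Y *m (Y *m (Om^T *m Y^T) + Y *m Om *m Y^T) *m (pinv_col Y)^T = 0.
        by rewrite h mulmx0 mul0mx.
      rewrite mulmxDr mulmxDl !mulmxA pinv_colK // !mul1mx -!mulmxA YP !mulmx1.
      by move/eqP; rewrite addr_eq0 => /eqP.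
    have O0 : Om = 0.
      apply: (q1_horizontal_orbit fY sk); rewrite -eE mulmxBr mulmxBl.
      by apply: sym_mxB; exact/q1_horizontalP.
    by apply/eqP; rewrite -subr_eq0 eE O0 mulmx0.
  + move=> v /(tangent_psdP _ (psd_rank_gram fY))[sv vx].
    have [Z ->] := tangent_psd_gram_ex fY sv vx.
    (* The target is [q1_dpi Y Z], and removing the vertical part of Z does not change it. *)
    exists (q1_hl Y Z); first exact: q1_hl_horizontal.
    rewrite /q1_hl /q1_dpi linearB /= mulmxBr mulmxBl addrACA -opprD.
    by rewrite -[X in _ - X]/(q1_dpi Y _) q1_dpi_orbit ?subr0 //; exact: q1_rot_skew.
- move=> Y fY k u v; rewrite /q1_hl.
  have -> : q1_rot Y (k *: u + v) = k *: q1_rot Y u + q1_rot Y v.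
    rewrite /q1_rot -(sylvester_linear (Y^T *m Y) (W Y)); congr sylvester.
    by rewrite [(_ + _)^T]linearP /= !mulmxDr !mulmxDl -!scalemxAr -!scalemxAl scalerBr opprD addrACA.
  by rewrite mulmxDr -scalemxAr scalerBr opprD addrACA.
- move=> Y v fY _; split; [exact: q1_lift|exact: q1_hl_horizontal|].
  rewrite /q1_hl /q1_dpi linearB /= mulmxBr mulmxBl addrACA -opprD.
  by rewrite -[X in _ - X]/(q1_dpi Y _) q1_dpi_orbit ?subr0 //; exact: q1_rot_skew.
- move=> Y u v fY; rewrite /= -mxtrace_tr !trmx_mul trmxK (proj1 (W_pos fY)).
  by rewrite mxtrace_mulC mxtrace_mulC mulmxA mxtrace_mulC mulmxA.
- move=> Y v k u u' _; rewrite /= [(_ + _)^T]linearP /= mulmxDr mulmxDl -scalemxAr -scalemxAl.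
  by rewrite linearD linearZ.
- by move=> Y v fY _ v0; apply: trace_congr_gt0 => //; exact: W_pos.
move=> d psi w1 w2 nM cpsi c1 c2.
have cW : {for (0 : 'rV[R]_d), continuous (W \o psi)} by exact: smooth_on_continuous W_smooth nM cpsi.
have fY := nbhs_singleton nM.
have chl w : {for (0 : 'rV[R]_d), continuous w} -> {for (0 : 'rV[R]_d), continuous (fun u => q1_hl (psi u) (w u))}.
  move=> cw; apply: (@cvgB _ _ _ (nbhs (0 : 'rV[R]_d))) => //.
  apply: (@cvg_mulmx _ _ (nbhs (0 : 'rV[R]_d))) => //.
  have cpT : (psi u)^T @[u --> (0 : 'rV[R]_d)] --> (psi 0)^T by exact: (@cvg_trmx _ _ (nbhs (0 : 'rV[R]_d))).
  apply: (@cvg_sylvester _ _ _ (nbhs (0 : 'rV[R]_d))) => //.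
  + exact: posdef_gram.
  + exact: W_pos.
  + exact: (@cvg_mulmx _ _ (nbhs (0 : 'rV[R]_d))).
  apply: (@cvgB _ _ _ (nbhs (0 : 'rV[R]_d))).
    do 2![apply: (@cvg_mulmx _ _ (nbhs (0 : 'rV[R]_d))) => //].
  do 2![apply: (@cvg_mulmx _ _ (nbhs (0 : 'rV[R]_d))) => //].
  exact: (@cvg_trmx _ _ (nbhs (0 : 'rV[R]_d))).
apply: (@cvg_mxtrace _ _ (nbhs (0 : 'rV[R]_d))).
apply: (@cvg_mulmx _ _ (nbhs (0 : 'rV[R]_d))); last exact: chl.
apply: (@cvg_mulmx _ _ (nbhs (0 : 'rV[R]_d))) => //.
by apply: (@cvg_trmx _ _ (nbhs (0 : 'rV[R]_d))); exact: chl.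
Qed.

End FactorModel.

(** * The polar model *)

Section Pairs.
Context {R : realType} {V W1 W2 : normedModType R}.

Lemma linear_fst : linear (fun z : W1 * W2 => z.1).
Proof. by []. Qed.

Lemma linear_snd : linear (fun z : W1 * W2 => z.2).
Proof. by []. Qed.

Lemma fstB (a b : W1 * W2) : (a - b).1 = a.1 - b.1.
Proof. by []. Qed.

Lemma sndB (a b : W1 * W2) : (a - b).2 = a.2 - b.2.
Proof. by []. Qed.

Lemma continuous_fst : continuous (fun z : W1 * W2 => z.1).
Proof. by move=> z; exact: cvg_fst. Qed.

Lemma continuous_snd : continuous (fun z : W1 * W2 => z.2).
Proof. by move=> z; exact: cvg_snd. Qed.

Lemma Ck_pair k (A : set V) (F : V -> W1) (G : V -> W2) :
  open A -> Ck k A F -> Ck k A G -> Ck k A (fun x => (F x, G x)).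
Proof.
move=> oA FC GC.
rewrite (_ : (fun x => _) = fun x => (F x, 0) + (0, G x)); last first.
  by apply/funext => x; rewrite -[RHS]/(F x + 0, 0 + G x) addr0 add0r.
apply: CkD => //.
- apply: (@Ck_linear _ _ _ _ _ _ _ (fun y => (y, 0))) FC oA.
    by move=> c x y; rewrite -[RHS]/(c *: x + y, c *: 0 + 0) scaler0 addr0.
  by move=> x; apply: cvg_pair; [exact: cvg_id|exact: cvg_cst].
- apply: (@Ck_linear _ _ _ _ _ _ _ (fun y => (0, y))) GC oA.
    by move=> c x y; rewrite -[RHS]/(c *: 0 + 0, c *: x + y) scaler0 addr0.
  by move=> x; apply: cvg_pair; [exact: cvg_cst|exact: cvg_id].
Qed.

Lemma caratheodory_pair (c : R -> W1 * W2) (v : W1 * W2) :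
  is_derive (0 : R) 1 c v ->
  exists (d1 : R -> W1) (d2 : R -> W2),
    [/\ forall t, (c t).1 = (c 0).1 + t *: d1 t, forall t, (c t).2 = (c 0).2 + t *: d2 t,
        d1 t @[t --> (0 : R)] --> v.1 & d2 t @[t --> (0 : R)] --> v.2].
Proof.
move=> /caratheodory[delta cE dv]; exists (fst \o delta), (snd \o delta); split.
- by move=> t; rewrite {1}cE.
- by move=> t; rewrite {1}cE.
- apply: (@cvg_comp _ _ _ delta fst _ (nbhs v)); [exact: dv|exact: continuous_fst].
- apply: (@cvg_comp _ _ _ delta snd _ (nbhs v)); [exact: dv|exact: continuous_snd].
Qed.

Lemma pair_caratheodory (c1 d1 : R -> W1) (c2 d2 : R -> W2) v1 v2 :
  (forall t, c1 t = c1 0 + t *: d1 t) -> (forall t, c2 t = c2 0 + t *: d2 t) ->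
  d1 t @[t --> (0 : R)] --> v1 -> d2 t @[t --> (0 : R)] --> v2 ->
  is_derive (0 : R) 1 (fun t => (c1 t, c2 t)) (v1, v2).
Proof.
move=> E1 E2 h1 h2; apply/caratheodory; exists (fun t => (d1 t, d2 t)).
  by move=> t; rewrite E1 E2.
exact: cvg_pair.
Qed.

End Pairs.

Section PolarModel.
Context {R : realType} (p r : nat).
Hypothesis r_le_p : (r <= p)%N.
Variables V W : 'M[R]_r -> 'M[R]_r.
Hypothesis V_pos : forall B, posdef B -> posdef (V B).
Hypothesis W_pos : forall B, posdef B -> posdef (W B).
Hypothesis V_smooth : smooth_on (@posdef R r) V.
Hypothesis W_smooth : smooth_on (@posdef R r) W.
Let E : normedModType R := ('M[R]_(p, r) * 'M[R]_r)%type.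
Let q2 : geometry E := Mq2 p V W.
Implicit Types z v w : E.

(** For a tangent v the matrix Om = U^T v_U is skew, and the vertical vector (U Om, B Om - Om B) is
    subtracted. *)
Definition q2_hl z v : E :=
  (v.1 - z.1 *m (z.1^T *m v.1),
   v.2 - z.2 *m (z.1^T *m v.1) + z.1^T *m v.1 *m z.2).

Definition q2_dpi z v : 'M[R]_p :=
  v.1 *m z.2 *m z.1^T + z.1 *m v.2 *m z.1^T + z.1 *m z.2 *m v.1^T.

Lemma q2_horizontalP z v : stiefel z.1 ->
  horizontal q2 z v <-> z.1^T *m v.1 = 0 /\ v.2^T = v.2.
Proof.
move=> sU; split.
  by move=> [Uc [D [[sUc UUc] -> sB]]]; rewrite mulmxA UUc mul0mx.
move=> [Uv sv]; have [Uc oUc] := orth_compl_ex sU.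
exists Uc, (Uc^T *m v.1); split=> //.
rewrite mulmxA -[LHS]mul1mx -(orth_compl_sum r_le_p sU oUc) mulmxDl.
by rewrite -mulmxA Uv mulmx0 add0r.
Qed.

(** The constraints U^T U = 1 and B^T = B are expanded along the curve, divided by t, and passed to
    the limit. *)
Lemma q2_tangent z v : tangent_space (total q2) z v ->
  (z.1^T *m v.1)^T = - (z.1^T *m v.1) /\ v.2^T = v.2.
Proof.
move=> [c [c0 cA /caratheodory_pair[d1 [d2 [E1 E2 h1 h2]]]]].
have h1T : (d1 t)^T @[t --> (0 : R)] --> v.1^T by exact: (@cvg_trmx _ _ (nbhs (0 : R))).
have [sU pB] : total q2 z by rewrite -c0; exact: nbhs_singleton cA.
split.
  apply/eqP; rewrite -addr_eq0; apply/eqP.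
  apply: (@mx_limit_eq0 _ _ _
    (fun t => (z.1^T *m d1 t)^T + z.1^T *m d1 t + t *: ((d1 t)^T *m d1 t))).
    have hU : z.1^T *m d1 t @[t --> (0 : R)] --> z.1^T *m v.1.
      by apply: (@cvg_mulmx _ _ (nbhs (0 : R))) => //; exact: cvg_cst.
    rewrite -[X in _ --> X]addr0; apply: (@cvgD _ _ _ (nbhs (0 : R))).
      by apply: (@cvgD _ _ _ (nbhs (0 : R))) => //; exact: (@cvg_trmx _ _ (nbhs (0 : R))).
    apply: (@cvg_scale0 _ _ _ (v.1^T *m v.1)).
    exact: (@cvg_mulmx _ _ (nbhs (0 : R))).
  near=> t; have [sc _] : total q2 (c t) by near: t.
  have cT : (z.1 + t *: d1 t)^T = z.1^T + t *: (d1 t)^T by rewrite linearD linearZ.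
  move: sc sU; rewrite /stiefel /= E1 c0 cT mulmxDl !mulmxDr => <-.
  rewrite -!scalemxAl -!scalemxAr -addrA => h.
  rewrite -[LHS]addr0 in h; move/addrI: h => h.
  by rewrite !scalerDr trmx_mul trmxK [RHS]h [X in X + _]addrC -!addrA.
apply/subr0_eq; apply: (@mx_limit_eq0 _ _ _ (fun t => (d2 t)^T - d2 t)).
  by apply: (@cvgB _ _ _ (nbhs (0 : R))) => //; exact: (@cvg_trmx _ _ (nbhs (0 : R))).
near=> t; have [_ [sc _]] : total q2 (c t) by near: t.
have cT : (z.2 + t *: d2 t)^T = z.2^T + t *: (d2 t)^T by rewrite linearD linearZ.
move: sc; rewrite /sym_mx /= E2 c0 cT (proj1 pB) => /addrI h.
by rewrite scalerBr h subrr.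
Unshelve. all: by end_near. Qed.

(** The first component is the orbit case for U, which has full column rank, and yields Om. The
    second is then forced, because the orthogonal factor Q is recovered from the first as U^T U
    Q. *)
Lemma q2_verticalP z w : stiefel z.1 ->
  vertical q2 z w <->
  exists2 Om : 'M[R]_r, Om^T = - Om & w = (z.1 *m Om, z.2 *m Om - Om *m z.2).
Proof.
move=> sU; split; last first.
  move=> [Om sk ->]; pose K t := invmx (1%:M + (- (t / 2)) *: Om) *m Om.
  have cK : K t @[t --> (0 : R)] --> Om by exact: cayley_cvg.
  have cKT : (K t)^T @[t --> (0 : R)] --> Om^T by exact: (@cvg_trmx _ _ (nbhs (0 : R))).
  have QE t : cayley Om t = 1%:M + t *: K t by exact: cayleyE.
  have Q0 : cayley Om 0 = 1%:M by rewrite QE scale0r addr0.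
  exists (fun t => (z.1 *m cayley Om t, (cayley Om t)^T *m z.2 *m cayley Om t)); split.
  - by rewrite Q0 trmx1 !mulmx1 mul1mx -surjective_pairing.
  - by near=> t; exists (cayley Om t) => //; exact: cayley_orthogonal.
  apply: (pair_caratheodory (d1 := fun t => z.1 *m K t)
    (d2 := fun t => (K t)^T *m z.2 + z.2 *m K t + t *: ((K t)^T *m z.2 *m K t))).
  - by move=> t; rewrite Q0 QE mulmxDr !mulmx1 -scalemxAr.
  - move=> t; rewrite Q0 QE trmx1 mul1mx mulmx1.
    have -> : (1%:M + t *: K t)^T = 1%:M + t *: (K t)^T by rewrite linearD linearZ /= trmx1.
    rewrite !mulmxDl mul1mx !mulmxDr !mulmx1 -!scalemxAl -!scalemxAr !scalerDr.
    by rewrite -!addrA; congr (_ + _); rewrite addrCA addrA.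
  - by apply: (@cvg_mulmx _ _ (nbhs (0 : R))) => //; exact: cvg_cst.
  have -> : z.2 *m Om - Om *m z.2 = Om^T *m z.2 + z.2 *m Om + 0.
    by rewrite sk mulNmx addr0 addrC.
  apply: (@cvgD _ _ _ (nbhs (0 : R))).
    apply: (@cvgD _ _ _ (nbhs (0 : R))); apply: (@cvg_mulmx _ _ (nbhs (0 : R))) => //;
      exact: cvg_cst.
  apply: (@cvg_scale0 _ _ _ (Om^T *m z.2 *m Om)).
  apply: (@cvg_mulmx _ _ (nbhs (0 : R))) => //.
  by apply: (@cvg_mulmx _ _ (nbhs (0 : R))) => //; exact: cvg_cst.
move=> [c [c0 cA dc]]; have [d1 [d2 [E1 E2 h1 h2]]] := caratheodory_pair dc.
have [Om sk w1] : exists2 Om : 'M[R]_r, Om^T = - Om & w.1 = z.1 *m Om.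
  apply/tangent_orbitP; first exact: stiefel_full_rank.
  exists (fun t => (c t).1); split; first by rewrite c0.
    by near=> t; have [Q oQ <-] : cls q2 z (c t); [near: t|exists Q].
  by apply/caratheodory; exists d1.
exists Om => //; rewrite [w]surjective_pairing w1; congr (_, _).
have OmE : Om = z.1^T *m w.1 by rewrite w1 mulmxA (sU : z.1^T *m z.1 = _) mul1mx.
pose K t := z.1^T *m d1 t.
have cK : K t @[t --> (0 : R)] --> Om.
  by rewrite OmE; apply: (@cvg_mulmx _ _ (nbhs (0 : R))) => //; exact: cvg_cst.
have cKT : (K t)^T @[t --> (0 : R)] --> Om^T by exact: (@cvg_trmx _ _ (nbhs (0 : R))).
apply/subr0_eq; rewrite (_ : _ - _ = w.2 - (Om^T *m z.2 + z.2 *m Om + 0)); last first.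
  by rewrite sk mulNmx addr0 [- _ + _]addrC.
apply: (@mx_limit_eq0 _ _ _
  (fun t => d2 t - ((K t)^T *m z.2 + z.2 *m K t + t *: ((K t)^T *m z.2 *m K t)))).
  apply: (@cvgB _ _ _ (nbhs (0 : R))) => //; apply: (@cvgD _ _ _ (nbhs (0 : R))).
    apply: (@cvgD _ _ _ (nbhs (0 : R))); apply: (@cvg_mulmx _ _ (nbhs (0 : R))) => //;
      exact: cvg_cst.
  apply: (@cvg_scale0 _ _ _ (Om^T *m z.2 *m Om)).
  apply: (@cvg_mulmx _ _ (nbhs (0 : R))) => //.
  by apply: (@cvg_mulmx _ _ (nbhs (0 : R))) => //; exact: cvg_cst.
near=> t; have [Q oQ QE] : cls q2 z (c t) by near: t.
have QK : Q = 1%:M + t *: K t.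
  rewrite -[LHS]mul1mx -(sU : z.1^T *m z.1 = _) -mulmxA.
  rewrite (congr1 fst QE : z.1 *m Q = (c t).1) E1 c0 mulmxDr -scalemxAr.
  by rewrite (sU : z.1^T *m z.1 = _).
have := congr1 snd QE; rewrite /= E2 c0 QK.
have -> : (1%:M + t *: K t)^T = 1%:M + t *: (K t)^T by rewrite linearD linearZ /= trmx1.
rewrite !mulmxDl mul1mx !mulmxDr !mulmx1 -!scalemxAl -!scalemxAr -!addrA => /addrI h.
by rewrite scalerBr -h !scalerDr addrCA addrA subrr.
Unshelve. all: by end_near. Qed.

Lemma q2_hl_horizontal z v : stiefel z.1 -> posdef z.2 ->
  (z.1^T *m v.1)^T = - (z.1^T *m v.1) -> v.2^T = v.2 -> horizontal q2 z (q2_hl z v).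
Proof.
move=> sU [sB _] sk sv; apply/q2_horizontalP => //=; split.
  by rewrite mulmxBr [z.1^T *m (z.1 *m _)]mulmxA (sU : z.1^T *m z.1 = _) mul1mx subrr.
move: sk; set Om := z.1^T *m v.1 => sk.
rewrite linearD linearB /= sv trmx_mul sk (sB : z.2^T = z.2) mulNmx opprK.
by rewrite trmx_mul sk (sB : z.2^T = z.2) mulmxN addrAC.
Qed.

(** A horizontal eta has U^T eta_U = 0, so applying U^T to v - eta = (U Om, ...) determines Om as
    U^T v_U. *)
Lemma q2_lift z v : total q2 z -> tangent_space (total q2) z v -> hlift q2 z v = q2_hl z v.
Proof.
move=> [sU pB] tv; have [sk sv] := q2_tangent tv.
have hh := q2_hl_horizontal sU pB sk sv.
have vv : vertical q2 z (v - q2_hl z v).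
  apply/q2_verticalP => //; exists (z.1^T *m v.1) => //.
  apply: injective_projections; rewrite ?fstB ?sndB /=.
    by rewrite opprB addrC subrK.
  by rewrite -addrA opprD addrA subrr add0r opprD opprK.
rewrite /hlift; case: xgetP => [eta _ [he ve]|/(_ (q2_hl z v)) []//].
have [Ue _] := (q2_horizontalP eta sU).1 he.
have [Om s1 E1] := (q2_verticalP (v - eta) sU).1 ve.
have OmE : z.1^T *m v.1 = Om.
  have := congr1 (fun w : E => z.1^T *m w.1) E1.
  by rewrite /= mulmxBr Ue subr0 mulmxA (sU : z.1^T *m z.1 = _) mul1mx.
rewrite /q2_hl OmE; have -> : eta = v - (v - eta) by rewrite opprB addrC subrK.
by rewrite E1; apply: injective_projections; rewrite ?fstB ?sndB //= opprB addrA addrAC.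
Qed.

Lemma q2_dpiB z u v : q2_dpi z (u - v) = q2_dpi z u - q2_dpi z v.
Proof.
rewrite /q2_dpi fstB sndB [(u.1 - v.1)^T]linearB /= !mulmxBr !mulmxBl.
by rewrite !opprD [RHS]addrACA; congr (_ + _); rewrite [RHS]addrACA.
Qed.

Lemma q2_dpi_vertical z Om : Om^T = - Om ->
  q2_dpi z (z.1 *m Om, z.2 *m Om - Om *m z.2) = 0.
Proof.
move=> sk; rewrite /q2_dpi /= trmx_mul sk mulNmx mulmxN mulmxBr mulmxBl !mulmxA.
by rewrite addrCA subrr addr0 subrr.
Qed.

Lemma q2_dpi_hl z v : (z.1^T *m v.1)^T = - (z.1^T *m v.1) -> q2_dpi z (q2_hl z v) = q2_dpi z v.
Proof.
move=> sk; have -> : q2_hl z v = v - (z.1 *m (z.1^T *m v.1), z.2 *m (z.1^T *m v.1) - z.1^T *m v.1 *m z.2).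
  by apply: injective_projections; rewrite ?fstB ?sndB //= opprB addrA addrAC.
by rewrite q2_dpiB q2_dpi_vertical // subr0.
Qed.

Lemma q2_dpi_bij z : total q2 z ->
  set_bij (horizontal q2 z) (tangent_space (@psd_rank R p r) (polar_map z)) (q2_dpi z).
Proof.
move=> [sU pB]; have UU : z.1^T *m z.1 = 1%:M by exact: sU.
have sB : z.2^T = z.2 := proj1 pB; have uB := posdef_unit pB.
(* Through B = N N^T the point U B U^T is the Gram matrix of U N, so the tangent space results
   stated for Y Y^T apply. *)
have [N uN BN] := psd_sqrt pB.
have fY : full_col_rank (z.1 *m N).
  apply/full_col_rankP => x; rewrite -mulmxA => /(congr1 (mulmx z.1^T)).
  by rewrite [z.1^T *m (z.1 *m _)]mulmxA UU mul1mx mulmx0 => /(congr1 (mulmx (invmx N))); rewrite mulKmx // mulmx0.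
have XE : polar_map z = (z.1 *m N) *m (z.1 *m N)^T.
  by rewrite /polar_map BN trmx_mul !mulmxA.
have rX : psd_rank r (polar_map z) by rewrite XE; exact: psd_rank_gram.
split.
- move=> th /(q2_horizontalP _ sU)[_ sth]; apply/tangent_psdP => //.
  split.
    rewrite /q2_dpi !linearD /= !trmx_mul !trmxK sB sth !mulmxA.
    by rewrite addrC addrA addrAC [X in X + _]addrC.
  move=> x Xx; have Ux : z.1^T *m x = 0.
    have : z.1^T *m (polar_map z *m x) = 0 by rewrite Xx mulmx0.
    rewrite /polar_map !mulmxA UU mul1mx -mulmxA => /(congr1 (mulmx (invmx z.2))).
    by rewrite mulKmx // mulmx0.
  have xU : x^T *m z.1 = 0 by rewrite -[_ *m _]trmxK trmx_mul trmxK Ux trmx0.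
  rewrite /q2_dpi !mulmxDr !mulmxDl !mulmxA xU !mul0mx -!mulmxA Ux !mulmx0 !addr0.
  by rewrite mxE.
- move=> e1 e2; rewrite !inE => /(q2_horizontalP _ sU)[U1 _] /(q2_horizontalP _ sU)[U2 _] e12.
  have Ue : z.1^T *m (e1 - e2).1 = 0 by rewrite fstB mulmxBr U1 U2 subrr.
  have eU : (e1 - e2).1^T *m z.1 = 0 by rewrite -[_ *m _]trmxK trmx_mul trmxK Ue trmx0.
  have k0 : q2_dpi z (e1 - e2) = 0 by rewrite q2_dpiB e12 subrr.
  apply/eqP; rewrite -subr_eq0; move: k0 Ue eU; set w := e1 - e2 => k0 Ue eU.
  (* Multiplying on the right by U kills the last term of the differential, as w_U is orthogonal to
     U; applying U^T then isolates w_B. *)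
  have kU : w.1 *m z.2 + z.1 *m w.2 = 0.
    have := congr1 (mulmx ^~ z.1) k0; rewrite mul0mx /q2_dpi !mulmxDl.
    by rewrite -!mulmxA eU UU !mulmx0 !mulmx1 addr0.
  have w2 : w.2 = 0.
    have := congr1 (mulmx z.1^T) kU; rewrite mulmx0 mulmxDr !mulmxA Ue mul0mx add0r.
    by rewrite UU mul1mx.
  have w1 : w.1 = 0.
    move: kU; rewrite w2 mulmx0 addr0 => /(congr1 (mulmx ^~ (invmx z.2))).
    by rewrite mulmxK // mul0mx.
  by apply/eqP; apply: injective_projections.
move=> v; move/(tangent_psdP _ rX) => [sv vx]; rewrite XE in vx.
have [Z vE] := tangent_psd_gram_ex fY sv vx.
pose A := N *m Z^T.
have {}vE : v = z.1 *m A + A^T *m z.1^T by rewrite vE /A !trmx_mul !trmxK !mulmxA.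
(* To solve for v = U A + A^T U^T, the part of A^T orthogonal to U goes to the first component,
   corrected by B^-1; the part along U gives the symmetric second component. *)
clearbody A; exists ((A^T - z.1 *m (z.1^T *m A^T)) *m invmx z.2, A *m z.1 + (A *m z.1)^T).
  apply/q2_horizontalP => //=; split; last by rewrite linearD /= trmxK addrC.
  rewrite [z.1^T *m _]mulmxA mulmxBr [z.1^T *m (z.1 *m _)]mulmxA UU mul1mx.
  by rewrite subrr mul0mx.
rewrite /q2_dpi /=; set T := A^T - _.
have TT : T^T = A - A *m z.1 *m z.1^T by rewrite /T linearB /= !trmx_mul !trmxK.
have -> : z.1 *m z.2 *m (T *m invmx z.2)^T = z.1 *m T^T.
  by rewrite trmx_mul trmx_inv sB mulmxA mulmxK.
rewrite mulmxKV // TT /T mulmxBl mulmxBr mulmxDr mulmxDl trmx_mul !mulmxA vE.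
move: (z.1 *m A *m z.1 *m _) => c; move: (z.1 *m z.1^T *m _ *m _) => b.
move: (A^T *m _) (z.1 *m A) => a e.
by rewrite [c + b]addrC [a - b + _]addrA subrK -addrA [c + _]addrCA subrr addr0 addrC.
Qed.

(** [gram_orbit] applied to U N and U' N' gives U' = U Q with Q = N Q0 N'^-1. Orthonormality of both
    frames makes Q orthogonal, and B' is recovered as U'^T X U'. *)
Lemma polar_orbit z y : total q2 z -> total q2 y -> polar_map z = polar_map y ->
  exists2 Q, orthogonal_mx Q & y = (z.1 *m Q, Q^T *m z.2 *m Q).
Proof.
move=> [sU pB] [sU' pB'] zy.
have UU : z.1^T *m z.1 = 1%:M := sU; have UU' : y.1^T *m y.1 = 1%:M := sU'.
have [N uN BN] := psd_sqrt pB; have [N' uN' BN'] := psd_sqrt pB'.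
have fY : full_col_rank (z.1 *m N).
  apply/full_col_rankP => x; rewrite -mulmxA => /(congr1 (mulmx z.1^T)).
  rewrite [z.1^T *m (z.1 *m _)]mulmxA UU mul1mx mulmx0 => /(congr1 (mulmx (invmx N))).
  by rewrite mulKmx // mulmx0.
have [|Q0 _ QE] := @gram_orbit _ _ _ _ (y.1 *m N') fY.
  by move: zy; rewrite /polar_map BN BN' !trmx_mul !mulmxA.
pose Q := N *m Q0 *m invmx N'.
have yE : y.1 = z.1 *m Q by rewrite /Q !mulmxA -QE mulmxK.
clearbody Q.
have oQ : orthogonal_mx Q.
  by rewrite /orthogonal_mx /= -UU' yE trmx_mul mulmxA -[_ *m z.1^T *m z.1]mulmxA UU mulmx1.
exists Q => //; rewrite [y]surjective_pairing {1}yE; congr (_, _).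
have -> : y.2 = y.1^T *m polar_map y *m y.1.
  by rewrite /polar_map !mulmxA UU' mul1mx -mulmxA UU' mulmx1.
rewrite -zy yE /polar_map trmx_mul !mulmxA -[_ *m z.1^T *m z.1]mulmxA UU mulmx1.
by rewrite -[_ *m z.1^T *m z.1]mulmxA UU mulmx1.
Qed.

Lemma q2_section d (phi : 'rV[R]_d -> 'M[R]_p) (B : set 'rV[R]_d) :
  open_nbhs (0 : 'rV[R]_d) B -> Cinf B phi -> (forall u, B u -> psd_rank r (phi u)) ->
  exists (psi : 'rV[R]_d -> E) (B' : set 'rV[R]_d),
    [/\ open_nbhs (0 : 'rV[R]_d) B', B' `<=` B, Cinf B' psi &
        forall u, B' u -> total q2 (psi u) /\ polar_map (psi u) = phi u].
Proof.
move=> B0 phiC phiB; have [Y0 fY0 X0] := psd_rank_factor (phiB _ (proj2 B0)).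
have uG0 := posdef_unit (posdef_gram fY0).
pose A u := (phi u *m Y0)^T *m (phi u *m Y0).
have FC (C : set 'rV[R]_d) : open C -> Cinf C phi -> Cinf C (fun u => phi u *m Y0).
  by move=> oC pC k; apply: Ck_mulmx => //; exact: Ck_cst.
have AC : Cinf B A.
  have oB := proj1 B0; move=> k; apply: Ck_mulmx => //; last exact: FC.
  by apply: Ck_trmx => //; exact: FC.
have pA u : B u -> possemidef (A u).
  by move=> _; rewrite /A -[(_ *m _)^T]mulmx1; apply: psd_congr; exact/posdef_psd/posdef1.
(* Since phi 0 = Y0 Y0^T, the matrix A 0 is the cube of Y0^T Y0. *)
have uA : A 0 \in unitmx.
  rewrite /A X0 -[Y0 *m _ *m Y0]mulmxA [(Y0 *m _)^T]trmx_mul mulmxA.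
  by rewrite -[_ *m Y0^T *m Y0]mulmxA !unitmx_mul unitmx_tr uG0.
have [L [B' [B0' BB LC LE]]] := smooth_local_cholesky B0 AC pA uA.
have oB' := proj1 B0'; have phiC' : Cinf B' phi by move=> k; exact: Ck_sub (phiC k).
pose U u := phi u *m Y0 *m L u.
have UC : Cinf B' U by move=> k; apply: Ck_mulmx => //; exact: FC.
exists (fun u => (U u, (U u)^T *m phi u *m U u)), B'; split=> //.
  move=> k; apply: Ck_pair => //; apply: Ck_mulmx => //; apply: Ck_mulmx => //.
  exact: Ck_trmx.
move=> u B'u; have [uAu LAL] := LE _ B'u; have rX := phiB _ (BB _ B'u).
have [Z fZ XZ] := psd_rank_factor rX; have [uL _ _] := cholesky_unit LAL.
have sU : stiefel (U u).
  rewrite /stiefel /= /U [(_ *m L u)^T]trmx_mul [LHS]mulmxA.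
  by rewrite -[_ *m _ *m (phi u *m Y0)]mulmxA; exact: LAL.
have uH : Z^T *m Y0 \in unitmx.
  have AE : A u = (phi u *m Y0)^T *m Z *m (Z^T *m Y0) by rewrite {1}/A {2}XZ !mulmxA.
  apply: unitmx_ker => x Hx; have : A u *m x = 0 by rewrite AE -mulmxA Hx mulmx0.
  by move=> Ax; rewrite -(mulKmx uAu x) Ax mulmx0.
(* phi = Z Z^T equals U L^-1 (Z^T Y0)^-1 Z^T, so its columns lie in the span of U and the projector
   U U^T fixes it. *)
have UX : U u *m ((U u)^T *m phi u) = phi u.
  have XU : phi u = U u *m (invmx (L u) *m invmx (Z^T *m Y0) *m Z^T).
    by rewrite /U !mulmxA mulmxK // [in RHS]XZ -[Z *m Z^T *m Y0]mulmxA mulmxK.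
  by rewrite {1}XU [(U u)^T *m (_ *m _)]mulmxA (sU : (U u)^T *m U u = _) mul1mx -XU.
move: (U u) sU UX => Q sU UX.
have XE : polar_map (Q, Q^T *m phi u *m Q) = phi u.
  have sX : (phi u)^T = phi u by case: rX.
  have XQ : phi u *m Q *m Q^T = phi u by rewrite -[RHS]sX -[in RHS]UX !trmx_mul trmxK sX.
  by rewrite /polar_map /= !mulmxA -[Q *m Q^T *m phi u]mulmxA UX.
split=> //; split=> //=.
have [sX rk psdX] := rX.
apply: psd_unit_posdef; first exact: psd_congr.
rewrite -row_free_unit /row_free eqn_leq rank_leq_row /= -[X in (X <= _)%N]rk.
rewrite -{1}XE /polar_map /=.
by apply: leq_trans (mxrankM_maxl _ _) (mxrankM_maxr _ _).
Qed.

Lemma trace_congr_ge0 m n (B : 'M[R]_n) (v : 'M[R]_(m, n)) : posdef B ->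
  0 <= \tr (B *m v^T *m v).
Proof.
move=> pB; have [->|v0] := eqVneq v 0; first by rewrite mulmx0 mxtrace0.
by apply/ltW/trace_congr_gt0.
Qed.

Lemma trace_sandwich (B C : 'M[R]_r) : posdef B -> C^T = C -> exists2 N : 'M[R]_r,
  N \in unitmx & \tr (B *m C *m B *m C) = \tr ((N^T *m C *m N)^T *m (N^T *m C *m N)).
Proof.
move=> pB sC; have [N uN ->] := psd_sqrt pB; exists N => //.
by rewrite !trmx_mul !trmxK sC -!mulmxA mxtrace_mulC !mulmxA.
Qed.

Lemma q2_metric_gt0 z v : total q2 z -> horizontal q2 z v -> v != 0 -> 0 < metric q2 z v v.
Proof.
move=> [sU pB] /(q2_horizontalP _ sU)[_ sv] v0 /=.
have [N uN tE] := trace_sandwich (W_pos pB) sv; rewrite tE.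
(* Both terms of the metric are squared norms up to congruence, so it is enough that one component
   of v is nonzero. *)
have [v1|v1] := eqVneq v.1 0; last first.
  by apply: ltr_pwDl; [exact/trace_congr_gt0/v1/V_pos|exact: mxtrace_tr_mul_ge0].
apply: ltr_wpDl; first exact/trace_congr_ge0/V_pos.
apply: mxtrace_tr_mul_gt0; apply: contra_neq v0 => v2.
apply: injective_projections => //=.
have uNT : N^T \in unitmx by rewrite unitmx_tr.
by rewrite -[v.2](mulKmx uNT) -[N^T *m v.2](mulmxK uN) v2 mul0mx mulmx0.
Qed.

Lemma Mq2_models : models r q2 (@polar_map R p r) q2_dpi q2_hl.
Proof.
apply: Models.
- move=> z [sU pB]; have [N uN BN] := psd_sqrt pB.
  rewrite /polar_map BN mulmxA -mulmxA -trmx_mul; apply: psd_rank_gram.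
  apply/full_col_rankP => x; rewrite -mulmxA => /(congr1 (mulmx z.1^T)).
  rewrite [z.1^T *m (z.1 *m _)]mulmxA (sU : z.1^T *m z.1 = _) mul1mx mulmx0.
  by move=> /(congr1 (mulmx (invmx N))); rewrite mulKmx // mulmx0.
- move=> z y Mz My; split=> [e|].
    have [Q oQ <-] : cls q2 z y.
      by rewrite e; exists 1%:M; [exact: orthogonal1|rewrite trmx1 !mulmx1 mul1mx -surjective_pairing].
    rewrite /polar_map /= trmx_mul !mulmxA -[_ *m Q *m Q^T]mulmxA (orthogonalP oQ) mulmx1.
    by rewrite -[_ *m Q *m Q^T]mulmxA (orthogonalP oQ) mulmx1.
  move=> /(polar_orbit Mz My)[Q oQ ->]; apply/seteqP; split=> _ [T oT <-] /=.
    exists (Q^T *m T); first by apply: orthogonal_mul => //; exact: orthogonal_tr.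
    congr (_, _); rewrite ?trmx_mul ?trmxK !mulmxA -[_ *m Q *m Q^T]mulmxA (orthogonalP oQ) mulmx1 //.
    by rewrite -[_ *m Q *m Q^T]mulmxA (orthogonalP oQ) mulmx1.
  by exists (Q *m T); [exact: orthogonal_mul|rewrite trmx_mul !mulmxA].
- exact: q2_section.
- move=> d psi B oB psiC k.
  have C1 := Ck_linear (@linear_fst R _ _) (@continuous_fst R _ _) (psiC k) oB.
  have C2 := Ck_linear (@linear_snd R _ _) (@continuous_snd R _ _) (psiC k) oB.
  apply: (@Ck_mulmx _ _ k B _ _ _ (fun u => (psi u).1 *m (psi u).2)) => //.
    exact: Ck_mulmx.
  exact: (Ck_trmx oB C1).
- move=> d psi u a dpsi.
  have [d1 E1] := diff_linear (@linear_fst R _ _) (@continuous_fst R _ _) dpsi.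
  have [d2 E2] := diff_linear (@linear_snd R _ _) (@continuous_snd R _ _) dpsi.
  have [dT ET] := diff_trmx d1; have [d12 E12] := diff_mulmx d1 d2.
  have [_ dE] := diff_mulmx d12 dT.
  have ET1 := etrans (ET a) (congr1 trmx (E1 a)).
  have E12a := etrans (E12 a) (congr2 (fun x y => (psi u).1 *m x + y *m (psi u).2) (E2 a) (E1 a)).
  apply: etrans (dE a) (etrans (congr2 (fun x y => (psi u).1 *m (psi u).2 *m x + y *m (psi u).1^T) ET1 E12a) _).
  by rewrite /q2_dpi mulmxDl addrC [X in X + _]addrC.
- exact: q2_dpi_bij.
- move=> z Mz k u v; apply: injective_projections.
    rewrite -[RHS]/(k *: (q2_hl z u).1 + (q2_hl z v).1) /=.
    by rewrite !mulmxDr -!scalemxAr scalerBr opprD addrACA.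
  rewrite -[RHS]/(k *: (q2_hl z u).2 + (q2_hl z v).2) /=.
  rewrite !mulmxDr mulmxDl -!scalemxAr -!scalemxAl scalerDr scalerBr opprD.
  by rewrite [RHS]addrACA; congr (_ + _); exact: addrACA.
- move=> z v Mz tv; have [sU pB] := Mz; have [sk sv] := q2_tangent tv.
  by split; [exact: q2_lift|exact: q2_hl_horizontal|exact: q2_dpi_hl].
- move=> z u v [_ pB] /=; congr (_ + _).
    rewrite -mxtrace_tr !trmx_mul trmxK (proj1 (V_pos pB)).
    by rewrite mxtrace_mulC mxtrace_mulC mulmxA mxtrace_mulC mulmxA.
  by rewrite -[_ *m W z.2 *m v.2]mulmxA mxtrace_mulC mulmxA.
- move=> z v k u u' _ /=.
  rewrite [(_ + _)^T]linearP /= !mulmxDr !mulmxDl -!scalemxAr -!scalemxAl.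
  by rewrite !mxtraceD !mxtraceZ mulrDr addrACA.
- exact: q2_metric_gt0.
move=> d psi w1 w2 nM cpsi c1 c2.
pose F := nbhs (0 : 'rV[R]_d).
have cfst (w : 'rV[R]_d -> E) : {for (0 : 'rV[R]_d), continuous w} -> (w u).1 @[u --> (0 : 'rV[R]_d)] --> (w 0).1.
  by move=> cw; apply: (@cvg_comp _ _ _ w fst _ (nbhs (w 0))); [exact: cw|exact: continuous_fst].
have csnd (w : 'rV[R]_d -> E) : {for (0 : 'rV[R]_d), continuous w} -> (w u).2 @[u --> (0 : 'rV[R]_d)] --> (w 0).2.
  by move=> cw; apply: (@cvg_comp _ _ _ w snd _ (nbhs (w 0))); [exact: cw|exact: continuous_snd].
have nB : \forall u \near (0 : 'rV[R]_d), posdef (psi u).2 by near=> u; have [] : total q2 (psi u) by near: u.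
have cV : V (psi u).2 @[u --> (0 : 'rV[R]_d)] --> V (psi 0).2.
  exact: (@smooth_on_continuous _ _ _ _ _ _ (fun u => (psi u).2) _ V_smooth nB (csnd _ cpsi)).
have cW : W (psi u).2 @[u --> (0 : 'rV[R]_d)] --> W (psi 0).2.
  exact: (@smooth_on_continuous _ _ _ _ _ _ (fun u => (psi u).2) _ W_smooth nB (csnd _ cpsi)).
have cR (w : 'rV[R]_d -> E) : {for (0 : 'rV[R]_d), continuous w} ->
    (psi u).1^T *m (w u).1 @[u --> (0 : 'rV[R]_d)] --> (psi 0).1^T *m (w 0).1.
  move=> cw; apply: (@cvg_mulmx _ _ F); last exact: cfst.
  by apply: (@cvg_trmx _ _ F); exact: cfst.
have h1 (w : 'rV[R]_d -> E) : {for (0 : 'rV[R]_d), continuous w} ->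
    (q2_hl (psi u) (w u)).1 @[u --> (0 : 'rV[R]_d)] --> (q2_hl (psi 0) (w 0)).1.
  move=> cw; apply: (@cvgB _ _ _ F); first exact: cfst.
  by apply: (@cvg_mulmx _ _ F); [exact: cfst|exact: cR].
have h2 (w : 'rV[R]_d -> E) : {for (0 : 'rV[R]_d), continuous w} ->
    (q2_hl (psi u) (w u)).2 @[u --> (0 : 'rV[R]_d)] --> (q2_hl (psi 0) (w 0)).2.
  move=> cw; apply: (@cvgD _ _ _ F).
    apply: (@cvgB _ _ _ F); first exact: csnd.
    by apply: (@cvg_mulmx _ _ F); [exact: csnd|exact: cR].
  by apply: (@cvg_mulmx _ _ F); [exact: cR|exact: csnd].
apply: (@cvgD _ _ _ F); apply: (@cvg_mxtrace _ _ F).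
  apply: (@cvg_mulmx _ _ F); last exact: h1.
  by apply: (@cvg_mulmx _ _ F) => //; apply: (@cvg_trmx _ _ F); exact: h1.
apply: (@cvg_mulmx _ _ F); last exact: h2.
apply: (@cvg_mulmx _ _ F) => //; apply: (@cvg_mulmx _ _ F) => //; exact: h2.
Unshelve. all: by end_near. Qed.

End PolarModel.

Theorem corollary1 (R : realType) (p r : nat) (r_gt0 : (0 < r)%N)
    (r_le_p : (r <= p)%N)
    (f : 'M[R]_p -> R)
    (f_C2 : Ck 2 [set: 'M[R]_p] f)
    (f_sym : forall X : 'M[R]_p, f X = f X^T)
    (W1 : 'M[R]_(p, r) -> 'M[R]_r) (V2 W2 : 'M[R]_r -> 'M[R]_r)
    (W1_pos : forall Y, full_col_rank Y -> posdef (W1 Y))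
    (V2_pos : forall B, posdef B -> posdef (V2 B))
    (W2_pos : forall B, posdef B -> posdef (W2 B))
    (W1_smooth : smooth_on (@full_col_rank R p r) W1)
    (V2_smooth : smooth_on (@posdef R r) V2)
    (W2_smooth : smooth_on (@posdef R r) W2)
    (W1_inv : forall Y Q, full_col_rank Y -> orthogonal_mx Q ->
       W1 Y = Q *m W1 (Y *m Q) *m Q^T)
    (V2_inv : forall B Q, posdef B -> orthogonal_mx Q ->
       V2 B = Q *m V2 (Q^T *m B *m Q) *m Q^T)
    (W2_inv : forall B Q, posdef B -> orthogonal_mx Q ->
       W2 B = Q *m W2 (Q^T *m B *m Q) *m Q^T) :
  let e := Me p r in
  let q1 := Mq1 W1 in
  let q2 := Mq2 p V2 W2 in
  let h1 := f \o @gram_map R p r in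
  let h2 := f \o @polar_map R p r in
  [/\ (* (a) *)
      forall Y : 'M[R]_(p, r), full_col_rank Y ->
        [/\ FOSP q1 h1 (cls q1 Y) -> FOSP e f (cls e (Y *m Y^T)),
            SOSP q1 h1 (cls q1 Y) -> SOSP e f (cls e (Y *m Y^T)) &
            strict_saddle q1 h1 (cls q1 Y) ->
              strict_saddle e f (cls e (Y *m Y^T))],
      forall (U : 'M[R]_(p, r)) (B : 'M[R]_r), stiefel U -> posdef B ->
        [/\ FOSP q2 h2 (cls q2 (U, B)) -> FOSP e f (cls e (U *m B *m U^T)),
            SOSP q2 h2 (cls q2 (U, B)) -> SOSP e f (cls e (U *m B *m U^T)) &
            strict_saddle q2 h2 (cls q2 (U, B)) ->
              strict_saddle e f (cls e (U *m B *m U^T))],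
      (* (b) *)
      forall X : 'M[R]_p,
        [/\ FOSP e f (cls e X) ->
              exists c, unique (class_over q1 (@gram_map R p r) X) c /\
                        FOSP q1 h1 c,
            SOSP e f (cls e X) ->
              exists c, unique (class_over q1 (@gram_map R p r) X) c /\
                        SOSP q1 h1 c &
            strict_saddle e f (cls e X) ->
              exists c, unique (class_over q1 (@gram_map R p r) X) c /\
                        strict_saddle q1 h1 c] &
      forall X : 'M[R]_p,
        [/\ FOSP e f (cls e X) ->
              exists c, unique (class_over q2 (@polar_map R p r) X) c /\
                        FOSP q2 h2 c,
            SOSP e f (cls e X) ->
              exists c, unique (class_over q2 (@polar_map R p r) X) c /\
                        SOSP q2 h2 c &
            strict_saddle e f (cls e X) ->
              exists c, unique (class_over q2 (@polar_map R p r) X) c /\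
                        strict_saddle q2 h2 c]].
Proof.
move=> e q1 q2 h1 h2.
have M1 := Mq1_models r_le_p W1_pos W1_smooth.
have M2 := Mq2_models r_le_p V2_pos W2_pos V2_smooth W2_smooth.
split.
- by move=> Y fY; exact: (correspondence_push M1 f_C2 fY).
- by move=> U B sU pB; exact: (correspondence_push M2 f_C2 (y := (U, B)) (conj sU pB)).
- exact: (correspondence_lift M1 f_C2).
- exact: (correspondence_lift M2 f_C2).
Qed.
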